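(* Assume $V$ is positive definite with smallest eigenvalue $\lambda$, that $i_n$, $n\ge0$, are i.i.d. uniformly distributed on $\{1,\dots,d\}$ (independent of $(g_n)$), and let $h$ be a $(\kappa,\gamma,V)$-Lipschitz function on $\mathbb R^d$ with $m=E(h(X))$ and $\Sigma^2=\mathrm{Var}(h(X))>0$, $X\sim N(0,V)$. Set $\kappa'=2\kappa d^{1+\gamma}/(\lambda\gamma)$ and $\delta=\lceil 4(\lambda\gamma)^{-1}d\ln(\kappa d/\Sigma)\rceil$. Then for $d\ge3$ and every even $n>0$, $$\Big|E\Big(\frac{\sum_{j=n/2}^{n-1}h(X_j)}{n/2}-m\Big)\Big|\le 2\kappa'\frac{e^{-\lambda\gamma n/(4d)}}{n}.$$ Furthermore, if in addition $n>2\delta$, then $$E\Big(\Big(\frac{\sum_{j=n/2}^{n-1}h(X_j)}{n/2}-m\Big)^2\Big)\le 34\,\frac{\delta\,\Sigma^2}{n}.$$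
   Context: Let $d\ge1$ and let $V$ be a real symmetric $d\times d$ matrix whose diagonal entries all equal $1$. Let $e_i$ be the $i$-th standard basis column vector of $\mathbb R^d$. Let $(i_n)_{n\ge0}$ be a sequence of indices in $\{1,\dots,d\}$ and $(g_n)_{n\ge0}$ i.i.d. standard Gaussian random variables independent of $(i_n)$. Define $X_0=0$ and $X_{n+1}=X_n+(g_n-e_{i_n}^TX_n)\,Ve_{i_n}$ for $n\ge0$. For a vector $x$, $\|x\|$ is its Euclidean norm; for a centered random vector $Z$, $\mathrm{cov}(Z)=E(ZZ^T)$; $A\le B$ means $B-A$ is positive semi-definite. Given $\kappa>0$, $\gamma\in(0,1]$ and a $d\times d$ positive semi-definite matrix $W$, a real-valued Borel function $h$ on $\mathbb R^d$ is $(\kappa,\gamma,W)$-Lipschitz if $E((h(X)-h(X'))^2)\le\kappa^2(E\|X-X'\|^2)^{\gamma}$ for every centered Gaussian vector $(X,X')$ in $\mathbb R^{2d}$ ($X,X'$ each $d$-dimensional) with $\mathrm{cov}(X)\le W$ and $\mathrm{cov}(X')\le W$. *)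

(* Defs.v *)
From HB Require Import structures.
From mathcomp Require Import all_boot all_order all_algebra.
From mathcomp Require Import all_classical all_reals all_analysis.
Set Implicit Arguments. Unset Strict Implicit. Unset Printing Implicit Defensive.
Import Order.TTheory GRing.Theory Num.Theory.
Import numFieldNormedType.Exports.
Local Open Scope classical_set_scope.
Local Open Scope ring_scope.

Definition sqnorm {R : realType} {d : nat} (x : 'cV[R]_d) : R :=
  \sum_(k < d) x k 0 ^+ 2.

Definition psd_le {R : realType} {d : nat} (A B : 'M[R]_d) : Prop :=
  forall u : 'cV[R]_d, 0 <= (u^T *m (B - A) *m u) 0 0.

Definition pos_def {R : realType} {d : nat} (V : 'M[R]_d) : Prop :=
  V^T = V /\ forall u : 'cV[R]_d, u != 0 -> 0 < (u^T *m V *m u) 0 0.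

Definition smallest_eigenvalue {R : realType} {d : nat} (V : 'M[R]_d) (lam : R)
  : Prop :=
  eigenvalue V lam /\ forall mu : R, eigenvalue V mu -> lam <= mu.

Definition ebasis {R : realType} {d : nat} (k : 'I_d) : 'cV[R]_d := delta_mx k 0.

Definition borel_cV {R : realType} {d : nat} (A : set 'cV[R]_d) : Prop :=
  <<s [set U : set 'cV[R]_d | open U] >> A.

Definition borel_fun {R : realType} {d : nat} (h : 'cV[R]_d -> R) : Prop :=
  forall B : set R, measurable B -> borel_cV (h @^-1` B).

Definition centered_normal {dT : measure_display} {T : measurableType dT}
  {R : realType} (P : probability T R) (Y : T -> R) : Prop :=
  measurable_fun setT Y /\
  exists s : R,
    (s = 0 /\ P (Y @^-1` [set 0]) = 1%E) \/
    (0 < s /\ forall B : set R, measurable B ->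
        P (Y @^-1` B) = normal_prob 0 s B).

Definition std_normal {dT : measure_display} {T : measurableType dT}
  {R : realType} (P : probability T R) (Y : T -> R) : Prop :=
  measurable_fun setT Y /\
  forall B : set R, measurable B -> P (Y @^-1` B) = normal_prob 0 1 B.

Definition centered_gaussian_vec {dT : measure_display} {T : measurableType dT}
  {R : realType} {k : nat} (P : probability T R) (Z : T -> 'cV[R]_k) : Prop :=
  forall u : 'cV[R]_k, centered_normal P (fun t => (u^T *m Z t) 0 0).

(** Covariance matrix cov(Z) = E(Z Z^T) of a centered random vector. *)
Definition cov {dT : measure_display} {T : measurableType dT}
  {R : realType} {k : nat} (P : probability T R) (Z : T -> 'cV[R]_k) : 'M[R]_k :=
  \matrix_(a < k, b < k) fine ('E_P[fun t => (Z t a ord0 * Z t b ord0)%R])%E.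

Definition gauss_lipschitz {R : realType} {d : nat} (kappa gamma : R)
  (W : 'M[R]_d) (h : 'cV[R]_d -> R) : Prop :=
  borel_fun h /\
  forall (dT : measure_display) (T : measurableType dT) (P : probability T R)
         (X X' : T -> 'cV[R]_d),
    centered_gaussian_vec P (fun t => col_mx (X t) (X' t)) ->
    psd_le (cov P X) W -> psd_le (cov P X') W ->
    ('E_P[fun t => ((h (X t) - h (X' t)) ^+ 2)%R] <=
      (kappa ^+ 2 * (fine 'E_P[fun t => sqnorm (X t - X' t)%R]) `^ gamma)%:E)%E.

Fixpoint proc {T : Type} {R : realType} {d : nat} (V : 'M[R]_d)
  (i : nat -> T -> 'I_d) (g : nat -> T -> R) (n : nat) (t : T) : 'cV[R]_d :=
  match n with
  | 0 => 0
  | n'.+1 =>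
      let x := proc V i g n' t in
      x + (g n' t - ((ebasis (i n' t))^T *m x) 0 0) *: (V *m ebasis (i n' t))
  end.

(** (i_n) i.i.d. uniform on the d indices, (g_n) i.i.d. N(0,1), and the whole
    family (i_0, g_0, i_1, g_1, ...) mutually independent (product rule on every
    initial segment for arbitrary events; taking full sets gives every
    finite subfamily). *)
Definition iid_model {dT : measure_display} {T : measurableType dT}
  {R : realType} {d : nat} (P : probability T R)
  (i : nat -> T -> 'I_d) (g : nat -> T -> R) : Prop :=
  (forall n (k : 'I_d), measurable (i n @^-1` [set k])) /\
  (forall n (k : 'I_d), P (i n @^-1` [set k]) = (d%:R^-1 : R)%:E) /\
  (forall n, std_normal P (g n)) /\
  (forall (N : nat) (A : nat -> set 'I_d) (B : nat -> set R),
     (forall n, measurable (B n)) ->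
     P (\bigcap_(n in `I_N) (i n @^-1` A n `&` g n @^-1` B n)) =
     (\prod_(n < N) (fine (P (i n @^-1` A n)) * fine (P (g n @^-1` B n))))%:E).

(* Main.v *)
(** The stationary chain: for every index [e], the map [x -> x + (g - x_e) V e]
    preserves N(0, V), and it moves two copies driven by the same noise closer:
    their difference is multiplied by [1 - V e e^T], the projection that removes
    the component along [V e] for the inner product of [V^-1]. Averaging over a
    uniform [e] contracts the squared [V^-1]-norm by [1 - lam / d].
    Conditionally on the indices everything is a linear image of one Gaussian
    vector, so the Lipschitz hypothesis bounds the L2 distance between [h] along
    the chain from [0] and [h] along the stationary chain by
    [kappa d^gamma rho^l], where [rho = (1 - lam / d)^(gamma / 2)]; Jensen handles
    the average over the indices. A chain restarted from [0] at time [j] is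
    independent of the stationary state at time [j], hence the same quantity
    bounds the correlations, and both estimates follow by summing geometric series.
    Gaussian laws are identified from their one-dimensional projections: equality
    of these gives equal means for trigonometric polynomials, whose bounded
    pointwise limits contain the indicators of boxes. *)
Require Import Defs.
From HB Require Import structures.
From mathcomp Require Import all_boot all_order all_algebra.
From mathcomp Require Import all_classical all_reals all_analysis.
From mathcomp Require Import measurable_realfun.
From mathcomp Require Import ring lra.
Set Implicit Arguments. Unset Strict Implicit. Unset Printing Implicit Defensive.
Import Order.TTheory GRing.Theory Num.Theory.
Import numFieldNormedType.Exports.
Local Open Scope classical_set_scope.
Local Open Scope ring_scope.

(** Nothing is assumed about the joint law of [Y] and the noise, so the stationary chain is built on
    [T * T], with [Y] read on the first factor and [(i, g)] on the second; the Lipschitz hypothesis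
    ranges over all probability spaces and so applies there. Conditioning on the indices is done by
    hand: [T * T] is cut into the [d^n] events fixing the first [n] indices, and on each of them the
    noise has [d^-n] times one and the same Gaussian law. Identification of laws is therefore needed
    for finite measures, not only for probabilities. Constants: concavity of powers gives
    [1 - rho >= gap = lam * gamma / (2 d)], so geometric series sum to at most [1 / gap]. The
    integer [delta] is the ceiling of [2 ln (kappa d / Sigma) / gap], a lag at which the coupling
    bound has fallen below [Sigma]. Since [Sigma^2 <= kappa^2 d] and [d >= 3 > e], the factor
    [2 ln (kappa d / Sigma)] is at least 1, whence [1 / gap <= delta]. With [N = n / 2] the second
    moment is at most [10 delta Sigma^2 / N = 20 delta Sigma^2 / n], which leaves room below 34. *)

(** * Change of variables and densities *)

Lemma lebesgue_measure_affine (R : realType) (a b : R) (A : set R) : 0 < b ->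
  measurable A ->
  lebesgue_measure A =
  (b%:E * lebesgue_measure ((fun x : R => (a + b * x)%R) @^-1` A))%E.
Proof.
move=> b0 mA.
have mf : measurable_fun setT (fun x : measurableTypeR R => a + b * x : measurableTypeR R).
  by apply: measurable_funD => //; exact: measurable_funM.
pose bb := NngNum (ltW b0).
pose nu' : {measure set (measurableTypeR R) -> \bar R} :=
  mscale bb (measure_function_pushforward__canonical__measure_function_Measure lebesgue_measure mf).
(* The right-hand side is itself a measure; it only has to give half-open intervals their length. *)
rewrite (@lebesgue_measure_unique R nu')//.
move=> _ [[x y]] _ <-.
rewrite /nu'/= /mscale/= /pushforward/=.
rewrite [X in _ = (_ * lebesgue_measure X)%E](_ : _ = `](x - a) / b, (y - a) / b]%classic); last first.
  apply/seteqP; split => z /=; rewrite !in_itv/= ltr_pdivrMr// ler_pdivlMr// => /andP[? ?]; apply/andP; split; lra.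
rewrite !lebesgue_measure_itv/= !lte_fin ltr_pM2r ?invr_gt0// ltrD2r.
case: ifPn => _; last by rewrite mule0.
by rewrite -!EFinB -EFinM; congr EFin; field; rewrite gt_eqF.
Qed.

Section density.
Import HBNNSimple.

(** Simple functions and monotone convergence. The density is given only through the values of [nu]
    on sets, so the lemma covers normal laws as well as a measure restricted to an event, whose
    density is an indicator. *)
Lemma ge0_integral_density d (T : measurableType d) (R : realType)
    (mu nu : {measure set T -> \bar R}) (p : T -> R) (f : T -> \bar R) :
  (forall x, 0 <= p x) -> measurable_fun setT p ->
  (forall A, measurable A -> nu A = \int[mu]_(x in A) (p x)%:E)%E ->
  measurable_fun setT f -> (forall x, 0 <= f x)%E ->
  (\int[nu]_x f x = \int[mu]_x (f x * (p x)%:E))%E.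
Proof.
move=> p0 mp nuE mf f0.
have mEp : measurable_fun setT (EFin \o p) by exact/measurable_EFinP.
pose f_ := nnsfun_approx measurableT mf.
have mf_ n : measurable_fun setT (EFin \o f_ n) by exact/measurable_EFinP/measurable_funP.
transitivity (limn (fun n => \int[nu]_x (f_ n x)%:E))%E.
  rewrite -monotone_convergence//.
  - by apply: eq_integral => y _; apply/esym/cvg_lim => //; apply: cvg_nnsfun_approx => // *; exact: f0.
  - by move=> n y _; rewrite lee_fin.
  - by move=> y _ m n mn; rewrite lee_fin; exact/lefP/nd_nnsfun_approx.
rewrite [X in limn X](_ : _ = (fun n => \int[mu]_x ((f_ n x)%:E * (p x)%:E))%E).
  rewrite -monotone_convergence//.
  - apply: eq_integral => x _; apply/cvg_lim => //.
    by apply: cvgeZr => //; apply: cvg_nnsfun_approx => // *; exact: f0.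
  - by move=> n; apply: (emeasurable_funM (mf_ n) mEp).
  - by move=> n x _; rewrite mule_ge0// lee_fin.
  - by move=> x _ m n mn; rewrite lee_wpmul2r// ?lee_fin//; exact/lefP/nd_nnsfun_approx.
apply/funext => n.
have mr r : measurable (f_ n @^-1` [set r]) by [].
transitivity (\sum_(k \in range (f_ n)) \int[nu]_x (k * \1_(f_ n @^-1` [set k]) x)%:E)%E.
  under eq_integral do rewrite fimfunE -fsumEFin//.
  rewrite ge0_integral_fsum//.
  - by move=> y; exact/measurable_EFinP/measurable_funM.
  - by move=> y x _; rewrite nnfun_muleindic_ge0.
under [RHS]eq_integral => x _.
  rewrite fimfunE -fsumEFin// ge0_mule_fsuml; first over.
  by move=> r; rewrite EFinM nnfun_muleindic_ge0.
rewrite ge0_integral_fsum//; last 2 first.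
- by move=> y; apply: emeasurable_funM => //; exact/measurable_EFinP/measurable_funM.
- by move=> y x _; rewrite mule_ge0 ?EFinM ?nnfun_muleindic_ge0 ?lee_fin.
apply: eq_fsbigr => r; rewrite inE => -[x _ <-].
have fx0 : 0 <= f_ n x by [].
under eq_integral do rewrite EFinM.
rewrite ge0_integralZl//; last first.
- by exact/measurable_EFinP.
rewrite integral_indic// setIT nuE//.
under [RHS]eq_integral do rewrite EFinM -muleA.
rewrite ge0_integralZl//; last 2 first.
- by apply: emeasurable_funM => //; exact/measurable_EFinP.
- by move=> y _; rewrite mule_ge0// lee_fin.
congr (_ * _)%E; rewrite integral_mkcond; apply: eq_integral => y _.
rewrite patchE indicE; case: ifPn => _; first by rewrite mul1e.
by rewrite mul0e.
Qed.
End density.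

(** * Normal laws on the line: affine images, convolution, variance *)

Section normal_convolution.
Context {R : realType}.
Local Notation N01 := (@normal_prob R 0 1).
Implicit Types (a b v : R) (C : set R).

Lemma measurable_affine a b :
  measurable_fun setT (fun x : measurableTypeR R => a + b * x : measurableTypeR R).
Proof. by apply: measurable_funD => //; exact: measurable_funM. Qed.

Lemma measurable_EFin_normal_pdf m s (D : set (measurableTypeR R)) :
  measurable_fun D (fun x : measurableTypeR R => (normal_pdf m s x)%:E).
Proof.
apply/measurable_EFinP; apply: measurable_funTS.
exact: (measurable_normal_pdf m s).
Qed.

Lemma normal_pdf_mulE (m s x : R) : s != 0 ->
  normal_pdf m s x =
  (Num.sqrt (s ^+ 2 * pi *+ 2))^-1 * expR (- (x - m) ^+ 2 / (s ^+ 2 *+ 2)).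
Proof. by move=> s0; rewrite /normal_pdf (negbTE s0). Qed.

Lemma normal_pdf_shift a b (x y : R) : b != 0 ->
  normal_pdf (a * x) b y = normal_pdf 0 b (- a * x + 1 * y).
Proof.
move=> b0; rewrite !normal_pdf_mulE//.
by have -> : - a * x + 1 * y - 0 = y - a * x by ring.
Qed.

Lemma normal_pdf_affine a b (x : R) : 0 < b ->
  normal_pdf 0 1 x = b * normal_pdf a b (a + b * x).
Proof.
move=> b0; rewrite !normal_pdf_mulE ?oner_neq0 ?gt_eqF//.
rewrite mulrA; congr (_ * expR _).
  rewrite expr1n mul1r -[in RHS]mulrnAr [in RHS]sqrtrM ?sqr_ge0// sqrtr_sqr gtr0_norm// invfM.
  by rewrite mulrA divff ?gt_eqF// mul1r.
by field; rewrite gt_eqF.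
Qed.

Lemma normal_prob_affine a b C : 0 < b -> measurable C ->
  N01 ((fun x => a + b * x) @^-1` C) = normal_prob a b C.
Proof.
move=> b0 mC; have mf := measurable_affine a b.
rewrite /normal_prob.
have mp : measurable_fun (C : set (measurableTypeR R)) (fun x : measurableTypeR R => (normal_pdf a b x)%:E).
  exact: measurable_EFin_normal_pdf.
have p0 : {in C, forall y, (0 <= (normal_pdf a b y)%:E)%E}.
  by move=> y _; rewrite lee_fin normal_pdf_ge0.
have bb0 : 0 <= b by exact: ltW.
transitivity (\int[mscale (NngNum bb0) (measure_function_pushforward__canonical__measure_function_Measure lebesgue_measure mf)]_(x in C)
   (normal_pdf a b x)%:E)%E; last first.
  apply: eq_measure_integral => A mA _.
  by rewrite /= /mscale/= /pushforward -lebesgue_measure_affine.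
rewrite ge0_integral_mscale//=; last by move=> x Cx; apply: p0; rewrite inE.
rewrite (ge0_integral_pushforward mf _ mC mp p0).
have mfC : measurable ((fun x : measurableTypeR R => a + b * x) @^-1` C).
  by rewrite -[X in measurable X]setTI; exact: mf.
rewrite -ge0_integralZl//=.
- by apply: eq_integral => x _; rewrite -EFinM (normal_pdf_affine a x b0).
- apply: measurable_funTS.
  have h := (@measurable_EFin_normal_pdf a b setT). by have := measurableT_comp h mf.
- by move=> x _; rewrite lee_fin normal_pdf_ge0.
Qed.

Lemma normal_prob_opp C : measurable C -> N01 (-%R @^-1` C) = N01 C.
Proof.
move=> mC; rewrite /normal_prob.
have mf : measurable_fun setT (-%R : measurableTypeR R -> measurableTypeR R) by [].
transitivity (\int[pushforward lebesgue_measure (-%R : measurableTypeR R -> measurableTypeR R)]_(x in C)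
   (normal_pdf 0 1 x)%:E)%E; last first.
  apply: eq_measure_integral => A mA _.
  exact: lebesgue_measureN.
rewrite (ge0_integral_pushforward mf _ mC).
- apply: eq_integral => x _ /=; congr EFin; rewrite !normal_pdf_mulE ?oner_neq0//.
  by rewrite !subr0 sqrrN.
- exact: measurable_EFin_normal_pdf.
- by move=> y _; rewrite lee_fin normal_pdf_ge0.
Qed.

(** Completing the square, that is, Bayes' rule: for independent standard [X] and [G] the joint
    density of [X] and [a X + b G] is the marginal density of the second times the conditional
    density of the first, which is normal with mean [a z / c^2] and deviation [b / c]. *)
Lemma normal_pdf_conv a b (x z : R) : b != 0 ->
  let c := Num.sqrt (a ^+ 2 + b ^+ 2) in
  normal_pdf 0 1 x * normal_pdf (a * x) b z =
  normal_pdf 0 c z * normal_pdf (a * z / c ^+ 2) (b / c) x.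
Proof.
move=> b0 c.
have c2 : c ^+ 2 = a ^+ 2 + b ^+ 2 by rewrite sqr_sqrtr// addr_ge0// sqr_ge0.
have c20 : 0 < a ^+ 2 + b ^+ 2.
  by rewrite ltr_wpDl ?sqr_ge0// lt_def sqr_ge0 andbT sqrf_eq0.
have c0 : 0 < c by rewrite sqrtr_gt0.
have c0' : c != 0 by rewrite gt_eqF.
rewrite !normal_pdf_mulE ?oner_neq0 ?mulf_neq0 ?invr_eq0//.
rewrite mulrACA [RHS]mulrACA -!expRD; congr (_ * expR _).
  have sM (p q : R) : 0 <= p -> (Num.sqrt p)^-1 * (Num.sqrt q)^-1 = (Num.sqrt (p * q))^-1.
    by move=> p0; rewrite sqrtrM// invfM.
  rewrite !sM ?mulrn_wge0 ?mulr_ge0 ?sqr_ge0 ?pi_ge0 ?(ltW c0)//; apply: (congr1 (fun u => (Num.sqrt u)^-1)).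
  by field.
rewrite expr_div_n c2; field.
by rewrite gt_eqF.
Qed.

Lemma measurable_lin2 a b : measurable_fun setT
  (fun z : measurableTypeR R * measurableTypeR R => a * z.1 + b * z.2 : measurableTypeR R).
Proof.
by apply: measurable_funD; apply: measurable_funM.
Qed.

Lemma ge0_integral_normal_prob m s (f : measurableTypeR R -> \bar R) :
  measurable_fun setT f -> (forall x, 0 <= f x)%E ->
  (\int[normal_prob m s]_x f x =
   \int[lebesgue_measure]_x (f x * (normal_pdf m s x)%:E))%E.
Proof.
move=> mf f0; apply: ge0_integral_density => //.
  by move=> x; exact: normal_pdf_ge0.
exact: (measurable_normal_pdf m s).
Qed.

(** Condition on the first coordinate, exchange the integrals, and let the conditional density of
    [normal_pdf_conv] integrate to 1. The condition [b > 0] keeps the conditional law absolutely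
    continuous. *)
Lemma normal_prob_conv a b C : 0 < b -> measurable C ->
  (N01 \x N01)%E [set z | C (a * z.1 + b * z.2)] =
  normal_prob 0 (Num.sqrt (a ^+ 2 + b ^+ 2)) C.
Proof.
move=> b0 mC; set c := Num.sqrt _.
have b0' : b != 0 by rewrite gt_eqF.
have mD := measurable_lin2 a b.
have mf (x : R) := @measurable_affine (a * x) b.
transitivity (\int[lebesgue_measure]_x
    ((normal_pdf 0 1 x)%:E * \int[lebesgue_measure]_(z in C) (normal_pdf (a * x) b z)%:E))%E.
  transitivity (\int[N01]_x (normal_prob (a * x) b C))%E.
    apply: eq_integral => x _; rewrite -(normal_prob_affine (a * x) b0 mC) /=.
    congr (normal_prob 0 1 _); apply/seteqP; split => y; rewrite /xsection/= inE//.
  rewrite ge0_integral_normal_prob//.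
  - by apply: eq_integral => x _; rewrite muleC.
  - rewrite [X in measurable_fun _ X](_ : _ = N01 \o xsection [set z | C (a * z.1 + b * z.2)]).
      apply: measurable_fun_xsection.
      by rewrite -[X in measurable X]setTI; exact: mD.
    apply/funext => x; rewrite -(normal_prob_affine (a * x) b0 mC) /=.
    congr (normal_prob 0 1 _); apply/seteqP; split => y; rewrite /xsection/= inE//.
pose G (z : measurableTypeR R * measurableTypeR R) :=
  (normal_pdf 0 1 z.1 * normal_pdf (a * z.1) b z.2 * \1_C z.2)%:E.
transitivity (\int[lebesgue_measure]_x \int[lebesgue_measure]_y G (x, y))%E.
  apply: eq_integral => x _.
  rewrite integral_mkcond -ge0_integralZl//=.
  - apply: eq_integral => y _; rewrite /G/= patchE indicE.
    by case: ifPn => _; rewrite ?mulr1 ?mulr0 ?mule0// EFinM.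
  - apply/(measurable_restrictT _ mC).
    exact: measurable_EFin_normal_pdf.
  - by move=> y _; rewrite patchE; case: ifPn => // _; rewrite lee_fin normal_pdf_ge0.
  - by rewrite lee_fin normal_pdf_ge0.
rewrite (fubini_tonelli G).
- rewrite /normal_prob [RHS]integral_mkcond; apply: eq_integral => z _.
  rewrite /G /= patchE indicE; case: ifPn => _; last first.
    by rewrite (eq_integral (cst 0%E)) ?integral0// => x _; rewrite mulr0.
  under eq_integral do rewrite mulr1 normal_pdf_conv// EFinM.
  rewrite ge0_integralZl//= ?integral_normal_pdf ?mule1//.
  + exact: measurable_EFin_normal_pdf.
  + by move=> x _; rewrite lee_fin normal_pdf_ge0.
  + by rewrite lee_fin normal_pdf_ge0.
- apply/measurable_EFinP; apply: measurable_funM; last first.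
    exact: (measurableT_comp (measurable_indic mC) measurable_snd).
  have -> : (fun z : measurableTypeR R * measurableTypeR R => normal_pdf 0 1 z.1 * normal_pdf (a * z.1) b z.2) =
     (fun z => normal_pdf 0 1 z.1 * normal_pdf 0 b (- a * z.1 + 1 * z.2)).
    by apply/funext => z; rewrite (normal_pdf_shift a z.1 z.2 b0').
  apply: measurable_funM.
    exact: (measurableT_comp (measurable_normal_pdf 0 1) measurable_fst).
  have := measurableT_comp (measurable_normal_pdf 0 b) (measurable_lin2 (- a) 1).
  exact.
- by move=> z; rewrite lee_fin !mulr_ge0// normal_pdf_ge0.
Qed.

(** Exponential moments of [x^2] are known exactly: the factor [exp ((1 - s^-2) x^2 / 2)] turns the
    standard density into [s] times the density of deviation [s], so its mean is [s]. Comparing it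
    with its affine minorant for [s] on either side of 1 squeezes the variance. *)
Lemma normal_variance : (\int[N01]_x (x ^+ 2)%:E = 1)%E.
Proof.
have mx2 : measurable_fun setT (fun x : measurableTypeR R => (x ^+ 2)%:E).
  by apply/measurable_EFinP; apply: measurable_funX; exact: measurable_id.
have Eexp (s : R) : 0 < s ->
    (\int[N01]_x (expR ((1 - (s ^+ 2)^-1) / 2 * x ^+ 2))%:E = s%:E)%E.
  move=> s0; rewrite ge0_integral_normal_prob//; last first.
    apply/measurable_EFinP; apply: measurableT_comp => //.
    by apply: measurable_funM => //; apply: measurable_funX; exact: measurable_id.
  transitivity (\int[lebesgue_measure]_x (s%:E * (normal_pdf 0 s x)%:E))%E.
    apply: eq_integral => x _; rewrite -!EFinM; congr EFin.
    rewrite !normal_pdf_mulE ?oner_neq0 ?gt_eqF// mulrCA -expRD [RHS]mulrA; congr (_ * expR _).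
      rewrite expr1n mul1r -[in RHS]mulrnAr [in RHS]sqrtrM ?sqr_ge0// sqrtr_sqr gtr0_norm// invfM.
      by rewrite mulrA divff ?gt_eqF// mul1r.
    by field; rewrite gt_eqF.
  rewrite ge0_integralZl//= ?integral_normal_pdf ?mule1//.
  - exact: measurable_EFin_normal_pdf.
  - by move=> x _; rewrite lee_fin normal_pdf_ge0.
  - by rewrite lee_fin ltW.
set v := (\int[N01]_x (x ^+ 2)%:E)%E.
have v0 : (0 <= v)%E by apply: integral_ge0 => x _; rewrite lee_fin sqr_ge0.
(* [1 + c x^2 <= exp (c x^2)] integrates to [1 + c v <= s] with [c = (1 - s^-2) / 2]. *)
have ub (s : R) : 1 < s -> (1 + ((1 - (s ^+ 2)^-1) / 2)%:E * v <= s%:E)%E.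
  move=> s1; have s0 : 0 < s by lra.
  have c0 : 0 <= (1 - (s ^+ 2)^-1) / 2.
    by rewrite divr_ge0// subr_ge0 invf_le1 ?exprn_gt0// exprn_ege1// ltW.
  rewrite -(Eexp s s0) /v -ge0_integralZl//; last by move=> x _; rewrite lee_fin sqr_ge0.
  have <- : (\int[N01]_x (cst 1 x) = 1)%E by rewrite integral_cst// mul1e; exact: integral_normal_pdf.
  rewrite -ge0_integralD//; last 2 first.
  - by move=> x _; rewrite mule_ge0// lee_fin sqr_ge0.
  - by apply: emeasurable_funM.
  apply: ge0_le_integral => //.
  - by move=> x _; rewrite adde_ge0// mule_ge0// lee_fin sqr_ge0.
  - by apply: emeasurable_funD => //; apply: emeasurable_funM.
  - apply/measurable_EFinP; apply: measurableT_comp => //.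
    by apply: measurable_funM => //; apply: measurable_funX; exact: measurable_id.
  - by move=> x _; rewrite -EFinM -EFinD lee_fin expR_ge1Dx.
(* At [s = 2] the coefficient of [v] is 3/8, positive, and the bound is finite. *)
have vfin : v \is a fin_num.
  rewrite ge0_fin_numE//; have := ub 2 (ltr1n _ 2).
  have c0 : 0 < (1 - (2 ^+ 2)^-1) / 2 :> R by lra.
  move: v v0 {ub} => [v| |]//= _; first by rewrite ltry.
  by rewrite gt0_muley ?lte_fin// addey// leye_eq.
have lb (s : R) : 0 < s < 1 -> 1 - ((s ^+ 2)^-1 - 1) / 2 * fine v <= s.
  move=> /andP[s0 s1].
  have c0 : 0 <= ((s ^+ 2)^-1 - 1) / 2.
    by rewrite divr_ge0// subr_ge0 invf_ge1 ?exprn_gt0// exprn_ile1// ltW.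
  rewrite lerBlDr -lee_fin EFinD EFinM fineK// -(Eexp s s0) /v -ge0_integralZl//; last first.
    by move=> x _; rewrite lee_fin sqr_ge0.
  have <- : (\int[N01]_x (cst 1 x) = 1)%E by rewrite integral_cst// mul1e; exact: integral_normal_pdf.
  have mexp : measurable_fun setT (fun x : measurableTypeR R => (expR ((1 - (s ^+ 2)^-1) / 2 * x ^+ 2))%:E).
    apply/measurable_EFinP; apply: measurableT_comp => //.
    by apply: measurable_funM => //; apply: measurable_funX; exact: measurable_id.
  rewrite -ge0_integralD//; last 2 first.
  - by move=> x _; rewrite mule_ge0// lee_fin sqr_ge0.
  - by apply: emeasurable_funM.
  apply: ge0_le_integral => //.
  - apply: emeasurable_funD => //; exact: emeasurable_funM.
  - move=> x _; rewrite -EFinM -EFinD lee_fin.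
    have := expR_ge1Dx ((1 - (s ^+ 2)^-1) / 2 * x ^+ 2); lra.
rewrite -(fineK vfin); congr EFin; apply/eqP; rewrite eq_le.
have fv0 : 0 <= fine v by rewrite fine_ge0.
(* Multiplying by [2 s^2] and dividing by [s - 1] removes the degeneracy at [s = 1], where the
   inequality becomes [2 v <= 2]; for [s < 1] the same operation gives the reverse. *)
have {}ub (s : R) : 1 < s -> (s + 1) * fine v <= 2 * s ^+ 2.
  move=> s1; have s0 : 0 < s by lra.
  have s1' : 0 < s - 1 by lra.
  have := ub s s1; rewrite -(fineK vfin) -EFinM -EFinD lee_fin -subr_ge0 => h.
  rewrite -(ler_pM2l s1') -subr_ge0.
  have := mulr_ge0 h (mulr_ge0 (ler0n R 2) (sqr_ge0 s)).
  by congr (0 <= _); field; rewrite gt_eqF.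
have {}lb (s : R) : 0 < s < 1 -> 2 * s ^+ 2 <= (s + 1) * fine v.
  move=> s01; have /andP[s0 s1] := s01.
  have s1' : 0 < 1 - s by lra.
  have := lb s s01; rewrite -subr_ge0 => h.
  rewrite -(ler_pM2l s1') -subr_ge0.
  have := mulr_ge0 h (mulr_ge0 (ler0n R 2) (sqr_ge0 s)).
  by congr (0 <= _); field; rewrite gt_eqF.
apply/andP; split; apply/ler_addgt0Pr => e e0.
- by have := ub (1 + e / 2) ltac:(lra); nra.
- have [e1|e1] := ltP e 1; last by rewrite (le_trans e1)// lerDr.
  by have := lb (1 - e / 2) ltac:(lra); nra.
Qed.
End normal_convolution.

(** * Borel sets of column vectors and equality of laws *)

Section borel_vectors.
Context {R : realType} {k : nat}.

(** An open set is the union of the countably many balls with rational centre and radius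
    [1 / (n + 1)] that it contains. Balls are cubes, so their preimages are finite intersections of
    conditions on single coordinates. *)
Lemma measurable_preimage_open d (T : measurableType d) (X : T -> 'cV[R]_k) :
  (forall a, measurable_fun setT (fun t => X t a 0)) ->
  forall U, open U -> measurable (X @^-1` U).
Proof.
move=> mX U oU.
pose q (z : 'cV[rat]_k * nat) : 'cV[R]_k := map_mx ratr z.1.
pose B (z : 'cV[rat]_k * nat) := ball (q z) (z.2.+1%:R^-1).
pose F (z : 'cV[rat]_k * nat) := [set t | B z (X t) /\ B z `<=` U].
have -> : X @^-1` U = \bigcup_z F z.
  apply/seteqP; split => [t /= Ut|t [z _ [Bz BU]]]; last exact: BU.
  have /nbhs_ballP [e /= e0 eU] : nbhs (X t) U by exact: open_nbhs_nbhs.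
  have [n ne] : exists n : nat, n.+1%:R^-1 < e / 2.
    have e20 : 0 < e / 2 by rewrite divr_gt0.
    have := near_infty_natSinv_lt (PosNum e20).
    by case=> N _ /(_ N (leqnn N)); exists N.
  have r (a : 'I_k) : exists r : rat, `|X t a 0 - ratr r| < n.+1%:R^-1.
    have lt1 : X t a 0 - n.+1%:R^-1 < X t a 0 + n.+1%:R^-1.
      by rewrite ltrD2l gtrN// invr_gt0.
    have [p] := rat_in_itvoo lt1.
    by rewrite in_itv/= => pE; exists p; rewrite ltr_distlC.
  have [p pE] := choice r.
  exists (\col_a p a, n) => //; split.
    by split=> [|a b]; rewrite ?invr_gt0// /q ord1 !mxE/= /ball/= distrC.
  move=> y [_ By]; apply: eU; split=> // a b; rewrite ord1 {b}.
  have := By a 0; have := pE a; rewrite /q !mxE /ball/= => h1 h2.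
  have -> : X t a 0 - y a 0 = (X t a 0 - ratr (p a)) + (ratr (p a) - y a 0) by lra.
  by rewrite (le_lt_trans (ler_normD _ _))// (splitr e) ltrD// (lt_trans _ ne).
apply: countable_bigcupT_measurable => [|z]; first exact: countableP.
have [BU|BU] := pselect (B z `<=` U); last first.
  rewrite (_ : F z = set0)//; apply/seteqP; split => // t [] //.
rewrite (_ : F z = \bigcap_(a in [set: 'I_k])
    ((fun t => X t a 0) @^-1` [set x | `|q z a 0 - x| < z.2.+1%:R^-1])).
  apply: fin_bigcap_measurable => // a _.
  rewrite -[X in measurable X]setTI; apply: mX => //.
  rewrite (_ : [set _ | _] = `](q z a 0 - z.2.+1%:R^-1), (q z a 0 + z.2.+1%:R^-1)[%classic)//.
  by apply/seteqP; split => x /=; rewrite in_itv/= ltr_distlC.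
apply/seteqP; split => [t [[_ Bt] _] a _|t Bt]; first exact: (Bt a 0).
by split=> //; split=> [|a b]; rewrite ?invr_gt0// ord1; exact: (Bt a I).
Qed.

Lemma measurable_preimage_borel d (T : measurableType d) (X : T -> 'cV[R]_k) :
  (forall a, measurable_fun setT (fun t => X t a 0)) ->
  forall A, borel_cV A -> measurable (X @^-1` A).
Proof.
move=> mX A; apply: (smallest_sub (X := [set A | measurable (X @^-1` A)])).
- split => /=.
  + by rewrite preimage_set0.
  + by move=> B mB; rewrite setTD preimage_setC; exact: measurableC.
  + by move=> F mF; rewrite preimage_bigcup; exact: bigcupT_measurable.
- by move=> U oU /=; exact: measurable_preimage_open.
Qed.

Lemma measurable_borel_comp d (T : measurableType d) (X : T -> 'cV[R]_k)
    (h : 'cV[R]_k -> R) :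
  (forall a, measurable_fun setT (fun t => X t a 0)) -> borel_fun h ->
  measurable_fun setT (h \o X).
Proof.
move=> mX bh _ B mB; rewrite setTI comp_preimage.
exact: measurable_preimage_borel (bh B mB).
Qed.

End borel_vectors.

Section equal_laws.
Context {R : realType} d1 d2 (T1 : measurableType d1) (T2 : measurableType d2).
Variables (mu1 : {measure set T1 -> \bar R}) (mu2 : {measure set T2 -> \bar R}).

Lemma eq_law_integral d (T : measurableType d) (U1 : T1 -> T) (U2 : T2 -> T)
    (F : T -> \bar R) :
  measurable_fun setT U1 -> measurable_fun setT U2 ->
  (forall B, measurable B -> mu1 (U1 @^-1` B) = mu2 (U2 @^-1` B)) ->
  measurable_fun setT F ->
  (\int[mu1]_x F (U1 x) = \int[mu2]_x F (U2 x))%E.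
Proof.
move=> mU1 mU2 UU mF.
have ge0 (G : T -> \bar R) : measurable_fun setT G -> (forall y, 0 <= G y)%E ->
    (\int[mu1]_x G (U1 x) = \int[mu2]_x G (U2 x))%E.
  move=> mG G0.
  have := ge0_integral_pushforward mU1 mu1 measurableT mG (fun y _ => G0 y).
  rewrite preimage_setT => <-.
  have := ge0_integral_pushforward mU2 mu2 measurableT mG (fun y _ => G0 y).
  rewrite preimage_setT => <-.
  by apply: eq_measure_integral => A mA _; exact: UU.
rewrite integralE [RHS]integralE.
have pE S (U : S -> T) : (fun x => F (U x))^\+%E = F^\+%E \o U.
  by apply/funext => x; rewrite /= !funeposE.
have nE S (U : S -> T) : (fun x => F (U x))^\-%E = F^\-%E \o U.
  by apply/funext => x; rewrite /= !funenegE.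
rewrite (pE _ U1) (pE _ U2) (nE _ U1) (nE _ U2); congr (_ - _)%E; apply: ge0 => //.
- exact: measurable_funepos.
- exact: measurable_funeneg.
Qed.

End equal_laws.

(** * Trigonometric polynomials in several variables *)

Section trigonometric_polynomials.
Context {R : realType} {k : nat}.
Implicit Types (f g : 'cV[R]_k -> R).

(** A triple of the list holds amplitude, phase and frequency vector. With phases, cosines alone
    also produce sines and constants. *)
Definition trigpoly f := exists s : seq (R * R * 'cV[R]_k), forall y,
  f y = \sum_(z <- s) z.1.1 * cos ((z.2^T *m y) 0 0 + z.1.2).

Lemma trigpoly_ext f g : f =1 g -> trigpoly f -> trigpoly g.
Proof. by move=> /funext ->. Qed.

Lemma trigpoly_cos c phi (u : 'cV[R]_k) : trigpoly (fun y => c * cos ((u^T *m y) 0 0 + phi)).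
Proof. by exists [:: (c, phi, u)] => y; rewrite big_seq1. Qed.

Lemma trigpoly_cst c : trigpoly (fun=> c).
Proof.
apply: trigpoly_ext (trigpoly_cos c 0 0) => y.
by rewrite trmx0 mul0mx mxE addr0 cos0 mulr1.
Qed.

Lemma trigpolyD f g : trigpoly f -> trigpoly g -> trigpoly (fun y => f y + g y).
Proof.
by move=> [s sE] [t tE]; exists (s ++ t) => y; rewrite big_cat/= -sE -tE.
Qed.

Lemma trigpoly_sum I (s : seq I) (F : I -> 'cV[R]_k -> R) :
  (forall i, trigpoly (F i)) -> trigpoly (fun y => \sum_(i <- s) F i y).
Proof.
move=> tF; elim: s => [|i s IH].
  by apply: trigpoly_ext (trigpoly_cst 0) => y; rewrite big_nil.
by apply: trigpoly_ext (trigpolyD (tF i) IH) => y; rewrite big_cons.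
Qed.

(** Product-to-sum formula: frequencies and phases are added and subtracted, amplitudes multiplied
    and halved. *)
Lemma trigpolyM f g : trigpoly f -> trigpoly g -> trigpoly (fun y => f y * g y).
Proof.
move=> [s sE] [t tE].
apply: (@trigpoly_ext (fun y => \sum_(z <- s) \sum_(w <- t)
   ((z.1.1 * w.1.1 / 2) * cos (((z.2 + w.2)^T *m y) 0 0 + (z.1.2 + w.1.2)) +
    (z.1.1 * w.1.1 / 2) * cos (((z.2 - w.2)^T *m y) 0 0 + (z.1.2 - w.1.2))))).
  move=> y; rewrite sE tE mulr_suml; apply: eq_bigr => z _.
  rewrite mulr_sumr; apply: eq_bigr => w _.
  rewrite !linearD/= linearN/= mulmxDl mulmxBl.
  move: (z.2^T *m y) (w.2^T *m y) => A B.
  have -> : (A + B) 0 0 = A 0 0 + B 0 0 by rewrite mxE.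
  have -> : (A - B) 0 0 = A 0 0 - B 0 0 by rewrite !mxE.
  have -> : A 0 0 + B 0 0 + (z.1.2 + w.1.2) = (A 0 0 + z.1.2) + (B 0 0 + w.1.2) by ring.
  have -> : A 0 0 - B 0 0 + (z.1.2 - w.1.2) = (A 0 0 + z.1.2) - (B 0 0 + w.1.2) by ring.
  by rewrite cosB cosD; field.
by do 2 apply: trigpoly_sum => ?; apply: trigpolyD; exact: trigpoly_cos.
Qed.

Lemma trigpoly_prod I (s : seq I) (F : I -> 'cV[R]_k -> R) :
  (forall i, trigpoly (F i)) -> trigpoly (fun y => \prod_(i <- s) F i y).
Proof.
move=> tF; elim: s => [|i s IH].
  by apply: trigpoly_ext (trigpoly_cst 1) => y; rewrite big_nil.
by apply: trigpoly_ext (trigpolyM (tF i) IH) => y; rewrite big_cons.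
Qed.

Lemma trigpolyX f n : trigpoly f -> trigpoly (fun y => f y ^+ n).
Proof.
move=> tf; apply: trigpoly_ext (trigpoly_prod (index_iota 0 n) (fun=> tf)) => y.
by rewrite prodr_const_nat subn0.
Qed.

Lemma trigpoly_sin_coord (a : 'I_k) c L :
  trigpoly (fun y => sin ((y a 0 - c) / L)).
Proof.
apply: trigpoly_ext (trigpoly_cos 1 (- c / L - pi / 2) (L^-1 *: delta_mx a 0)) => y.
rewrite linearZ/= -scalemxAl mxE mul1r trmx_delta -rowE mxE.
set z := (y a 0 - c) / L.
have -> : L^-1 * y a 0 + (- c / L - pi / 2) = z - pi / 2 by rewrite /z; ring.
by rewrite cosB cos_pihalf mulr0 add0r sin_pihalf mulr1.
Qed.

End trigonometric_polynomials.

(** * Polynomials converging to a step function on the unit interval *)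

Section step_polynomial.
Context {R : realType}.
Implicit Types s x : R.

Lemma bernoulli_ineq x n : - 1 <= x -> 1 + n%:R * x <= (1 + x) ^+ n.
Proof.
move=> x1; elim: n => [|n IH]; first by rewrite mul0r addr0 expr0.
rewrite exprS (le_trans _ (ler_wpM2l _ IH))//; last by lra.
rewrite -natr1; have : 0 <= n%:R * x ^+ 2 by rewrite mulr_ge0// sqr_ge0.
nra.
Qed.

(** Choose [q] strictly between the square root of [s] and 1. Bernoulli's inequality for [1 / q]
    bounds [n q^n], and [n s^n <= (n q^n) q^n]. *)
Lemma cvg_natr_mul_exp s : 0 <= s < 1 -> (fun n => n%:R * s ^+ n) @ \oo --> (0 : R).
Proof.
move=> /andP[s0 s1].
pose q := (1 + Num.sqrt s) / 2.
have q1 : Num.sqrt s < 1 by rewrite -sqrtr1 ltr_sqrt.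
have q0 := sqrtr_ge0 s.
have hq : 0 < q < 1 by rewrite /q; lra.
have sq : s <= q ^+ 2.
  rewrite -{1}(sqr_sqrtr s0) ler_sqr ?nnegrE//; rewrite /q; lra.
pose x := q^-1 - 1.
have x0 : 0 < x by rewrite /x subr_gt0 invf_gt1; lra.
have nq n : n%:R * q ^+ n <= x^-1.
  have := @bernoulli_ineq x n ltac:(lra).
  rewrite [1 + x](_ : _ = q^-1); last by rewrite /x addrC subrK.
  rewrite exprVn => h.
  have qn0 : 0 < q ^+ n by rewrite exprn_gt0//; lra.
  rewrite -ler_pdivlMr// (mulrC x^-1) ler_pdivlMr//.
  by apply: le_trans h; rewrite lerDr.
apply: (@squeeze_cvgr _ _ _ _ (cst 0) (fun n => x^-1 * q ^+ n)).
- apply: nearW => n; apply/andP; split; first by rewrite mulr_ge0// exprn_ge0.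
  apply: (@le_trans _ _ (n%:R * (q ^+ 2) ^+ n)).
    by rewrite ler_wpM2l// lerXn2r ?nnegrE// sqr_ge0.
  rewrite -exprM mulnC exprM expr2 mulrA ler_wpM2r// exprn_ge0//; lra.
- exact: cvg_cst.
- rewrite -(mulr0 x^-1); apply: cvgM; first exact: cvg_cst.
  by apply: cvg_expr; rewrite gtr0_norm; lra.
Qed.

(** These are the polynomials of the elementary proof of the Stone-Weierstrass theorem. The exponent
    is chosen so that exponent times [s^n] equals [n (2 s)^n], which tends to 0 for [s < 1/2] and is
    at least [n] for [s >= 1/2]. *)
Definition step_poly (n : nat) s : R := (1 - s ^+ n) ^+ (n * 2 ^ n).

Lemma step_poly_itv n s : 0 <= s <= 1 -> 0 <= step_poly n s <= 1.
Proof.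
move=> /andP[s0 s1]; have := exprn_ge0 n s0; have := exprn_ile1 n s0 s1 => h1 h2.
rewrite /step_poly exprn_ge0 ?exprn_ile1//; lra.
Qed.

(** Below 1/2 Bernoulli gives [(1 - x)^k >= 1 - k x]. From 1/2 on, [(1 - x)^k (1 + x)^k <= 1] and
    Bernoulli for the second factor give a bound [1 / (n + 1)]. The value at 1/2 itself is 0, in
    agreement with the strict inequality. *)
Lemma cvg_step_poly s : 0 <= s <= 1 ->
  (fun n => step_poly n s) @ \oo --> ((s < 1 / 2)%R%:R : R).
Proof.
move=> s01; have /andP[s0 s1] := s01.
have p01 n := step_poly_itv n s01.
have sn0 n := exprn_ge0 n s0.
have sn1 n := exprn_ile1 n s0 s1.
have mE n : (n * 2 ^ n)%:R * s ^+ n = n%:R * (2 * s) ^+ n :> R.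
  by rewrite natrM natrX exprMn mulrA.
have [s2|s2] := ltP.
  apply: (@squeeze_cvgr _ _ _ _ (fun n => 1 - n%:R * (2 * s) ^+ n) (cst 1)).
  - apply: nearW => n; apply/andP; split; last by case/andP: (p01 n).
    have := @bernoulli_ineq (- s ^+ n) (n * 2 ^ n) ltac:(by rewrite lerN2).
    by rewrite mulrN mE.
  - rewrite -[X in _ --> X](subr0 1); apply: cvgB; first exact: cvg_cst.
    by apply: cvg_natr_mul_exp; lra.
  - exact: cvg_cst.
apply: (@squeeze_cvgr _ _ _ _ (cst 0) (fun n => n.+1%:R^-1)).
- apply: nearW => n; apply/andP; split; first by case/andP: (p01 n).
  have h := @bernoulli_ineq (s ^+ n) (n * 2 ^ n) ltac:(by rewrite (le_trans _ (sn0 n))// lerN10).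
  rewrite mE in h.
  have le1 : (1 + s ^+ n) ^+ (n * 2 ^ n) * step_poly n s <= 1.
    have := sn0 n; have := sn1 n; rewrite /step_poly -exprMn => *.
    by apply: exprn_ile1; nra.
  have h2 : n%:R <= n%:R * (2 * s) ^+ n.
    by rewrite ler_peMr// exprn_ege1//; lra.
  rewrite -[leRHS]mul1r ler_pdivlMr ?ltr0Sn// mulrC.
  apply: le_trans le1; apply: ler_wpM2r; first by case/andP: (p01 n).
  by rewrite -natr1; lra.
- exact: cvg_cst.
- exact: cvg_harmonic.
Qed.

End step_polynomial.

(** * Finite measures with equal one-dimensional projections *)

Section cramer_wold.
Context {R : realType} {k : nat} d1 d2 (T1 : measurableType d1) (T2 : measurableType d2).
Variables (mu1 : {measure set T1 -> \bar R}) (mu2 : {measure set T2 -> \bar R}).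
Variables (X1 : T1 -> 'cV[R]_k) (X2 : T2 -> 'cV[R]_k).
Hypothesis fin1 : (mu1 setT < +oo)%E.
Hypothesis fin2 : (mu2 setT < +oo)%E.
Hypothesis mX1 : forall u : 'cV[R]_k, measurable_fun setT (fun t => (u^T *m X1 t) 0 0).
Hypothesis mX2 : forall u : 'cV[R]_k, measurable_fun setT (fun t => (u^T *m X2 t) 0 0).
Hypothesis X12 : forall (u : 'cV[R]_k) (B : set R), measurable B ->
  mu1 ((fun t => (u^T *m X1 t) 0 0) @^-1` B) = mu2 ((fun t => (u^T *m X2 t) 0 0) @^-1` B).

Let same_mean (f : 'cV[R]_k -> R) := [/\ measurable_fun setT (f \o X1),
  measurable_fun setT (f \o X2) &
  (\int[mu1]_x (f (X1 x))%:E = \int[mu2]_x (f (X2 x))%:E)%E].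

Let bounded_int d (T : measurableType d) (mu : {measure set T -> \bar R}) (f : T -> R) M :
  (mu setT < +oo)%E -> measurable_fun setT f -> (forall x, `|f x| <= M) ->
  mu.-integrable setT (EFin \o f).
Proof.
move=> fin mf fM; apply: measurable_bounded_integrable => //.
exists M; split; first exact: num_real.
by move=> x Mx y _ /=; rewrite (le_trans (fM y))// ltW.
Qed.

(** Each cosine is a function of a single linear form, whose law is the same on both sides by
    hypothesis; linearity of the integral needs the boundedness of the terms. *)
Let same_mean_trigpoly f : trigpoly f -> same_mean f.
Proof.
move=> [s /funext ->]; elim: s => [|[[c phi] u] s [m1 m2 IH]].
  split; [apply: eq_measurable_fun (measurable_cst (0:R))|
          apply: eq_measurable_fun (measurable_cst (0:R))|].
  - by move=> x _ /=; rewrite big_nil.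
  - by move=> x _ /=; rewrite big_nil.
  - by under eq_integral do rewrite big_nil; under [RHS]eq_integral do rewrite big_nil; rewrite !integral0.
set g := (fun y => \sum_(z <- s) _) in m1 m2 IH *.
pose F (x : R) := c * cos (x + phi).
have mF : measurable_fun setT F.
  apply: measurable_funM => //; apply: (@measurableT_comp _ _ _ _ _ _ (@cos R)).
    exact: continuous_measurable_fun (@continuous_cos R).
  exact: measurable_funD.
have E : (fun y => \sum_(z <- (c, phi, u) :: s) z.1.1 * cos ((z.2^T *m y) 0 0 + z.1.2)) =
    (fun y => F ((u^T *m y) 0 0) + g y).
  by apply/funext => y; rewrite big_cons.
have bF y : `|F y| <= `|c|.
  by rewrite normrM ler_piMr// ler_norml cos_geN1 cos_le1.
have [M gM] : exists M, forall y, `|g y| <= M.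
  exists (\sum_(z <- s) `|z.1.1|) => y; rewrite (le_trans (ler_norm_sum _ _ _))//.
  apply: ler_sum => z _; by rewrite normrM ler_piMr// ler_norml cos_geN1 cos_le1.
have mF1 := measurableT_comp mF (mX1 u).
have mF2 := measurableT_comp mF (mX2 u).
rewrite E; split.
- exact: measurable_funD mF1 m1.
- exact: measurable_funD mF2 m2.
under eq_integral do rewrite EFinD; under [RHS]eq_integral do rewrite EFinD.
rewrite integralD//; last 2 first.
- by apply: (@bounded_int _ _ _ _ `|c|) => // x; exact: bF.
- by apply: (@bounded_int _ _ _ _ M) => // x; exact: gM.
rewrite integralD//; last 2 first.
- by apply: (@bounded_int _ _ _ _ `|c|) => // x; exact: bF.
- by apply: (@bounded_int _ _ _ _ M) => // x; exact: gM.
congr (_ + _)%E; last exact: IH.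
apply: (eq_law_integral (F := EFin \o F) (mX1 u) (mX2 u) (X12 u)).
exact/measurable_EFinP.
Qed.

Let same_mean_lim (f_ : nat -> 'cV[R]_k -> R) f :
  (forall n, same_mean (f_ n)) -> (forall n y, `|f_ n y| <= 1) ->
  (forall y, f_ ^~ y @ \oo --> f y) -> same_mean f.
Proof.
move=> sf f1 fl.
have lim_int d (T : measurableType d) (mu : {measure set T -> \bar R}) (X : T -> 'cV[R]_k) :
    (mu setT < +oo)%E -> (forall n, measurable_fun setT (f_ n \o X)) ->
    measurable_fun setT (f \o X) /\
    ((fun n => \int[mu]_x (f_ n (X x))%:E) @ \oo --> \int[mu]_x (f (X x))%:E)%E.
  move=> fin mf; have mfX : measurable_fun setT (f \o X).
    by apply: (measurable_fun_cvg mf) => x _; exact: fl.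
  split=> //.
  have [||| | |] := @dominated_convergence _ _ _ mu setT measurableT
     (fun n x => (f_ n (X x))%:E) (fun x => (f (X x))%:E) (cst 1%E).
  - by move=> n; exact/measurable_EFinP/mf.
  - exact/measurable_EFinP.
  - by apply: aeW => x _; apply: cvg_EFin; [exact: nearW|exact: fl].
  - by apply: (@bounded_int _ _ _ (cst 1) 1) => // x; rewrite normr1.
  - by apply: aeW => x n _; rewrite lee_fin.
  - by move=> _ _.
have [m1 l1] := lim_int _ _ mu1 X1 fin1 (fun n => let: And3 h _ _ := sf n in h).
have [m2 l2] := lim_int _ _ mu2 X2 fin2 (fun n => let: And3 _ h _ := sf n in h).
split => //; apply: (cvg_unique _ l1) => //.
rewrite (_ : (fun n => _) = (fun n => \int[mu2]_x (f_ n (X2 x))%:E)%E)//.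
by apply/funext => n; case: (sf n).
Qed.

Let box (c : 'I_k -> R) : set 'cV[R]_k := [set y | forall a, y a 0 < c a].

(** Two nested limits. For fixed [l], step polynomials in [(1 + sin z) / 2] are trigonometric
    polynomials and converge to the indicator of [sin z < 0], where [z] is [(y a 0 - c a) / l.+1].
    As [l] grows, [z] ends up in []-pi, pi[], where the sine has the sign of its argument. *)
Let same_mean_box c : same_mean (fun y => \prod_(a < k) (y a 0 < c a)%R%:R).
Proof.
pose s l (y : 'cV[R]_k) a := (1 + sin ((y a 0 - c a) / l.+1%:R)) / 2 : R.
have s01 l y a : 0 <= s l y a <= 1.
  by rewrite /s; have := sin_geN1 ((y a 0 - c a) / l.+1%:R);
    have := sin_le1 ((y a 0 - c a) / l.+1%:R); lra.
have prod01 (F : 'I_k -> R) : (forall a, 0 <= F a <= 1) -> `|\prod_(a < k) F a| <= 1.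
  move=> F01; have /andP[p0 p1] : 0 <= \prod_(a < k) F a <= 1.
    elim/big_ind: _ => [|x y /andP[? ?] /andP[? ?]|a _]; [by rewrite ler01 lexx| |exact: F01].
    by rewrite mulr_ge0// mulr_ile1.
  by rewrite ger0_norm.
have cM : continuous (fun x : R * R => x.1 * x.2) by exact: mul_continuous.
apply: (@same_mean_lim (fun l y => \prod_(a < k) (sin ((y a 0 - c a) / l.+1%:R) < 0)%R%:R)).
- move=> l; apply: (@same_mean_lim (fun n y => \prod_(a < k) step_poly n (s l y a))).
  + move=> n; apply: same_mean_trigpoly; apply: trigpoly_prod => a.
    apply: trigpolyX; apply: trigpolyD; first exact: trigpoly_cst.
    apply: trigpoly_ext (trigpolyM (trigpoly_cst (- 1))
      (trigpolyX n (trigpolyM (trigpolyD (trigpoly_cst 1) (trigpoly_sin_coord a (c a) l.+1%:R))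
                   (trigpoly_cst 2^-1)))) => y.
    by rewrite mulN1r.
  + by move=> n y; apply: prod01 => a; exact: step_poly_itv.
  + move=> y; apply: cvg_big => // a _.
    rewrite (_ : (sin _ < 0) = (s l y a < 1 / 2)); last first.
      by rewrite /s ltr_pM2r ?invr_gt0// gtrDl.
    exact: cvg_step_poly.
- by move=> n y; apply: prod01 => a; case: ltP; rewrite ?ler01 ?lexx ?lter01.
- move=> y; apply: cvg_big => // a _.
  set z := y a 0 - c a.
  rewrite (_ : (y a 0 < c a) = (z < 0)); last by rewrite subr_lt0.
  apply: cvg_near_cst.
  have zl : \forall l \near \oo, `|z| / l.+1%:R < pi.
    near=> l; rewrite ltr_pdivrMr// (@lt_le_trans _ _ (l.+1%:R))//.
      near: l; exists (Num.truncn `|z|).+1 => // l /= hl.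
      rewrite (lt_trans (truncnS_gt _))// ltr_nat; exact: leq_trans hl _.
    by rewrite ler_peMl// (le_trans _ (pi_ge2 R))// ler1n.
  near=> l.
  have hl : `|z| / l.+1%:R < pi by near: l.
  congr (_%:R); congr nat_of_bool.
  have l0 : 0 < (l.+1%:R : R)^-1 by rewrite invr_gt0.
  case: (ltrgtP z 0) => z0.
  + rewrite ltr0_norm// mulNr in hl.
    by rewrite -oppr_gt0 -sinN sin_gt0_pi// hl oppr_gt0 pmulr_llt0// z0.
  + rewrite gtr0_norm// in hl.
    by rewrite ltNge ltW// sin_gt0_pi// hl mulr_gt0.
  + by rewrite z0 mul0r sin0 ltxx.
Unshelve. all: by end_near.
Qed.

(** The lower-left boxes are stable under intersection, exhaust the space and generate the Borel
    sets, so two finite measures that agree on them coincide. The total masses need not be 1, so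
    that laws restricted to an event can be compared. *)
Lemma cramer_wold (A : set 'cV[R]_k) : borel_cV A ->
  mu1 (X1 @^-1` A) = mu2 (X2 @^-1` A).
Proof.
have coordE (T : Type) (X : T -> 'cV[R]_k) a :
    (fun t => X t a 0) = (fun t => ((delta_mx a 0 : 'cV[R]_k)^T *m X t) 0 0).
  by apply/funext => t; rewrite trmx_delta -rowE mxE.
have mc1 a : measurable_fun setT (fun t => X1 t a 0) by rewrite coordE.
have mc2 a : measurable_fun setT (fun t => X2 t a 0) by rewrite coordE.
pose BT := g_sigma_algebraType [set U : set 'cV[R]_k | open U].
have mB1 : measurable_fun setT (X1 : T1 -> BT).
  by move=> _ B mB; rewrite setTI; exact: measurable_preimage_borel.
have mB2 : measurable_fun setT (X2 : T2 -> BT).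
  by move=> _ B mB; rewrite setTI; exact: measurable_preimage_borel.
pose nu1 : {measure set BT -> \bar R} :=
  measure_function_pushforward__canonical__measure_function_Measure mu1 mB1.
pose nu2 : {measure set BT -> \bar R} :=
  measure_function_pushforward__canonical__measure_function_Measure mu2 mB2.
pose G : set (set BT) := [set box c | c in [set: 'I_k -> R]].
have mcoord a : measurable_fun setT (fun y : BT => y a 0 : R).
  apply: (measurability (@RGenInftyO.G R)); first exact: RGenInftyO.measurableE.
  move=> _ [_ [x ->] <-]; rewrite setTI; apply: sub_sigma_algebra => /=.
  apply: open_comp; last exact: open_lt.
  by move=> y _; exact: coord_continuous.
have Gm : G `<=` measurable.
  move=> _ [c _ <-]; rewrite (_ : box c = \bigcap_(a in [set: 'I_k])
      ((fun y : BT => y a 0) @^-1` `]-oo, c a[%classic)).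
    apply: fin_bigcap_measurable => // a _.
    by rewrite -[X in measurable X]setTI; exact: mcoord.
  apply/seteqP; split => [y yc a _|y yc a] /=; first by rewrite in_itv/=; exact: yc.
  by have := yc a I; rewrite /= in_itv.
move=> bA.
apply: (@g_sigma_algebra_measure_unique _ R BT G Gm (fun n => box (fun=> n%:R)) _ _ nu1 nu2).
- by move=> n; exists (fun=> n%:R).
- apply/seteqP; split => // y _.
  exists (Num.truncn (\sum_a `|y a 0|)).+1 => // a.
  apply: le_lt_trans (truncnS_gt _); rewrite (bigD1 a)//= ler_wpDr// ?ler_norm//.
  exact: sumr_ge0.
- move=> _ _ [c _ <-] [c' _ <-]; exists (fun a => Num.min (c a) (c' a)) => //.
  apply/seteqP; split => y yc; last by move=> a; rewrite lt_min; case: yc => -> ->.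
  by split=> a; have := yc a; rewrite lt_min => /andP[].
- move=> _ [c _ <-].
  have [m1 m2] := same_mean_box c.
  have indE (y : 'cV[R]_k) : \prod_(a < k) ((y a 0 < c a)%R%:R : R) = \1_(box c) y.
    rewrite indicE; case: (pselect (box c y)) => [yc|yc].
      by rewrite mem_set//= big1// => a _; rewrite (yc a).
    rewrite memNset//=.
    have [a /negbTE ya] : exists a, ~~ (y a 0 < c a).
      by apply: contra_notP yc => /forallNP h a; apply/negP => /negP/h.
    by rewrite (bigD1 a)//= ya mul0r.
  under eq_integral do rewrite indE; under [RHS]eq_integral do rewrite indE.
  have mbox : measurable (box c : set BT) by apply: Gm; exists c.
  rewrite (_ : (fun x => (\1_(box c) (X1 x))%:E) = (fun x => (\1_(X1 @^-1` box c) x)%:E))//.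
  rewrite (_ : (fun x => (\1_(box c) (X2 x))%:E) = (fun x => (\1_(X2 @^-1` box c) x)%:E))//.
  rewrite !integral_indic// ?setIT//.
  + by rewrite -[X in measurable X]setTI; exact: (mB2 measurableT _ mbox).
  + by rewrite -[X in measurable X]setTI; exact: (mB1 measurableT _ mbox).
- move=> n; have mb : measurable (X1 @^-1` box (fun=> n%:R)).
    by rewrite -[X in measurable X]setTI; apply: (mB1 measurableT); apply: Gm; exists (fun=> n%:R).
  by apply: le_lt_trans fin1; apply: (@le_measure _ _ _ mu1); rewrite ?inE.
- move: bA; apply: smallest_sub; first exact: smallest_sigma_algebra.
  move=> U oU; pose GT := g_sigma_algebraType G.
  apply: (@measurable_preimage_open R k _ GT (fun y => y)) => // a.
  apply: (measurability (@RGenInftyO.G R)); first exact: RGenInftyO.measurableE.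
  move=> _ [_ [x ->] <-]; rewrite setTI.
  (* An open half-space for coordinate [a] is the union of the boxes whose other bounds are [n];
     thus coordinates, and with them open sets, are measurable for the boxes. *)
  rewrite (_ : _ @^-1` _ = \bigcup_n box (fun b => if b == a then x else n%:R)).
    by apply: bigcupT_measurable => n; apply: sub_sigma_algebra; exists (fun b => if b == a then x else n%:R).
  apply/seteqP; split => [y|y [n _ /(_ a)]]; rewrite /= in_itv/= ?eqxx// => ya.
  exists (Num.truncn (\sum_a `|y a 0|)).+1 => // b; case: eqP => [->//|_].
  apply: le_lt_trans (truncnS_gt _); rewrite (bigD1 b)//= ler_wpDr// ?ler_norm//.
  exact: sumr_ge0.
Qed.

End cramer_wold.

(** * Centered normal laws, the degenerate one included *)

Section centered_normal_laws.
Context {R : realType}.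
Local Notation N01 := (@normal_prob R 0 1).

(** The centered normal law of variance [v], including the Dirac mass [v = 0]. *)
Definition nrm (v : R) (B : set R) : \bar R :=
  N01 ((fun x => Num.sqrt v * x) @^-1` B).

Lemma measurable_scale (v : R) : measurable_fun setT (fun x : measurableTypeR R => v * x : R).
Proof. exact: measurable_funM. Qed.

Lemma measurable_scale_preimage (v : R) (B : set R) : measurable B ->
  measurable ((fun x : measurableTypeR R => v * x) @^-1` B).
Proof. by move=> mB; rewrite -[X in measurable X]setTI; exact: measurable_scale. Qed.

Lemma nrmT (v : R) : nrm v setT = 1%E.
Proof. by rewrite /nrm preimage_setT; exact: integral_normal_pdf. Qed.

Lemma nrm0 (B : set R) : nrm 0 B = (\1_B 0)%:E.
Proof.
rewrite /nrm sqrtr0 indicE; case: (pselect (B 0)) => B0.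
  rewrite mem_set//= -(nrmT 0) /nrm; congr (N01 _).
  by apply/seteqP; split => x //= _; rewrite mul0r.
rewrite memNset//= (_ : _ @^-1` _ = set0) ?measure0//.
by apply/seteqP; split => x //=; rewrite mul0r.
Qed.

Lemma nrm_fin_num (v : R) (B : set R) : measurable B -> nrm v B \is a fin_num.
Proof. by move=> mB; apply: fin_num_measure; exact: measurable_scale_preimage. Qed.

(** The symmetry of the standard normal law lets the scale have either sign. *)
Lemma nrm_sqr (s : R) (B : set R) : measurable B ->
  nrm (s ^+ 2) B = N01 ((fun x => s * x) @^-1` B).
Proof.
move=> mB; rewrite /nrm sqrtr_sqr.
have [s0|s0] := ger0P s => //.
rewrite -[RHS]normal_prob_opp; last exact: measurable_scale_preimage.
by congr (N01 _); apply/seteqP; split => x /=; rewrite mulrN mulNr.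
Qed.

Lemma nrm_normal_prob (s : R) (B : set R) : 0 < s -> measurable B ->
  nrm (s ^+ 2) B = normal_prob 0 s B.
Proof.
move=> s0 mB; rewrite nrm_sqr//; apply: etrans (normal_prob_affine 0 s0 mB).
have -> : (fun x => 0 + s * x) = (fun x => s * x) by apply/funext => x; rewrite add0r.
by [].
Qed.

(** Only the second variance has to be positive for the convolution by densities; the Dirac case
    [w = 0] is a product set. *)
Lemma nrm_conv (v w : R) (C : set R) : 0 <= v -> 0 <= w -> measurable C ->
  (N01 \x N01)%E [set z | C (Num.sqrt v * z.1 + Num.sqrt w * z.2)] = nrm (v + w) C.
Proof.
move=> v0; rewrite le_eqVlt => /predU1P[<-|w0] mC.
  rewrite addr0 sqrtr0.
  rewrite (_ : [set _ | _] = ((fun x => Num.sqrt v * x) @^-1` C) `*` setT); last first.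
    by apply/seteqP; split => z /=; rewrite mul0r addr0// => -[].
  rewrite product_measure1E//; last exact: measurable_scale_preimage.
  rewrite [X in (_ * X)%E = _](_ : _ = 1%E) ?mule1//; exact: integral_normal_pdf.
have sw0 : 0 < Num.sqrt w by rewrite sqrtr_gt0.
apply: etrans (normal_prob_conv (Num.sqrt v) sw0 mC) _; rewrite !sqr_sqrtr ?(ltW w0)//.
have vw : 0 < v + w by rewrite ltr_wpDl.
by rewrite -nrm_normal_prob ?sqrtr_gt0// sqr_sqrtr// ltW.
Qed.

(** The hypothesis determines the joint law of [U] and [W] on rectangles, hence everywhere: it is
    [a] times the law of two independent scaled normals. The mass [a] allows [mu] to be a
    probability restricted to an event. *)
Lemma law_add d (T : measurableType d) (mu : {measure set T -> \bar R})
    (U W : T -> R) (a v w : R) :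
  measurable_fun setT U -> measurable_fun setT W -> 0 <= a -> 0 <= v -> 0 <= w ->
  (forall C D, measurable C -> measurable D ->
     mu (U @^-1` C `&` W @^-1` D) = (a%:E * (nrm v C * nrm w D))%E) ->
  forall C, measurable C -> mu ((fun t => U t + W t) @^-1` C) = (a%:E * nrm (v + w) C)%E.
Proof.
move=> mU mW a0 v0 w0 UW C mC.
have mUW : measurable_fun setT (fun t => (U t, W t)) by exact: measurable_fun_pair.
pose f (z : measurableTypeR R * measurableTypeR R) : R * R :=
  (Num.sqrt v * z.1, Num.sqrt w * z.2).
have mf : measurable_fun setT f.
  apply: measurable_fun_pair.
    exact: (measurableT_comp (measurable_scale (Num.sqrt v)) measurable_fst).
  exact: (measurableT_comp (measurable_scale (Num.sqrt w)) measurable_snd).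
pose m1 : {measure set (R * R) -> \bar R} :=
  measure_function_pushforward__canonical__measure_function_Measure mu mUW.
pose m2 : {measure set (R * R) -> \bar R} :=
  mscale (NngNum a0) (measure_function_pushforward__canonical__measure_function_Measure (N01 \x N01)%E mf).
pose G : set (set (R * R)) := [set A `*` B | A in measurable & B in measurable].
have m12 A : G A -> m1 A = m2 A.
  move=> [A1 mA1 [A2 mA2 <-]].
  rewrite /m1 /m2 /= /mscale/= /pushforward.
  transitivity (mu (U @^-1` A1 `&` W @^-1` A2)); first by [].
  rewrite UW//; congr (_ * _)%E.
  transitivity ((N01 \x N01)%E (((fun x => Num.sqrt v * x) @^-1` A1) `*` ((fun x => Num.sqrt w * x) @^-1` A2))); last by [].
  by rewrite product_measure1E//; exact: measurable_scale_preimage.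
have mD : measurable [set z : R * R | C (z.1 + z.2)].
  rewrite -[X in measurable X]setTI.
  have : measurable_fun setT (fun z : R * R => z.1 + z.2) by exact: measurable_funD.
  by apply.
have := @measure_unique _ R _ G (fun=> setT) _ _ _ _ m1 m2 m12 _ _ mD.
rewrite -(nrm_conv v0 w0 mC) /m1 /m2 /= /mscale/= /pushforward; apply.
- by rewrite measurable_prod_measurableType.
- move=> _ _ [A mA [B mB <-]] [A' mA' [B' mB' <-]].
  exists (A `&` A'); first exact: measurableI.
  by exists (B `&` B'); [exact: measurableI|rewrite setXI].
- by move=> n; exists setT => //; exists setT => //; rewrite setXTT.
- by apply/seteqP; split => // x _; exists 0%N.
- move=> n; rewrite preimage_setT.
  have := UW setT setT measurableT measurableT.
  by rewrite !preimage_setT setTI !nrmT !mule1 => ->; rewrite ltry.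
Qed.

End centered_normal_laws.

(** * Joint law of the indices and of linear combinations of the noise *)

Section iid_model_laws.
Context {R : realType} {d : nat} dT (T : measurableType dT) (P : probability T R).
Variables (i : nat -> T -> 'I_d) (g : nat -> T -> R).
Hypothesis model : iid_model P i g.

Let mi n (A : set 'I_d) : measurable (i n @^-1` A).
Proof.
rewrite (_ : _ @^-1` _ = \bigcup_(k in A) (i n @^-1` [set k])); last first.
  by apply/seteqP; split => [t At|t [k Ak /= ->]]//; exists (i n t).
by apply: fin_bigcup_measurable => // k _; case: model.
Qed.

Lemma iid_measurable_g n : measurable_fun setT (g n).
Proof. by have [_ [_ [/(_ n)[]]]] := model. Qed.

Let mgB n (B : set R) : measurable B -> measurable (g n @^-1` B).
Proof. by move=> mB; rewrite -[X in measurable X]setTI; exact: iid_measurable_g. Qed.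

Lemma measurable_lincomb (c : nat -> R) k :
  measurable_fun setT (fun t => \sum_(m < k) c m * g m t).
Proof.
apply: measurable_sum => m; apply: measurable_funM => //; exact: iid_measurable_g.
Qed.

Let E N (A : nat -> set 'I_d) (B : nat -> set R) : set T :=
  \bigcap_(n in `I_N) (i n @^-1` A n `&` g n @^-1` B n).

Let mE N A B : (forall n, measurable (B n)) -> measurable (E N A B).
Proof.
by move=> mB; apply: fin_bigcap_measurable => // n _; apply: measurableI => //; exact: mgB.
Qed.

(** Induction on the number [k] of summands. The statement keeps arbitrary constraints [B n] for
    [n >= k], because the induction step hands the event on the last summand over to [B]. *)
Lemma iid_law_lincomb_aux N (A : nat -> set 'I_d) (c : nat -> R) k : (k <= N)%N ->
  forall B : nat -> set R, (forall n, measurable (B n)) ->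
  (forall n, (n < k)%N -> B n = setT) ->
  forall C, measurable C ->
  P ((fun t => \sum_(m < k) c m * g m t) @^-1` C `&` E N A B) =
  ((\prod_(n < N) (fine (P (i n @^-1` A n)) * fine (P (g n @^-1` B n))))%:E *
   nrm (\sum_(m < k) c m ^+ 2) C)%E.
Proof.
have [_ [_ [gN PE]]] := model.
elim: k => [|k IH] kN B mB BT C mC.
  rewrite big_ord0 nrm0 indicE.
  rewrite (_ : (fun t => _) = cst 0); last by apply/funext => t; rewrite big_ord0.
  rewrite preimage_cst -PE//; case: ifPn => _; first by rewrite setTI mule1.
  by rewrite set0I measure0 mule0.
set a := \prod_(n < N) _.
have a0 : 0 <= a by apply: prodr_ge0 => n _; rewrite mulr_ge0// fine_ge0.
have lt0 v : 0 <= \sum_(m < v) c m ^+ 2 by apply: sumr_ge0 => m _; exact: sqr_ge0.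
pose U t := \sum_(m < k) c m * g m t.
pose W t := c k * g k t.
have mW : measurable_fun setT W by apply: measurable_funM => //; exact: iid_measurable_g.
have -> : (fun t => \sum_(m < k.+1) c m * g m t) = (fun t => U t + W t).
  by apply/funext => t; rewrite big_ord_recr.
rewrite big_ord_recr /=.
pose mu : {measure set T -> \bar R} := mrestr P (@mE N A B mB).
suff K C1 C2 : measurable C1 -> measurable C2 -> P (U @^-1` C1 `&` W @^-1` C2 `&` E N A B) =
    (a%:E * (nrm (\sum_(i0 < k) c i0 ^+ 2) C1 * nrm (c k ^+ 2) C2))%E.
  exact: (@law_add R _ T mu U W a _ _ (measurable_lincomb c k) mW a0 (lt0 k) (sqr_ge0 _) K C mC).
move=> mC1 mC2.
(* The event on [c k * g k] becomes a constraint on [g k], at a place where [B] was the full set. *)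
pose B' n := if n == k then (fun x => c k * x) @^-1` C2 else B n.
have mC2' : measurable ((fun x : R => c k * x) @^-1` C2) by exact: (measurable_scale_preimage (c k) mC2).
have mB' n : measurable (B' n) by rewrite /B'; case: ifP.
have B'T n : (n < k)%N -> B' n = setT.
  by move=> nk; rewrite /B' ltn_eqF// BT// ltnW.
have -> : U @^-1` C1 `&` W @^-1` C2 `&` E N A B = U @^-1` C1 `&` E N A B'.
  apply/seteqP; split => [t [[UC WC] Et]|t [UC Et]].
    split => // n nN; have [h1 h2] := Et n nN; split => //.
    by rewrite /B'; case: eqP => // ->.
  have [_ /=] := Et k kN; rewrite /B' eqxx => WC.
  split=> // n nN; have [h1] := Et n nN; rewrite /B'.
  by case: eqP => [nk _|_ //]; split => //; rewrite nk BT.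
rewrite (IH (ltnW kN) B' mB' B'T C1 mC1).
have gC2 : P (g k @^-1` ((fun x => c k * x) @^-1` C2)) = nrm (c k ^+ 2) C2.
  rewrite nrm_sqr//; have [_ gP] := gN k; exact: gP.
have -> : \prod_(n < N) (fine (P (i n @^-1` A n)) * fine (P (g n @^-1` B' n))) =
    a * fine (nrm (c k ^+ 2) C2).
  rewrite /a (bigD1 (Ordinal kN))//= [in RHS](bigD1 (Ordinal kN))//=.
  rewrite /B' eqxx BT// preimage_setT probability_setT mulr1 gC2 mulrAC.
  congr (_ * _ * _); apply: eq_bigr => n nk.
  by rewrite (_ : (val n == k) = false)//; apply/negbTE; move: nk; apply: contra => /eqP nk; apply/eqP/val_inj.
rewrite EFinM fineK ?nrm_fin_num// -muleA; congr (_ * _)%E.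
exact: muleC.
Qed.

Lemma iid_law_lincomb N (A : nat -> set 'I_d) (c : nat -> R) C : measurable C ->
  P ((fun t => \sum_(m < N) c m * g m t) @^-1` C `&` \bigcap_(n in `I_N) (i n @^-1` A n)) =
  ((\prod_(n < N) fine (P (i n @^-1` A n)))%:E * nrm (\sum_(m < N) c m ^+ 2) C)%E.
Proof.
move=> mC.
have := @iid_law_lincomb_aux N A c N (leqnn N) (fun=> setT) (fun=> measurableT) (fun _ _ => erefl) C mC.
rewrite /E; under eq_bigcapr do rewrite preimage_setT setIT.
move=> ->; congr (_%:E * _)%E; apply: eq_bigr => n _.
by rewrite preimage_setT probability_setT mulr1.
Qed.

End iid_model_laws.

(** * Integrable and square integrable variables *)

Section square_integrable.
Context {R : realType} d (T : measurableType d) (P : probability T R).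
Implicit Types (f g : T -> R).

Definition L1 f := P.-integrable setT (EFin \o f).
Definition Ex f : R := \int[P]_x f x.
(** Measurability of [f] is required separately, since it does not follow from that of its
    square. *)
Definition L2 f := measurable_fun setT f /\ L1 (fun x => f x ^+ 2).

Lemma ExpE f : L1 f -> ('E_P[f] = (Ex f)%:E)%E.
Proof. by move=> lf; rewrite unlock /Ex /Rintegral fineK//; exact: integrable_fin_num. Qed.

Lemma L1_measurable f : L1 f -> measurable_fun setT f.
Proof. by move=> /integrableP[mf _]; exact/measurable_EFinP. Qed.

Lemma L1_cst c : L1 (cst c).
Proof.
exact: finite_measure_integrable_cst.
Qed.

Lemma L1_ext f g : f =1 g -> L1 f -> L1 g.
Proof. by move=> /funext ->. Qed.

Lemma L1D f g : L1 f -> L1 g -> L1 (fun x => f x + g x).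
Proof. by move=> lf lg; apply: eq_integrable (integrableD _ lf lg). Qed.

Lemma L1Z c f : L1 f -> L1 (fun x => c * f x).
Proof. by move=> lf; apply: eq_integrable (integrableZl _ c lf). Qed.

Lemma L1_sum I (s : seq I) (F : I -> T -> R) :
  (forall i, L1 (F i)) -> L1 (fun x => \sum_(i <- s) F i x).
Proof.
move=> LF; elim: s => [|i s IH].
  by apply: L1_ext (L1_cst 0) => x; rewrite big_nil.
by apply: L1_ext (L1D (LF i) IH) => x; rewrite big_cons.
Qed.

Lemma L1_le f g : measurable_fun setT f -> L1 g -> (forall x, `|f x| <= g x) -> L1 f.
Proof.
move=> mf lg fg; apply: (le_integrable measurableT _ _ lg).
  exact/measurable_EFinP.
by move=> x _ /=; rewrite lee_fin (le_trans (fg x))// ler_norm.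
Qed.

Lemma Ex_cst c : Ex (cst c) = c.
Proof.
rewrite /Ex Rintegral_cst// [X in fine X](_ : _ = 1%E) ?mulr1//.
exact: (@probability_setT _ _ _ P).
Qed.

Lemma ExD f g : L1 f -> L1 g -> Ex (fun x => f x + g x) = Ex f + Ex g.
Proof. exact: RintegralD. Qed.

Lemma ExB f g : L1 f -> L1 g -> Ex (fun x => f x - g x) = Ex f - Ex g.
Proof. exact: RintegralB. Qed.

Lemma ExZ c f : L1 f -> Ex (fun x => c * f x) = c * Ex f.
Proof. exact: RintegralZl. Qed.

Lemma Ex_sum I (s : seq I) (F : I -> T -> R) : (forall i, L1 (F i)) ->
  Ex (fun x => \sum_(i <- s) F i x) = \sum_(i <- s) Ex (F i).
Proof.
move=> LF; elim: s => [|i s IH].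
  rewrite big_nil -[RHS](Ex_cst 0); congr Ex; apply/funext => x; exact: big_nil.
rewrite big_cons -IH -ExD//; last exact: L1_sum.
by congr Ex; apply/funext => x; rewrite big_cons.
Qed.

Lemma Ex_le f g : L1 f -> L1 g -> (forall x, f x <= g x) -> Ex f <= Ex g.
Proof. by move=> lf lg fg; apply: le_Rintegral. Qed.

Lemma Ex_ge0 f : (forall x, 0 <= f x) -> 0 <= Ex f.
Proof. by move=> f0; apply: Rintegral_ge0 => x _; exact: f0. Qed.

Lemma L2M f g : L2 f -> L2 g -> L1 (fun x => f x * g x).
Proof.
move=> [mf lf] [mg lg]; apply: (L1_le _ (L1D lf lg)); first exact: measurable_funM.
move=> x; rewrite normrM; have := sqr_ge0 (`|f x| - `|g x|).
by rewrite sqrrB !real_normK ?num_real// => h; have := sqr_ge0 (f x); have := sqr_ge0 (g x); lra.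
Qed.

Lemma L2_cst c : L2 (cst c).
Proof. by split => //; apply: L1_ext (L1_cst (c ^+ 2)) => x. Qed.

Lemma L2_L1 f : L2 f -> L1 f.
Proof. by move=> lf; apply: L1_ext (L2M lf (L2_cst 1)) => x; rewrite mulr1. Qed.

Lemma L2_ext f g : f =1 g -> L2 f -> L2 g.
Proof. by move=> /funext ->. Qed.

Lemma L2D f g : L2 f -> L2 g -> L2 (fun x => f x + g x).
Proof.
move=> lf lg; split; first by apply: measurable_funD; [case: lf|case: lg].
apply: L1_ext (L1D (L1D (L2M lf lf) (L2M lg lg)) (L1Z 2 (L2M lf lg))) => x; ring.
Qed.

Lemma L2Z c f : L2 f -> L2 (fun x => c * f x).
Proof.
move=> [mf lf]; split; first exact: measurable_funM.
by apply: L1_ext (L1Z (c ^+ 2) lf) => x; rewrite exprMn.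
Qed.

Lemma L2B f g : L2 f -> L2 g -> L2 (fun x => f x - g x).
Proof. by move=> lf lg; apply: L2_ext (L2D lf (L2Z (- 1) lg)) => x; rewrite mulN1r. Qed.

Lemma L2_sum I (s : seq I) (F : I -> T -> R) :
  (forall i, L2 (F i)) -> L2 (fun x => \sum_(i <- s) F i x).
Proof.
move=> LF; elim: s => [|i s IH].
  by apply: L2_ext (L2_cst 0) => x; rewrite big_nil.
by apply: L2_ext (L2D (LF i) IH) => x; rewrite big_cons.
Qed.

Lemma L2_lt_pinfty f : measurable_fun setT f -> (\int[P]_x (f x ^+ 2)%:E < +oo)%E -> L2 f.
Proof.
move=> mf foo; split => //; apply/integrableP; split.
  exact/measurable_EFinP/measurable_funX.
by under eq_integral do rewrite /= ger0_norm ?sqr_ge0//.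
Qed.

End square_integrable.

(** * Gaussian vectors with a given covariance *)

Section gaussian_vectors.
Context {R : realType}.

(** The covariance is a parameter and all projections, degenerate ones included, are described by
    [nrm]; [gaussian_centered] and [centered_gaussian_vecP] translate to and from
    [centered_gaussian_vec]. *)
Definition gaussian_vec d (T : measurableType d) (P : probability T R) k
    (Z : T -> 'cV[R]_k) (C : 'M[R]_k) :=
  [/\ C^T = C, forall u : 'cV[R]_k, 0 <= (u^T *m C *m u) 0 0 &
    forall u : 'cV[R]_k, measurable_fun setT (fun t => (u^T *m Z t) 0 0) /\
      forall B, measurable B ->
        P ((fun t => (u^T *m Z t) 0 0) @^-1` B) = nrm ((u^T *m C *m u) 0 0) B].

Lemma nrm_second_moment d (T : measurableType d) (P : probability T R) (U : T -> R) v :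
  0 <= v -> measurable_fun setT U ->
  (forall B, measurable B -> P (U @^-1` B) = nrm v B) ->
  (\int[P]_t (U t ^+ 2)%:E = v%:E)%E.
Proof.
move=> v0 mU UE.
have mx2 : measurable_fun setT (fun x : R => (x ^+ 2)%:E).
  by apply/measurable_EFinP; apply: measurable_funX; exact: measurable_id.
have := @eq_law_integral R _ _ T (measurableTypeR R) P (normal_prob 0 1) _ R U
  (fun x => Num.sqrt v * x) (fun x => (x ^+ 2)%:E) mU (measurable_scale _) UE mx2.
move=> ->.
have mx2' : measurable_fun setT (fun x : measurableTypeR R => (x ^+ 2)%:E) by exact: mx2.
under eq_integral do rewrite exprMn sqr_sqrtr// EFinM.
rewrite ge0_integralZl//=; first by rewrite normal_variance mule1.
by move=> x _; rewrite lee_fin sqr_ge0.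
Qed.

Section moments.
Context d (T : measurableType d) (P : probability T R) k (Z : T -> 'cV[R]_k) (C : 'M[R]_k).
Hypothesis gZ : gaussian_vec P Z C.

Let mZ u := (let: And3 _ _ h := gZ in h u).1.
Let law u := (let: And3 _ _ h := gZ in h u).2.
Let C0 u := let: And3 _ h _ := gZ in h u.
Let sym := let: And3 h _ _ := gZ in h.

Lemma gaussian_measurable_coord a : measurable_fun setT (fun t => Z t a 0).
Proof.
have -> : (fun t => Z t a 0) = (fun t => ((delta_mx a 0 : 'cV[R]_k)^T *m Z t) 0 0).
  by apply/funext => t; rewrite trmx_delta -rowE mxE.
exact: mZ.
Qed.

Lemma gaussian_L2_lin (u : 'cV[R]_k) : L2 P (fun t => (u^T *m Z t) 0 0).
Proof.
apply: L2_lt_pinfty => //; rewrite (nrm_second_moment (C0 u) (mZ u) (law u)).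
exact: ltry.
Qed.

Lemma gaussian_Ex_lin (u : 'cV[R]_k) :
  Ex P (fun t => (u^T *m Z t) 0 0 ^+ 2) = (u^T *m C *m u) 0 0.
Proof.
by rewrite /Ex /Rintegral (nrm_second_moment (C0 u) (mZ u) (law u)).
Qed.

Let coordE a t : Z t a 0 = ((delta_mx a 0 : 'cV[R]_k)^T *m Z t) 0 0.
Proof. by rewrite trmx_delta -rowE mxE. Qed.

Lemma gaussian_L2_coord a : L2 P (fun t => Z t a 0).
Proof.
by apply: L2_ext (gaussian_L2_lin (delta_mx a 0)) => t; rewrite coordE.
Qed.

(** Polarization: the variances of [Z a], [Z b] and [Z a + Z b] are known, being variances of
    projections. *)
Lemma gaussian_Ex_coord a b : Ex P (fun t => Z t a 0 * Z t b 0) = C a b.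
Proof.
have La := gaussian_L2_coord a; have Lb := gaussian_L2_coord b.
have Cab x y : ((delta_mx x 0 : 'cV[R]_k)^T *m C *m (delta_mx y 0 : 'cV[R]_k)) 0 0 = C x y.
  by rewrite trmx_delta -rowE -colE !mxE.
have e x : Ex P (fun t => Z t x 0 ^+ 2) = C x x.
  by rewrite -Cab -gaussian_Ex_lin; congr Ex; apply/funext => t; rewrite -coordE.
have eab : Ex P (fun t => (Z t a 0 + Z t b 0) ^+ 2) = C a a + C b b + 2 * C a b.
  transitivity (Ex P (fun t => ((delta_mx a 0 + delta_mx b 0 : 'cV[R]_k)^T *m Z t) 0 0 ^+ 2)).
    congr Ex; apply/funext => t; rewrite linearD/= mulmxDl.
    by rewrite [in RHS]mxE -!coordE.
  rewrite gaussian_Ex_lin.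
  have -> : (delta_mx a 0 + delta_mx b 0 : 'cV[R]_k)^T = (delta_mx a 0)^T + (delta_mx b 0)^T by rewrite linearD.
  rewrite !(mulmxDl, mulmxDr).
  have sumE (A B : 'M[R]_1) : (A + B) 0 0 = A 0 0 + B 0 0 by rewrite mxE.
  rewrite !sumE !Cab (_ : C a b = C b a); last by rewrite -[in LHS]sym mxE.
  by ring.
have : Ex P (fun t => (Z t a 0 + Z t b 0) ^+ 2) =
       Ex P (fun t => (Z t a 0 ^+ 2 + Z t b 0 ^+ 2) + 2 * (Z t a 0 * Z t b 0)).
  by congr Ex; apply/funext => t; ring.
have [_ La2] := La; have [_ Lb2] := Lb.
rewrite eab ExD; [|exact: L1D|by apply: L1Z; exact: L2M].
rewrite ExD// ExZ ?e; last exact: L2M.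
lra.
Qed.

Lemma gaussian_cov : cov P Z = C.
Proof.
apply/matrixP => a b; rewrite mxE ExpE ?gaussian_Ex_coord//.
by apply: L2M; exact: gaussian_L2_coord.
Qed.

Lemma gaussian_L1_quad (S : 'M[R]_k) : L1 P (fun t => ((Z t)^T *m S *m Z t) 0 0).
Proof.
apply: (@L1_ext _ _ _ _ (fun t => \sum_b \sum_a S a b * (Z t a 0 * Z t b 0))).
  move=> t; rewrite mxE; apply: eq_bigr => b _; rewrite mxE mulr_suml.
  by apply: eq_bigr => a _; rewrite mxE; ring.
do 2 apply: L1_sum => ?; apply: L1Z; apply: L2M; exact: gaussian_L2_coord.
Qed.

Lemma gaussian_Ex_quad (S : 'M[R]_k) :
  Ex P (fun t => ((Z t)^T *m S *m Z t) 0 0) = \tr (S *m C).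
Proof.
transitivity (Ex P (fun t => \sum_b \sum_a S a b * (Z t a 0 * Z t b 0))).
  congr Ex; apply/funext => t; rewrite mxE; apply: eq_bigr => b _; rewrite mxE mulr_suml.
  by apply: eq_bigr => a _; rewrite mxE; ring.
have LL a b : L1 P (fun t => Z t a 0 * Z t b 0) by apply: L2M; exact: gaussian_L2_coord.
rewrite Ex_sum; last by move=> b; apply: L1_sum => a; exact: L1Z.
rewrite /mxtrace.
under eq_bigr => b _.
  rewrite Ex_sum; last by move=> a; exact: L1Z.
  over.
rewrite exchange_big/=; apply: eq_bigr => a _; rewrite mxE; apply: eq_bigr => b _.
by rewrite ExZ// gaussian_Ex_coord -[in LHS]sym mxE.
Qed.

Lemma gaussian_lin l (A : 'M[R]_(l, k)) : gaussian_vec P (fun t => A *m Z t) (A *m C *m A^T).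
Proof.
have E (u : 'cV[R]_l) : (fun t => (u^T *m (A *m Z t)) 0 0) = (fun t => ((A^T *m u)^T *m Z t) 0 0).
  by apply/funext => t; rewrite trmx_mul trmxK mulmxA.
have E2 (u : 'cV[R]_l) : u^T *m (A *m C *m A^T) *m u = (A^T *m u)^T *m C *m (A^T *m u).
  by rewrite trmx_mul trmxK !mulmxA.
split=> [|u|u]; first by rewrite !trmx_mul trmxK sym mulmxA.
  by rewrite E2; exact: C0.
by rewrite E E2; split=> [|B mB]; [exact: mZ|exact: law].
Qed.

Lemma gaussian_centered : centered_gaussian_vec P Z.
Proof.
move=> u; split; first exact: mZ.
have := C0 u; set v := (_ *m _) 0 0 => v0; exists (Num.sqrt v).
move: v0; rewrite le_eqVlt => /predU1P[v0|v0].
  left; rewrite -v0 sqrtr0; split => //; rewrite (law u)// -/v -v0 nrm0 indicE.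
  by rewrite mem_set.
have sv0 : 0 < Num.sqrt v by rewrite sqrtr_gt0.
right; split => // B mB; apply: etrans (nrm_normal_prob sv0 mB).
by rewrite sqr_sqrtr ?(law u)// ltW.
Qed.

End moments.

Lemma centered_normal_nrm d (T : measurableType d) (P : probability T R) (U : T -> R) :
  centered_normal P U -> exists2 v, 0 <= v & forall B, measurable B -> P (U @^-1` B) = nrm v B.
Proof.
move=> [mU [s [[s0 U0]|[s0 UE]]]].
  have m0 : measurable (U @^-1` [set 0]) by rewrite -[X in measurable X]setTI; exact: mU.
  exists 0 => // B mB; rewrite nrm0 indicE.
  have mUB : measurable (U @^-1` B) by rewrite -[X in measurable X]setTI; exact: mU.
  have [B0|B0] := pselect (B 0).
    rewrite mem_set//=; apply/eqP; rewrite eq_le probability_le1//= -U0.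
    by apply: le_measure; rewrite ?inE// => t /= ->.
  rewrite memNset//=; apply/eqP; rewrite -measure_le0.
  have : (P (U @^-1` B) <= P (~` (U @^-1` [set 0%R])))%E.
    apply: le_measure; rewrite ?inE//; first exact: measurableC.
    by move=> t /= UB U00; apply: B0; rewrite -U00.
  by rewrite probability_setC// U0 subee.
exists (s ^+ 2) => [|B mB]; first exact: sqr_ge0.
by apply: etrans (UE B mB) _; apply/esym; exact: nrm_normal_prob.
Qed.

(** A centered normal law is determined by its second moment, and for the projection along [u] that
    moment is the quadratic form of the covariance entries. *)
Lemma centered_gaussian_vecP d (T : measurableType d) (P : probability T R) k
    (Z : T -> 'cV[R]_k) : centered_gaussian_vec P Z -> gaussian_vec P Z (cov P Z).
Proof.
move=> cZ.
have mZ (u : 'cV[R]_k) : measurable_fun setT (fun t => (u^T *m Z t) 0 0) := (cZ u).1.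
have L2u (u : 'cV[R]_k) : L2 P (fun t => (u^T *m Z t) 0 0).
  have [v v0 UE] := centered_normal_nrm (cZ u).
  by apply: L2_lt_pinfty => //; rewrite (nrm_second_moment v0 (mZ u) UE) ltry.
have L2c a : L2 P (fun t => Z t a 0).
  by apply: L2_ext (L2u (delta_mx a 0)) => t; rewrite trmx_delta -rowE mxE.
have covE a b : cov P Z a b = Ex P (fun t => Z t a 0 * Z t b 0).
  by rewrite mxE ExpE//; exact: L2M.
have quadE (u : 'cV[R]_k) : (u^T *m cov P Z *m u) 0 0 = Ex P (fun t => (u^T *m Z t) 0 0 ^+ 2).
  transitivity (Ex P (fun t => \sum_b \sum_a (u a 0 * u b 0) * (Z t a 0 * Z t b 0))).
    rewrite Ex_sum; last by move=> b; apply: L1_sum => a; apply: L1Z; exact: L2M.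
    rewrite mxE; apply: eq_bigr => b _; rewrite Ex_sum; last by move=> a; apply: L1Z; exact: L2M.
    rewrite mxE mulr_suml; apply: eq_bigr => a _; rewrite ExZ; last exact: L2M.
    by rewrite covE mxE; ring.
  congr Ex; apply/funext => t; rewrite expr2 mxE mulr_sumr; apply: eq_bigr => b _.
  by rewrite mulr_suml; apply: eq_bigr => a _; rewrite !mxE; ring.
split=> [|u|u].
- by apply/matrixP => a b; rewrite mxE !covE; congr Ex; apply/funext => t; exact: mulrC.
- by rewrite quadE; apply: Ex_ge0 => t; exact: sqr_ge0.
split=> // B mB; have [v v0 UE] := centered_normal_nrm (cZ u).
by rewrite UE// quadE /Ex /Rintegral (nrm_second_moment v0 (mZ u) UE).
Qed.

Lemma gaussian_vec_law d1 (T1 : measurableType d1) (P1 : probability T1 R)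
    d2 (T2 : measurableType d2) (P2 : probability T2 R) k
    (Z1 : T1 -> 'cV[R]_k) (Z2 : T2 -> 'cV[R]_k) C :
  gaussian_vec P1 Z1 C -> gaussian_vec P2 Z2 C ->
  forall A, borel_cV A -> P1 (Z1 @^-1` A) = P2 (Z2 @^-1` A).
Proof.
move=> [_ _ g1] [_ _ g2]; apply: cramer_wold.
- by rewrite [X in (X < _)%E]probability_setT ltry.
- by rewrite [X in (X < _)%E]probability_setT ltry.
- by move=> u; case: (g1 u).
- by move=> u; case: (g2 u).
- move=> u B mB; have [_ h1] := g1 u; have [_ h2] := g2 u.
  exact: etrans (h1 B mB) (esym (h2 B mB)).
Qed.

Lemma gaussian_vec_Ex d1 (T1 : measurableType d1) (P1 : probability T1 R)
    d2 (T2 : measurableType d2) (P2 : probability T2 R) k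
    (Z1 : T1 -> 'cV[R]_k) (Z2 : T2 -> 'cV[R]_k) C (H : 'cV[R]_k -> R) :
  gaussian_vec P1 Z1 C -> gaussian_vec P2 Z2 C -> borel_fun H ->
  (\int[P1]_t (H (Z1 t))%:E = \int[P2]_t (H (Z2 t))%:E)%E.
Proof.
move=> g1 g2 bH.
apply: (eq_law_integral (U1 := H \o Z1) (U2 := H \o Z2) (F := EFin)) => //.
- by apply: measurable_borel_comp => // a; exact: gaussian_measurable_coord g1 a.
- by apply: measurable_borel_comp => // a; exact: gaussian_measurable_coord g2 a.
- by move=> B mB; exact: (gaussian_vec_law g1 g2 (bH B mB)).
Qed.

End gaussian_vectors.

(** * The noise vector on the product space and its law along a path *)

Section product_model.
Context {R : realType} {d : nat} dT (T : measurableType dT) (P : probability T R).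
Variables (i : nat -> T -> 'I_d) (g : nat -> T -> R) (Y : T -> 'cV[R]_d) (V : 'M[R]_d).
Hypothesis model : iid_model P i g.
Hypothesis gY : gaussian_vec P Y V.
Variable n : nat.

(** Two independent copies of the sample space: the first one carries the
    stationary initial vector [Y], the second one carries [(i, g)]. *)
Definition PP : probability (T * T)%type R := (P \x P)%E.

Definition noise_vec (t : T * T) : 'cV[R]_(d + n) :=
  col_mx (Y t.1) (\col_(m < n) g m t.2).

Definition noise_cov : 'M[R]_(d + n) := block_mx V 0 0 1%:M.

Lemma PP_setX (A B : set T) : measurable A -> measurable B ->
  PP (A `*` B) = (P A * P B)%E.
Proof. by move=> mA mB; exact: product_measure1E. Qed.

Lemma noise_quad (u : 'cV[R]_(d + n)) :
  (u^T *m noise_cov *m u) 0 0 = ((usubmx u)^T *m V *m usubmx u) 0 0 +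
    \sum_(m < n) dsubmx u m 0 ^+ 2.
Proof.
rewrite -{1 2}[u]vsubmxK tr_col_mx mul_row_block !mulmx0 addr0 add0r mulmx1 mul_row_col.
by rewrite mxE; congr (_ + _); rewrite mxE; apply: eq_bigr => m _; rewrite mxE -expr2.
Qed.

Lemma noise_lin (u : 'cV[R]_(d + n)) t :
  (u^T *m noise_vec t) 0 0 = ((usubmx u)^T *m Y t.1) 0 0 +
    \sum_(m < n) dsubmx u m 0 * g m t.2.
Proof.
rewrite -{1}[u]vsubmxK tr_col_mx mul_row_col mxE; congr (_ + _).
by rewrite mxE; apply: eq_bigr => m _; rewrite !mxE.
Qed.

(** The projection is a part depending on [Y] plus a part depending on [g]; restricting to the index
    event only multiplies the product law by the probability of that event, so [law_add] applies to
    the restricted measure. *)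
Lemma model_law (A : nat -> set 'I_d) (u : 'cV[R]_(d + n)) (B : set R) : measurable B ->
  PP ((fun t => (u^T *m noise_vec t) 0 0) @^-1` B `&`
      setT `*` \bigcap_(m in `I_n) (i m @^-1` A m)) =
  ((\prod_(m < n) fine (P (i m @^-1` A m)))%:E *
   nrm ((u^T *m noise_cov *m u) 0 0)%R B)%E.
Proof.
move=> mB; have [_ V0 lY] := gY.
set a := \prod_(m < n) _.
have a0 : 0 <= a by apply: prodr_ge0 => m _; rewrite fine_ge0.
pose c (m : nat) : R := if insub m is Some o then dsubmx u o 0 else 0.
have cE (m : 'I_n) : c m = dsubmx u m 0 by rewrite /c valK.
pose U t := ((usubmx u)^T *m Y t) 0 0.
pose S t := \sum_(m < n) c m * g m t.
have mU : measurable_fun setT U by case: (lY (usubmx u)).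
have mS : measurable_fun setT S by exact: measurable_lincomb model c n.
have mi m (D : set 'I_d) : measurable (i m @^-1` D).
  rewrite (_ : _ @^-1` _ = \bigcup_(k in D) (i m @^-1` [set k])); last first.
    by apply/seteqP; split => [t At|t [k Ak /= ->]]//; exists (i m t).
  by apply: fin_bigcup_measurable => // k _; case: model.
pose F := \bigcap_(m in `I_n) (i m @^-1` A m).
have mF : measurable F by apply: fin_bigcap_measurable.
have mE : measurable (setT `*` F : set (T * T)) by exact: measurableX.
have -> : (fun t => (u^T *m noise_vec t) 0 0) = (fun t => U t.1 + S t.2).
  apply/funext => t; rewrite noise_lin; congr (_ + _).
  by apply: eq_bigr => m _; rewrite cE.
rewrite noise_quad.
have -> : \sum_(m < n) dsubmx u m 0 ^+ 2 = \sum_(m < n) c m ^+ 2.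
  by apply: eq_bigr => m _; rewrite cE.
pose mu : {measure set (T * T) -> \bar R} := mrestr PP mE.
apply: (@law_add R _ _ mu (fun t => U t.1) (fun t => S t.2) a _ _ _ _ a0 (V0 _) _ _ B mB).
- exact: (measurableT_comp mU measurable_fst).
- exact: (measurableT_comp mS measurable_snd).
- by apply: sumr_ge0 => m _; exact: sqr_ge0.
move=> C1 C2 mC1 mC2.
have mUC : measurable (U @^-1` C1) by rewrite -[X in measurable X]setTI; exact: mU.
have mSC : measurable (S @^-1` C2) by rewrite -[X in measurable X]setTI; exact: mS.
transitivity (PP ((U @^-1` C1) `*` (S @^-1` C2 `&` F))).
  congr (PP _); apply/seteqP; split => t /=.
    by move=> [[? ?] [_ ?]].
  by move=> [? [? ?]].
rewrite PP_setX//; last exact: measurableI.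
have [_ ->//] := lY (usubmx u).
rewrite (@iid_law_lincomb R d _ T P i g model n A c C2 mC2) -/a.
exact: muleCA.
Qed.

Lemma noise_gaussian : gaussian_vec PP noise_vec noise_cov.
Proof.
have [Vsym V0 lY] := gY.
split=> [|u|u].
- by rewrite tr_block_mx Vsym !trmx0 trmx1.
- by rewrite noise_quad addr_ge0// sumr_ge0// => m _; exact: sqr_ge0.
have mu : measurable_fun setT (fun t => (u^T *m noise_vec t) 0 0).
  have -> : (fun t => (u^T *m noise_vec t) 0 0) = (fun t => ((usubmx u)^T *m Y t.1) 0 0 +
    \sum_(m < n) dsubmx u m 0 * g m t.2) by apply/funext => t; exact: noise_lin.
  apply: measurable_funD.
    have [mY _] := lY (usubmx u); exact: (measurableT_comp mY measurable_fst).
  apply: measurable_sum => m; apply: measurable_funM => //.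
  exact: (measurableT_comp (iid_measurable_g model m) measurable_snd).
split=> // B mB; have := model_law (fun=> setT) u mB.
rewrite (_ : \bigcap_(m in `I_n) _ = setT); last by apply/seteqP; split.
rewrite setXTT setIT => ->; rewrite big1 ?mul1e// => m _.
by rewrite preimage_setT [X in fine X](_ : _ = 1%E)//; exact: (@probability_setT _ _ _ P).
Qed.

Definition on_path (p : nat -> 'I_d) : set (T * T) :=
  setT `*` \bigcap_(m in `I_n) (i m @^-1` [set p m]).

Lemma measurable_on_path p : measurable (on_path p).
Proof.
apply: measurableX => //; apply: fin_bigcap_measurable => // m _.
by case: model.
Qed.

(** Independence of the indices and the noise, for all Borel events at once: two measures of mass
    [d^-n] with the same projections. *)
Lemma noise_on_path p A : borel_cV A ->
  PP (noise_vec @^-1` A `&` on_path p) = (((d%:R ^- n)%:E : \bar R) * PP (noise_vec @^-1` A))%E.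
Proof.
move=> bA; have [_ [iu _]] := model.
have [_ _ gN] := noise_gaussian.
have dn0 : 0 <= (d%:R ^- n : R) by rewrite invr_ge0 exprn_ge0.
pose mu1 : {measure set (T * T) -> \bar R} := mrestr PP (measurable_on_path p).
pose mu2 : {measure set (T * T) -> \bar R} := mscale (NngNum dn0) PP.
have PT : PP setT = 1%E by exact: (@probability_setT _ _ _ PP).
apply: (@cramer_wold R (d + n) _ _ _ _ mu1 mu2 noise_vec noise_vec _ _ _ _ _ A bA).
- apply: (@le_lt_trans _ _ 1%E); last exact: ltry.
  have mp : measurable (setT `&` on_path p) by rewrite setTI; exact: measurable_on_path.
  rewrite -PT; apply: (@le_measure _ _ _ PP) => //; rewrite inE; [exact: mp|exact: measurableT].
- by rewrite /mu2/= /mscale/= PT mule1 ltry.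
- by move=> u; case: (gN u).
- by move=> u; case: (gN u).
move=> u B mB; have [_ lB] := gN u.
transitivity (((\prod_(m < n) fine (P (i m @^-1` [set p m])))%:E *
   nrm ((u^T *m noise_cov *m u) 0 0)%R B)%E); first exact: (model_law (fun m => [set p m]) u mB).
transitivity ((d%:R ^- n)%:E * PP ((fun t => (u^T *m noise_vec t) 0%R 0%R) @^-1` B))%E; last by [].
rewrite lB//; congr (_%:E * _)%E.
under eq_bigr do rewrite iu.
by rewrite prodr_const card_ord exprVn.
Qed.

End product_model.

(** * Quadratic forms *)

Lemma discriminant_le (R : realFieldType) (a b c : R) : 0 <= c ->
  (forall t, 0 <= a + 2 * t * b + t ^+ 2 * c) -> b ^+ 2 <= a * c.
Proof.
move=> c0 h.
move: c0; rewrite le_eqVlt => /predU1P[c0|c0].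
  have [->|b0] := eqVneq b 0; first by rewrite expr0n/= -c0 mulr0.
  (* With [c = 0] the expression is affine in [t]; this [t] gives it the value -1. *)
  have := h (- (a + 1) / (2 * b)); rewrite -c0 mulr0 addr0.
  have -> : a + 2 * (- (a + 1) / (2 * b)) * b = - 1 by field.
  by rewrite ler0N1.
have := h (- b / c); rewrite -(pmulr_rge0 _ c0).
have -> : c * (a + 2 * (- b / c) * b + (- b / c) ^+ 2 * c) = a * c - b ^+ 2.
  by field; rewrite gt_eqF.
by rewrite subr_ge0.
Qed.

Section quadratic_forms.
Context {R : realType} {d : nat}.
Implicit Types (S B V : 'M[R]_d) (u w x : 'cV[R]_d).

Definition bf S u w : R := (u^T *m S *m w) 0 0.

Lemma bfDr S u w w' : bf S u (w + w') = bf S u w + bf S u w'.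
Proof. by rewrite /bf mulmxDr mxE. Qed.

Lemma bfDl S u u' w : bf S (u + u') w = bf S u w + bf S u' w.
Proof. by rewrite /bf linearD/= !mulmxDl mxE. Qed.

Lemma bfZr S u t w : bf S u (t *: w) = t * bf S u w.
Proof. by rewrite /bf -scalemxAr mxE. Qed.

Lemma bfZl S u t w : bf S (t *: u) w = t * bf S u w.
Proof. by rewrite /bf linearZ/= -!scalemxAl mxE. Qed.

Lemma bfC S u w : S^T = S -> bf S u w = bf S w u.
Proof.
move=> Ssym; rewrite /bf.
have -> : w^T *m S *m u = (u^T *m S *m w)^T by rewrite !trmx_mul trmxK Ssym mulmxA.
by rewrite [in RHS]mxE.
Qed.

Lemma bfBm S S' u w : bf (S - S') u w = bf S u w - bf S' u w.
Proof. by rewrite /bf mulmxBr mulmxBl mxE [X in _ + X]mxE. Qed.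

Lemma bfZm S t u w : bf (t *: S) u w = t * bf S u w.
Proof. by rewrite /bf -scalemxAr -scalemxAl mxE. Qed.

Lemma sqnormE x : sqnorm x = bf 1%:M x x.
Proof. by rewrite /bf mulmx1 mxE; apply: eq_bigr => k _; rewrite mxE expr2. Qed.

Lemma sqnorm_ge0 x : 0 <= sqnorm x.
Proof. by apply: sumr_ge0 => k _; exact: sqr_ge0. Qed.

Lemma sqnorm_gt0 x : x != 0 -> 0 < sqnorm x.
Proof.
move=> x0; rewrite lt_def sqnorm_ge0 andbT; apply: contraNneq x0 => /eqP.
rewrite psumr_eq0; last by move=> k _; exact: sqr_ge0.
move=> /allP h; apply/eqP/matrixP => k j; rewrite ord1 mxE.
by apply/eqP; rewrite -sqrf_eq0; exact: (h k (mem_index_enum k)).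
Qed.

Lemma bf_cauchy_schwarz S u w : S^T = S -> (forall z, 0 <= bf S z z) ->
  bf S u w ^+ 2 <= bf S u u * bf S w w.
Proof.
move=> Ssym S0; have h t : 0 <= bf S u u + 2 * t * bf S u w + t ^+ 2 * bf S w w.
  have := S0 (u + t *: w); rewrite !(bfDl, bfDr, bfZl, bfZr) (bfC w u Ssym).
  by congr (0 <= _); ring.
exact: discriminant_le (S0 w) h.
Qed.

Lemma bf_bound S x : bf S x x <= (\sum_i \sum_j `|S i j|) * sqnorm x.
Proof.
have le2 (i j : 'I_d) : `|x i 0 * x j 0| <= sqnorm x.
  have le1 k : x k 0 ^+ 2 <= sqnorm x.
    rewrite /sqnorm (bigD1 k)//= lerDl; apply: sumr_ge0 => l _; exact: sqr_ge0.
  rewrite -(@ler_pXn2r _ 2)// ?nnegrE ?sqnorm_ge0// real_normK ?num_real// exprMn [leRHS]expr2.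
  by rewrite ler_pM ?sqr_ge0.
rewrite /bf mxE exchange_big mulr_suml; apply: ler_sum => j _.
rewrite mxE !mulr_suml; apply: ler_sum => i _; rewrite mxE.
by rewrite (le_trans (ler_norm _))// mulrAC mulrC normrM ler_wpM2l.
Qed.

(** Cauchy-Schwarz for [B] with [w = B^-1 u]: the fourth power of the norm of [u] is at most
    [B(u, u) B(w, w)], and [B(w, w) = B^-1(u, u)] is at most a constant times the squared norm. *)
Lemma psd_unit_bound B : B^T = B -> (forall z, 0 <= bf B z z) -> B \in unitmx ->
  exists2 K : R, 0 < K & forall u, sqnorm u <= K * bf B u u.
Proof.
move=> Bsym B0 Bu.
have K0 : 0 <= \sum_i \sum_j `|(invmx B) i j| :> R.
  by apply: sumr_ge0 => i _; apply: sumr_ge0.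
set K := \sum_i _ in K0; exists (K + 1) => [|u]; first by lra.
have [->|u0] := eqVneq u 0.
  by rewrite sqnormE {1}/bf mulmx0 mxE mulr_ge0//; lra.
have s0 := sqnorm_gt0 u0.
pose w := invmx B *m u.
have e1 : sqnorm u = bf B u w by rewrite sqnormE /bf /w mulmx1 mulmxA mulmxK.
have e2 : bf B w w = bf (invmx B) u u.
  rewrite /bf /w trmx_mul trmx_inv Bsym -!mulmxA; congr ((_ *m _) 0 0).
  by rewrite (mulmxA B) mulmxV// mul1mx.
have := bf_cauchy_schwarz u w Bsym B0; rewrite -e1 e2 => h.
rewrite -(ler_pM2l s0) -expr2 (le_trans h)// mulrC.
have : bf B u u * bf (invmx B) u u <= bf B u u * (K * sqnorm u).
  by rewrite ler_wpM2l//; exact: bf_bound.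
have := mulr_ge0 (B0 u) (ltW s0); nra.
Qed.

End quadratic_forms.

(** * Spectral bound for [V] and the geometry of a single step *)

Section smallest_eigenvalue.
Context {R : realType} {d : nat}.
Variables (V : 'M[R]_d) (lam : R).
Hypothesis Vsym : V^T = V.
Hypothesis Vdiag : forall k : 'I_d, V k k = 1.
Hypothesis Vpos : pos_def V.
Hypothesis Vlam : smallest_eigenvalue V lam.
Hypothesis d0 : (0 < d)%N.

Let Vge0 u : 0 <= bf V u u.
Proof.
have [->|u0] := eqVneq u 0; first by rewrite /bf mulmx0 mxE.
by apply: ltW; case: Vpos => _; apply.
Qed.

Let V_diag_bf (k : 'I_d) : bf V (delta_mx k 0) (delta_mx k 0) = 1.
Proof. by rewrite /bf trmx_delta -rowE -colE !mxE Vdiag. Qed.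

Let sqnorm_delta (k : 'I_d) : sqnorm (delta_mx k 0 : 'cV[R]_d) = 1.
Proof. by rewrite sqnormE /bf mulmx1 trmx_delta -rowE !mxE !eqxx. Qed.

Lemma eigenvalue_cV (mu : R) : eigenvalue V mu <-> exists2 v : 'cV[R]_d, V *m v = mu *: v & v != 0.
Proof.
split=> [/eigenvalueP[v vV v0]|[v vV v0]].
  by exists v^T; [rewrite -{1}Vsym -trmx_mul vV linearZ|rewrite trmx_eq0].
apply/eigenvalueP; exists v^T; last by rewrite trmx_eq0.
by rewrite -{1}Vsym -trmx_mul vV linearZ.
Qed.

Lemma lam_gt0 : 0 < lam.
Proof.
have [/eigenvalue_cV[v vV v0] _] := Vlam; have [_ /(_ v v0)] := Vpos.
rewrite -mulmxA vV -scalemxAr mxE.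
have -> : (v^T *m v) 0 0 = sqnorm v by rewrite sqnormE /bf mulmx1.
by rewrite pmulr_lgt0// sqnorm_gt0.
Qed.

(** Let [mu] be the largest [t] with [V - t] positive semi-definite. If [V - mu] were invertible,
    [psd_unit_bound] would allow a larger [t]; so [mu] is an eigenvalue, and [lam <= mu]. *)
Lemma lam_rayleigh u : lam * sqnorm u <= bf V u u.
Proof.
pose k0 := Ordinal d0.
pose A : set R := [set t | forall u, t * sqnorm u <= bf V u u].
have A0 : A 0 by move=> w; rewrite mul0r.
have A1 : ubound A 1.
  by move=> t /(_ (delta_mx k0 0)); rewrite sqnorm_delta V_diag_bf mulr1.
have supA : has_sup A by split; [exists 0|exists 1].
set mu := sup A.
have muP w : mu * sqnorm w <= bf V w w.
  have [->|w0] := eqVneq w 0.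
    by rewrite sqnormE /bf !mulmx0 mxE mulr0.
  rewrite -ler_pdivlMr ?sqnorm_gt0//; apply: ge_sup; first by exists 0.
  by move=> t At; rewrite ler_pdivlMr ?sqnorm_gt0.
suff : lam <= mu by move=> h; apply: le_trans (muP u); rewrite ler_wpM2r// sqnorm_ge0.
pose B := V - mu *: 1%:M.
have Bsym : B^T = B by rewrite /B linearB/= linearZ/= trmx1 Vsym.
have BE w : bf B w w = bf V w w - mu * sqnorm w by rewrite bfBm bfZm sqnormE.
have B0 w : 0 <= bf B w w by rewrite BE subr_ge0.
have [Bu|Bu] := boolP (B \in unitmx).
  have [K K0 BK] := psd_unit_bound Bsym B0 Bu.
  have : A (mu + K^-1).
    move=> w; rewrite mulrDl -lerBrDl -BE mulrC ler_pdivrMr// mulrC; exact: BK.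
  by move=> /(sup_ubound supA.2); rewrite -/mu gerDl invr_le0 leNgt K0.
have [_ lmin] := Vlam; apply: lmin; apply/eigenvalueP.
move: Bu; rewrite -row_free_unit -kermx_eq0 => /rowV0Pn[v /sub_kermxP vB v0].
exists v => //; apply/eqP; rewrite -subr_eq0 -vB /B mulmxBr -scalemxAr mulmx1.
by [].
Qed.

Lemma lam_le1 : lam <= 1.
Proof.
have := lam_rayleigh (delta_mx (Ordinal d0) 0).
by rewrite sqnorm_delta V_diag_bf mulr1.
Qed.

Lemma V_unit : V \in unitmx.
Proof.
apply: contraT; rewrite -row_free_unit -kermx_eq0 => /rowV0Pn[v /sub_kermxP vV v0].
have : 0 < bf V v^T v^T by case: Vpos => _; apply; rewrite trmx_eq0.
by rewrite /bf trmxK vV mul0mx mxE ltxx.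
Qed.

Local Notation Vi := (invmx V).

Lemma Vi_sym : Vi^T = Vi. Proof. by rewrite trmx_inv Vsym. Qed.

Lemma bf_inv x : bf Vi x x = bf V (Vi *m x) (Vi *m x).
Proof.
rewrite /bf trmx_mul Vi_sym -!mulmxA; congr ((_ *m _) 0 0).
by rewrite (mulmxA V) mulmxV ?V_unit// mul1mx.
Qed.

(** Put [y = V^-1 x] and [q = V(y, y)], the left-hand form. Then [q] is the scalar product of [y]
    and [x], so [q^2] is at most the product of their squared norms, while [lam] times that of [y]
    is at most [q]. *)
Lemma sqnorm_ge_inv x : lam * bf Vi x x <= sqnorm x.
Proof.
pose y := Vi *m x.
have xE : x = V *m y by rewrite /y mulmxA mulmxV ?V_unit// mul1mx.
rewrite bf_inv -/y; have := lam_rayleigh y.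
have h : bf V y y ^+ 2 <= sqnorm y * sqnorm x.
  have := @bf_cauchy_schwarz R d 1%:M y x (trmx1 _ _) (fun z => _).
  rewrite -!sqnormE (_ : bf 1%:M y x = bf V y y); last by rewrite /bf mulmx1 xE mulmxA.
  by apply=> z; rewrite -sqnormE sqnorm_ge0.
move=> h2; have q0 := Vge0 y; have s0 := sqnorm_ge0 x; have l0 := lam_gt0.
move: q0; rewrite le_eqVlt => /predU1P[<-|q0]; first by rewrite mulr0.
have : lam * bf V y y ^+ 2 <= bf V y y * sqnorm x.
  apply: (le_trans (ler_wpM2l (ltW l0) h)); rewrite mulrA ler_wpM2r//.
rewrite expr2 mulrCA ler_pM2l//.
Qed.

(** With [y = V^-1 x], the coordinate [x k] is [V(e_k, y)]. Since [V(e_k, e_k) = 1], Cauchy-Schwarz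
    bounds each of the [d] squares by [V(y, y)]. *)
Lemma sqnorm_le_inv x : sqnorm x <= d%:R * bf Vi x x.
Proof.
pose y := Vi *m x.
have xE : x = V *m y by rewrite /y mulmxA mulmxV ?V_unit// mul1mx.
rewrite bf_inv -/y /sqnorm.
apply: (@le_trans _ _ (\sum_(k < d) bf V y y)); last first.
  by rewrite sumr_const card_ord mulr_natl.
apply: ler_sum => k _.
have := bf_cauchy_schwarz (delta_mx k 0) y Vsym Vge0; rewrite V_diag_bf mul1r.
by rewrite {1}/bf trmx_delta -mulmxA -xE -rowE mxE.
Qed.

Definition refl (e : 'I_d) : 'M[R]_d := 1%:M - V *m delta_mx e e.

(** Pythagoras for [V^-1]: the vector [V e] has length 1 there, and its product with [x] is the
    coordinate [x e]. *)
Lemma bf_inv_refl e x : bf Vi (refl e *m x) (refl e *m x) = bf Vi x x - x e 0 ^+ 2.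
Proof.
have xe : refl e *m x = x - x e 0 *: (V *m delta_mx e 0).
  rewrite /refl mulmxBl mul1mx; congr (_ - _).
  rewrite -(mul_delta_mx (0 : 'I_1)) -!mulmxA -rowE.
  have -> : row e x = (x e 0)%:M by apply/matrixP => a b; rewrite !ord1 !mxE eqxx.
  by rewrite mul_mx_scalar -scalemxAr.
have cross : bf Vi x (V *m delta_mx e 0) = x e 0.
  by rewrite /bf -!mulmxA (mulmxA Vi) mulVmx ?V_unit// mul1mx -colE !mxE.
have diag : bf Vi (V *m delta_mx e 0) (V *m delta_mx e 0) = 1.
  by rewrite /bf trmx_mul Vsym -!mulmxA (mulmxA Vi) mulVmx ?V_unit// mul1mx -(V_diag_bf e) /bf !mulmxA.
rewrite xe -scaleNr !(bfDl, bfDr, bfZl, bfZr) (bfC (V *m _) x Vi_sym) cross diag.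
by ring.
Qed.

Lemma sum_bf_inv_refl x :
  \sum_e bf Vi (refl e *m x) (refl e *m x) <= (d%:R - lam) * bf Vi x x.
Proof.
under eq_bigr do rewrite bf_inv_refl.
rewrite sumrB sumr_const card_ord mulrBl mulr_natl lerD2l lerN2.
exact: sqnorm_ge_inv.
Qed.

(** With [D = delta_mx e e], the unit diagonal gives [D V D = D], so the linear part of a step
    lowers the covariance [V] by [V D V], which is exactly the covariance of the fresh noise. *)
Lemma refl_stationary e :
  refl e *m V *m (refl e)^T + V *m delta_mx e e *m V = V.
Proof.
rewrite /refl; have dVd : delta_mx e e *m V *m delta_mx e e = delta_mx e e :> 'M[R]_d.
  have bVa : (delta_mx 0 e : 'rV[R]_d) *m V *m (delta_mx e 0 : 'cV[R]_d) = 1%:M.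
    by apply/matrixP => x y; rewrite !ord1 -rowE -colE !mxE Vdiag eqxx.
  have -> : delta_mx e e = (delta_mx e 0 : 'cV[R]_d) *m (delta_mx 0 e : 'rV[R]_d).
    by rewrite mul_delta_mx.
  move: (delta_mx e 0 : 'cV[R]_d) (delta_mx 0 e : 'rV[R]_d) bVa => a b bVa.
  transitivity (a *m (b *m V *m a) *m b); first by rewrite !mulmxA.
  by rewrite bVa mulmx1.
have DT : (delta_mx e e : 'M[R]_d)^T = delta_mx e e by rewrite trmx_delta.
move: (delta_mx e e) dVd DT => D dVd DT.
have h : V *m D *m V *m D = V *m D by rewrite -!mulmxA (mulmxA D V) dVd.
rewrite linearB/= trmx1 trmx_mul Vsym DT mulmxBl mul1mx mulmxBr mulmx1 mulmxBl.
rewrite (mulmxA V D V) !mulmxA h.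
by rewrite subrr subr0 subrK.
Qed.

End smallest_eigenvalue.

(** * The chain along a fixed path as a matrix acting on the noise *)

Section chain_matrices.
Context {R : realType} {d : nat}.
Variables (V : 'M[R]_d) (n : nat).
Hypothesis Vsym : V^T = V.
Hypothesis Vdiag : forall k : 'I_d, V k k = 1.

(** Selects the increment of time [m] from [noise_vec]; it is the zero row once [m >= n]. *)
Definition noise_row (m : nat) : 'rV[R]_(d + n) :=
  row_mx 0 (\row_(k < n) (k == m :> nat)%:R).

(** The recursion of [proc] with free starting time and state, so that it can start from the
    stationary vector or be restarted from 0 at a later time. *)
Fixpoint run (e : nat -> 'I_d) (gam : nat -> R) (x : 'cV[R]_d) (j l : nat) : 'cV[R]_d :=
  match l with
  | 0 => x
  | l'.+1 =>
      let y := run e gam x j l' in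
      y + (gam (j + l')%N - ((ebasis (e (j + l')%N))^T *m y) 0 0) *: (V *m ebasis (e (j + l')%N))
  end.

(** [chain_mx p A j l] maps the noise vector [Z] to the state reached from
    [A *m Z] after the steps [j], ..., [j + l - 1] along the path [p]. *)
Fixpoint chain_mx (p : nat -> 'I_d) (A : 'M[R]_(d, d + n)) (j l : nat) : 'M[R]_(d, d + n) :=
  match l with
  | 0 => A
  | l'.+1 => refl V (p (j + l')%N) *m chain_mx p A j l' +
             V *m ebasis (p (j + l')%N) *m noise_row (j + l')
  end.

Fixpoint refl_prod (p : nat -> 'I_d) (j l : nat) : 'M[R]_d :=
  match l with
  | 0 => 1%:M
  | l'.+1 => refl V (p (j + l')%N) *m refl_prod p j l'
  end.

Lemma refl_step e (y : 'cV[R]_d) (c : R) :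
  y + (c - ((ebasis e)^T *m y) 0 0) *: (V *m ebasis e) =
  refl V e *m y + c *: (V *m ebasis e).
Proof.
rewrite scalerBl addrA addrAC; congr (_ + _).
rewrite /refl mulmxBl mul1mx; congr (_ - _).
rewrite -(mul_delta_mx (0 : 'I_1)) -!mulmxA /ebasis trmx_delta -rowE.
have -> : row e y = (row e y 0 0)%:M by apply/matrixP => a b; rewrite !ord1 !mxE eqxx.
by rewrite mul_mx_scalar -scalemxAr mxE eqxx mulr1n.
Qed.

Lemma run_ext e e' gam gam' x j l : (forall m, (j <= m < j + l)%N -> e m = e' m) ->
  (forall m, (j <= m < j + l)%N -> gam m = gam' m) -> run e gam x j l = run e' gam' x j l.
Proof.
elim: l => [//|l IH] he hg /=.
have jl : (j <= j + l < j + l.+1)%N by rewrite leq_addr addnS leqnn.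
rewrite he// hg// IH// => m /andP[jm ml]; [apply: he|apply: hg];
  by rewrite jm (leq_trans ml)// leq_add2l.
Qed.

Lemma proc_run (T : Type) (i : nat -> T -> 'I_d) (g : nat -> T -> R) k t :
  proc V i g k t = run (fun m => i m t) (fun m => g m t) 0 0 k.
Proof. by elim: k => [//|k IH] /=; rewrite IH add0n. Qed.

Lemma run_chain_mx p gam (z : 'cV[R]_(d + n)) A j l :
  (forall m, (m < n)%N -> gam m = (noise_row m *m z) 0 0) -> (j + l <= n)%N ->
  run p gam (A *m z) j l = chain_mx p A j l *m z.
Proof.
move=> hg; elim: l => [//|l IH]; rewrite addnS => jl /=.
rewrite refl_step IH ?(ltnW jl)// hg// mulmxDl -!mulmxA; congr (_ + _).
set X := noise_row _ *m z.
have XE : X = (X 0 0)%:M by apply/matrixP => a b; rewrite !ord1 [in RHS]mxE eqxx mulr1n.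
by rewrite [in RHS]XE mul_mx_scalar -scalemxAr.
Qed.

Lemma chain_mx_diff p A j l :
  chain_mx p A j l - chain_mx p 0 j l = refl_prod p j l *m A.
Proof.
elim: l => [|l IH] /=; first by rewrite subr0 mul1mx.
by rewrite opprD addrACA subrr addr0 -mulmxBr IH mulmxA.
Qed.

Local Notation C := (noise_cov V n).

Lemma noise_cov_row m m' : (m < n)%N -> (m' < n)%N ->
  noise_row m *m C *m (noise_row m')^T = ((m == m')%:R)%:M.
Proof.
move=> mn m'n.
rewrite /noise_row /noise_cov tr_row_mx mul_row_block !mul0mx !mulmx0 addr0 add0r mulmx1 trmx0.
rewrite mul_row_col mulmx0 add0r; apply/matrixP => a b; rewrite !ord1 !mxE eqxx mulr1n.
rewrite (bigD1 (Ordinal mn))//= !mxE eqxx mul1r big1 ?addr0; first by [].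
move=> k; rewrite !mxE => km; rewrite (_ : (val k == m) = false) ?mul0r//.
by apply/negbTE; apply: contra km => /eqP km; apply/eqP/val_inj.
Qed.

(** A state involves only increments used so far, hence is uncorrelated with those of time [j + l]
    and later. *)
Lemma chain_mx_orth p A j l : (j + l <= n)%N ->
  (forall m, (j <= m < n)%N -> A *m C *m (noise_row m)^T = 0) ->
  forall m, (j + l <= m < n)%N -> chain_mx p A j l *m C *m (noise_row m)^T = 0.
Proof.
move=> + hA; elim: l => [|l IH]; first by rewrite addn0 => _.
rewrite addnS => jl m /andP[lm mn] /=.
rewrite !mulmxDl -!mulmxA (mulmxA _ C) IH ?(ltnW jl)// ?mn ?andbT ?(ltnW lm)//.
rewrite mulmx0 add0r (mulmxA (noise_row _)) noise_cov_row// (ltn_eqF lm).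
rewrite (_ : (false%:R)%:M = 0 :> 'M[R]_1); last exact: raddf0.
by rewrite !mulmx0 addr0.
Qed.

(** A chain restarted from 0 at time [j] is built from the increments of time [j] and later alone,
    so it is uncorrelated with anything uncorrelated with these. *)
Lemma chain_mx0_orth r p (B : 'M[R]_(r, d + n)) j l : (j + l <= n)%N ->
  (forall m, (j <= m < n)%N -> B *m C *m (noise_row m)^T = 0) ->
  B *m C *m (chain_mx p 0 j l)^T = 0.
Proof.
move=> + hB; elim: l => [|l IH]; first by rewrite trmx0 mulmx0.
rewrite addnS => jl /=; rewrite linearD/= mulmxDr !trmx_mul !mulmxA IH ?(ltnW jl)//.
by rewrite hB ?jl ?leq_addr// !mul0mx addr0.
Qed.

Lemma noise_cov_sym : C^T = C.
Proof. by rewrite tr_block_mx Vsym !trmx0 trmx1. Qed.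

(** The defect [V - cov] is merely transported by the linear parts of the steps. Starting from
    covariance [V] it stays 0, which is stationarity; starting from 0 it stays positive
    semi-definite, which gives the bound [cov <= V] that the Lipschitz hypothesis asks for. *)
Lemma chain_mx_cov p A j l : (j + l <= n)%N ->
  (forall m, (j <= m < n)%N -> A *m C *m (noise_row m)^T = 0) ->
  V - chain_mx p A j l *m C *m (chain_mx p A j l)^T =
  refl_prod p j l *m (V - A *m C *m A^T) *m (refl_prod p j l)^T.
Proof.
move=> + hA; elim: l => [|l IH]; first by rewrite /= mul1mx trmx1 mulmx1.
rewrite addnS => jl /=.
set e := p _; set F := chain_mx p A j l; set r := noise_row _; set v := V *m ebasis e.
set M := refl V e; set N := refl_prod p j l.
have FCr : F *m C *m r^T = 0 by apply: chain_mx_orth; rewrite ?(ltnW jl)// leqnn jl.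
have rCF : r *m C *m F^T = 0.
  by apply: trmx_inj; rewrite !trmx_mul trmxK noise_cov_sym mulmxA FCr trmx0.
have rCr : r *m C *m r^T = 1%:M by rewrite noise_cov_row ?eqxx.
have vv : v *m v^T = V *m delta_mx e e *m V.
  by rewrite /v trmx_mul Vsym /ebasis trmx_delta !mulmxA -(mulmxA V) mul_delta_mx.
(* The cross terms vanish because the fresh increment is uncorrelated with the current state. *)
have -> : (M *m F + v *m r) *m C *m (M *m F + v *m r)^T =
    M *m (F *m C *m F^T) *m M^T + v *m v^T.
  move: M F v r FCr rCF rCr {vv} => M' F' v' r' FCr rCF rCr.
  rewrite linearD/= !trmx_mul !mulmxDl !mulmxDr.
  have -> : M' *m F' *m C *m (r'^T *m v'^T) = 0.
    transitivity (M' *m (F' *m C *m r'^T) *m v'^T); first by rewrite !mulmxA.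
    by rewrite FCr mulmx0 mul0mx.
  have -> : v' *m r' *m C *m (F'^T *m M'^T) = 0.
    transitivity (v' *m (r' *m C *m F'^T) *m M'^T); first by rewrite !mulmxA.
    by rewrite rCF mulmx0 mul0mx.
  have -> : v' *m r' *m C *m (r'^T *m v'^T) = v' *m v'^T.
    transitivity (v' *m (r' *m C *m r'^T) *m v'^T); first by rewrite !mulmxA.
    by rewrite rCr mulmx1.
  by rewrite addr0 add0r !mulmxA.
rewrite -[X in X - _](refl_stationary Vsym Vdiag e) -/M vv.
rewrite opprD addrACA subrr addr0 -mulmxBl -mulmxBr IH ?(ltnW jl)// -/N.
by rewrite trmx_mul !mulmxA.
Qed.

Definition start_mx : 'M[R]_(d, d + n) := row_mx 1%:M 0.

Lemma start_cov : start_mx *m C *m start_mx^T = V.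
Proof.
rewrite /start_mx /noise_cov tr_row_mx mul_row_block !mul0mx !mulmx0 !addr0 mul1mx trmx0.
by rewrite mul_row_col mulmx0 addr0 trmx1 mulmx1.
Qed.

Lemma start_orth m : start_mx *m C *m (noise_row m)^T = 0.
Proof.
rewrite /start_mx /noise_cov /noise_row !tr_row_mx mul_row_block !mul0mx !mulmx0 !addr0 mul1mx trmx0.
by rewrite mul_row_col mulmx0 add0r mul0mx.
Qed.

End chain_matrices.

(** * Averages over all index paths of length [n] *)

Section path_average.
Context {R : realType} {d : nat}.
Variables (n : nat) (k0 : 'I_d).

(** Beyond time [n] the path takes the default value [k0]; this turns a member of a finite type,
    over which one can sum, into the index sequence that [chain_mx] expects. *)
Definition path_of (p : {ffun 'I_n -> 'I_d}) (m : nat) : 'I_d :=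
  if insub m is Some o then p o else k0.

Lemma path_ofE (p : {ffun 'I_n -> 'I_d}) (m : 'I_n) : path_of p m = p m.
Proof. by rewrite /path_of valK. Qed.

(** Resampling one coordinate leaves the uniform average unchanged:
    [(p, e) |-> (p with value e at k, p k)] is an involution. *)
Lemma sum_path_resample (k : 'I_n) (G : {ffun 'I_n -> 'I_d} -> 'I_d -> R) :
  (forall (p : {ffun 'I_n -> 'I_d}) e e', G [ffun m => if m == k then e' else p m] e = G p e) ->
  d%:R * \sum_p G p (p k) = \sum_p \sum_e G p e.
Proof.
move=> GE; pose phi (z : {ffun 'I_n -> 'I_d} * 'I_d) :=
  ([ffun m => if m == k then z.2 else z.1 m] : {ffun 'I_n -> 'I_d}, z.1 k).
have phiK : involutive phi.
  move=> [p e]; rewrite /phi/=; congr (_, _); last by rewrite ffunE eqxx.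
  by apply/ffunP => m; rewrite !ffunE; case: eqP => [->|].
rewrite pair_big/= (reindex_inj (inv_inj phiK))/=.
rewrite -(pair_big xpredT xpredT (fun p e => G (phi (p, e)).1 (phi (p, e)).2))/= mulr_sumr.
apply: eq_bigr => p _; under eq_bigr do rewrite GE.
by rewrite sumr_const card_ord mulr_natl.
Qed.

Variables (V : 'M[R]_d) (lam : R).
Hypothesis Vsym : V^T = V.
Hypothesis Vdiag : forall k : 'I_d, V k k = 1.
Hypothesis Vpos : pos_def V.
Hypothesis Vlam : smallest_eigenvalue V lam.

Let d0 : (0 < d)%N := leq_ltn_trans (leq0n k0) (ltn_ord k0).
Local Notation Vi := (invmx V).

Lemma refl_prod_ext p p' j l : (forall m, (j <= m < j + l)%N -> p m = p' m) ->
  refl_prod V p j l = refl_prod V p' j l.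
Proof.
elim: l => [//|l IH] h /=; rewrite h ?leq_addr ?addnS ?leqnn// IH// => m /andP[jm ml].
by apply: h; rewrite jm addnS ltnW.
Qed.

(** The product of the first [l] steps does not read the index of time [j + l], so that index can be
    resampled; the next step then appears averaged over all [e], where [sum_bf_inv_refl] applies. *)
Lemma path_average_contraction j l (x : 'cV[R]_d) : (j + l <= n)%N ->
  \sum_p bf Vi (refl_prod V (path_of p) j l *m x) (refl_prod V (path_of p) j l *m x) <=
  d%:R ^+ n * (1 - lam / d%:R) ^+ l * bf Vi x x.
Proof.
have dR : 0 < d%:R :> R by rewrite ltr0n.
elim: l => [_|l IH].
  rewrite expr0 mulr1 (eq_bigr (fun=> bf Vi x x)); last by move=> p _; rewrite mul1mx.
  by rewrite sumr_const card_ffun !card_ord -[leLHS]mulr_natl natrX.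
rewrite addnS => jl.
pose G (p : {ffun 'I_n -> 'I_d}) e := bf Vi (refl V e *m (refl_prod V (path_of p) j l *m x))
  (refl V e *m (refl_prod V (path_of p) j l *m x)).
have GE (p : {ffun 'I_n -> 'I_d}) e e' : G [ffun m => if m == Ordinal jl then e' else p m] e = G p e.
  rewrite /G (@refl_prod_ext _ (path_of p))// => m /andP[jm ml].
  rewrite /path_of; case: insubP => [q qn qm|_]; last by [].
  rewrite ffunE; case: eqP => [qq|_]; last by [].
  by move: ml; rewrite -qm qq ltnn.
rewrite -(ler_pM2l dR).
have -> : \sum_p bf Vi (refl_prod V (path_of p) j l.+1 *m x) (refl_prod V (path_of p) j l.+1 *m x) =
    \sum_p G p (p (Ordinal jl)).
  by apply: eq_bigr => p _; rewrite /= -!mulmxA -(path_ofE p (Ordinal jl)).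
rewrite (sum_path_resample GE).
apply: (@le_trans _ _ (\sum_p (d%:R - lam) * bf Vi (refl_prod V (path_of p) j l *m x)
    (refl_prod V (path_of p) j l *m x))).
  by apply: ler_sum => p _; exact: sum_bf_inv_refl.
rewrite -mulr_sumr.
have l1 := lam_le1 Vsym Vdiag Vpos Vlam d0.
have d1 : 1 <= d%:R :> R by rewrite ler1n.
have dl : 0 <= d%:R - lam by lra.
apply: (le_trans (ler_wpM2l dl (IH (ltnW jl)))).
rewrite exprS le_eqVlt; apply/orP; left; apply/eqP; field.
by rewrite gt_eqF.
Qed.

End path_average.

(** * Powers, Jensen's inequality and geometric sums *)

Section real_estimates.
Context {R : realType}.
Implicit Types (z g rho : R).

(** Concavity in the form of the tangent at 1; it serves both for Jensen's inequality and for the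
    upper bound on [rate]. *)
Lemma powR_le_tangent z g : 0 < z -> 0 <= g <= 1 -> z `^ g <= 1 + g * (z - 1).
Proof.
move=> z0 /andP[g0 g1].
set w := 1 + g * (z - 1).
have w0 : 0 < w.
  have -> : w = (1 - g) + g * z by rewrite /w; ring.
  have := mulr_ge0 g0 (ltW z0).
  have [->|gn1] := eqVneq g 1; first by rewrite mul1r; lra.
  have : g < 1 by rewrite lt_neqAle gn1.
  lra.
(* [a >= w (1 + ln (a / w))] for [a = z] and [a = 1], averaged with weights [g] and [1 - g] *)
have tang a : 0 < a -> w * (1 + (ln a - ln w)) <= a.
  move=> a0; have aE : a = w * (a / w) by rewrite mulrC divfK ?gt_eqF.
  rewrite [leRHS]aE ler_wpM2l ?(ltW w0)//.
  rewrite -[leRHS]lnK ?posrE ?divr_gt0// ln_div ?posrE//; exact: expR_ge1Dx.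
have h1 := tang z z0; have h2 := tang 1 ltr01.
rewrite ln1 in h2.
have : g * (w * (1 + (ln z - ln w))) + (1 - g) * (w * (1 + (0 - ln w))) <= w.
  rewrite [leRHS](_ : w = g * z + (1 - g) * 1); last by rewrite /w; ring.
  by apply: lerD; apply: ler_wpM2l => //; rewrite subr_ge0.
have -> : g * (w * (1 + (ln z - ln w))) + (1 - g) * (w * (1 + (0 - ln w))) =
   w + w * (g * ln z - ln w) by ring.
rewrite gerDl pmulr_rle0// subr_le0 => hln.
by rewrite /powR gt_eqF// -[leRHS]lnK ?posrE// ler_expR.
Qed.

(** Apply the tangent bound to the ratios [a i / A], where [A] is the mean: the linear terms average
    to 0. Vanishing [a i] and [A] are set apart, since the tangent bound is for positive
    arguments. *)
Lemma powR_jensen (I : finType) (a : I -> R) g (c : R) : 0 < g <= 1 -> 0 <= c ->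
  c * #|I|%:R = 1 -> (forall i, 0 <= a i) ->
  \sum_i c * a i `^ g <= (\sum_i c * a i) `^ g.
Proof.
move=> /andP[g0 g1] c0 cI a0; set A := \sum_i c * a i.
have A0 : 0 <= A by apply: sumr_ge0 => i _; rewrite mulr_ge0.
move: (A0); rewrite le_eqVlt => /predU1P[Az|Ap].
  rewrite big1; first exact: powR_ge0.
  move=> i _; have : c * a i <= A by rewrite /A (bigD1 i)//= lerDl sumr_ge0// => j _; rewrite mulr_ge0.
  rewrite -Az => h; have /eqP : c * a i == 0 by rewrite eq_le h mulr_ge0.
  move/eqP; rewrite mulf_eq0 => /orP[/eqP->|/eqP->]; first by rewrite mul0r.
  by rewrite powR0 ?mulr0// gt_eqF.
apply: (@le_trans _ _ (\sum_i c * (A `^ g * (1 + g * (a i / A - 1))))).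
  apply: ler_sum => i _; rewrite ler_wpM2l//.
  have := a0 i; rewrite le_eqVlt => /predU1P[<-|ai].
    by rewrite powR0 ?gt_eqF// mulr_ge0 ?powR_ge0// mul0r; lra.
  have -> : a i `^ g = A `^ g * (a i / A) `^ g.
    by rewrite -powRM ?ltW ?divr_gt0// mulrC divfK// gt_eqF.
  rewrite ler_wpM2l ?powR_ge0//; apply: powR_le_tangent; rewrite ?divr_gt0// (ltW g0)//.
have -> : \sum_i c * (A `^ g * (1 + g * (a i / A - 1))) =
    A `^ g * ((1 - g) * (\sum_(i in I) c) + g / A * \sum_i c * a i).
  rewrite !mulr_sumr -big_split/= mulr_sumr; apply: eq_bigr => i _.
  by ring.
have -> : \sum_(i in I) c = 1 by rewrite sumr_const -mulr_natr.
by rewrite -/A divfK ?gt_eqF// mulr1 subrK mulr1.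
Qed.

Lemma geometric_sum_le rho M : 0 <= rho < 1 -> \sum_(l < M) rho ^+ l <= (1 - rho)^-1.
Proof.
move=> /andP[r0 r1]; have r1' : 0 < 1 - rho by lra.
rewrite -[leRHS]mul1r ler_pdivlMr//.
have -> : (\sum_(l < M) rho ^+ l) * (1 - rho) = 1 - rho ^+ M.
  elim: M => [|M IH]; first by rewrite big_ord0 mul0r expr0 subrr.
  by rewrite big_ord_recr/= mulrDl IH exprS; ring.
by rewrite gerBl exprn_ge0.
Qed.

(** Natural subtraction is truncated, so the first [D] terms equal 1 and the others form a geometric
    series. *)
Lemma geometric_sum_shift_le rho D M : 0 <= rho < 1 ->
  \sum_(l < M) rho ^+ (l - D) <= D%:R + (1 - rho)^-1.
Proof.
move=> r01; have /andP[r0 r1] := r01.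
elim: D M => [|D IH] M.
  by rewrite add0r; under eq_bigr do rewrite subn0; exact: geometric_sum_le.
case: M => [|M].
  by rewrite big_ord0 addr_ge0// invr_ge0; lra.
rewrite big_ord_recl/= sub0n expr0.
under eq_bigr do rewrite /bump/= add1n subSS.
have := IH M; rewrite -natr1; lra.
Qed.

End real_estimates.

(** * Second moments of sums *)

Section ergodic_average.
Context {R : realType} d (T : measurableType d) (P : probability T R).

Lemma Ex_mul_sqr_le (f g : T -> R) : L2 P f -> L2 P g ->
  Ex P (fun x => f x * g x) ^+ 2 <= Ex P (fun x => f x ^+ 2) * Ex P (fun x => g x ^+ 2).
Proof.
move=> Lf Lg; have [_ Lf2] := Lf; have [_ Lg2] := Lg; have Lfg := L2M Lf Lg.
apply: discriminant_le => [|t]; first by apply: Ex_ge0 => x; exact: sqr_ge0.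
have := Ex_ge0 P (fun x => sqr_ge0 (f x + t * g x)).
have -> : (fun x => (f x + t * g x) ^+ 2) =
   (fun x => (f x ^+ 2 + 2 * t * (f x * g x)) + t ^+ 2 * g x ^+ 2).
  by apply/funext => x; ring.
by rewrite ExD ?ExD ?ExZ//; do ?[exact: L1Z|apply: L1D].
Qed.

Lemma Ex_mul_le (f g : T -> R) a b : L2 P f -> L2 P g -> 0 <= a -> 0 <= b ->
  Ex P (fun x => f x ^+ 2) <= a ^+ 2 -> Ex P (fun x => g x ^+ 2) <= b ^+ 2 ->
  `|Ex P (fun x => f x * g x)| <= a * b.
Proof.
move=> Lf Lg a0 b0 fa gb.
rewrite -(@ler_pXn2r _ 2)// ?nnegrE ?mulr_ge0// real_normK ?num_real// exprMn.
apply: (le_trans (Ex_mul_sqr_le Lf Lg)); apply: ler_pM => //; apply: Ex_ge0 => x; exact: sqr_ge0.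
Qed.

Lemma Ex_norm_le (f : T -> R) a : L2 P f -> 0 <= a ->
  Ex P (fun x => f x ^+ 2) <= a ^+ 2 -> `|Ex P f| <= a.
Proof.
move=> Lf a0 fa; have := @Ex_mul_le f (cst 1) a 1 Lf (L2_cst P 1) a0 ler01 fa.
rewrite mulr1; under [in X in `|X|]eq_fun do rewrite mulr1; apply.
have -> : (fun x : T => cst 1 x ^+ 2 : R) = cst 1 by apply/funext => x /=; rewrite expr1n.
by rewrite Ex_cst expr1n.
Qed.

(** Minkowski's inequality in squared form, adding one summand at a time. *)
Lemma Ex_sum_sqr_le (D : nat -> T -> R) (b : nat -> R) N M :
  (forall j, L2 P (D j)) -> (forall j, 0 <= b j) ->
  (forall j, (j < N + M)%N -> Ex P (fun x => D j x ^+ 2) <= b j ^+ 2) ->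
  Ex P (fun x => (\sum_(j < M) D (N + j)%N x) ^+ 2) <= (\sum_(j < M) b (N + j)%N) ^+ 2.
Proof.
move=> LD b0; elim: M => [|M IH] hb.
  rewrite big_ord0 expr0n/= (_ : (fun x => _) = cst 0) ?Ex_cst//.
  by apply/funext => x; rewrite big_ord0 expr0n.
have {}IH := IH (fun j jM => hb j (leq_trans jM (leq_add (leqnn N) (leqnSn M)))).
have hM := hb (N + M)%N; rewrite addnS ltnS leqnn in hM; have {}hM := hM isT.
have LS : L2 P (fun x => \sum_(j < M) D (N + j)%N x) by exact: L2_sum.
have s0 : 0 <= \sum_(j < M) b (N + j)%N by exact: sumr_ge0.
have hx := Ex_mul_le LS (LD (N + M)%N) s0 (b0 _) IH hM.
have [_ LS2] := LS; have [_ LD2] := LD (N + M)%N.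
have -> : (fun x => (\sum_(j < M.+1) D (N + j)%N x) ^+ 2) = (fun x =>
   ((\sum_(j < M) D (N + j)%N x) ^+ 2 + 2 * ((\sum_(j < M) D (N + j)%N x) * D (N + M)%N x)) + D (N + M)%N x ^+ 2).
  by apply/funext => x; rewrite big_ord_recr/=; ring.
rewrite ExD//; last by apply: L1D => //; apply: L1Z; exact: L2M.
rewrite ExD//; last by apply: L1Z; exact: L2M.
rewrite ExZ; last exact: L2M.
rewrite big_ord_recr/= sqrrD; have := ler_norm (Ex P (fun x => (\sum_(j < M) D (N + j)%N x) * D (N + M)%N x)).
rewrite mulr2n; lra.
Qed.

(** Appending the last variable adds its covariances with the earlier ones twice and its variance
    once, at most [2 (c 1 + ... + c M) + c 0], hence at most [2 B]. *)
Lemma Ex_stationary_sum_le (F : nat -> T -> R) (c : nat -> R) B N M :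
  (forall j, L2 P (F j)) -> (forall l, 0 <= c l) ->
  (forall j k, (j <= k)%N -> (k < N + M)%N -> Ex P (fun x => F j x * F k x) <= c (k - j)%N) ->
  \sum_(l < M) c l <= B ->
  Ex P (fun x => (\sum_(j < M) F (N + j)%N x) ^+ 2) <= M%:R * (2 * B).
Proof.
move=> LF c0; elim: M => [|M IH] hc hB.
  rewrite mul0r (_ : (fun x => _) = cst 0) ?Ex_cst//.
  by apply/funext => x; rewrite big_ord0 expr0n.
have LS : L2 P (fun x => \sum_(j < M) F (N + j)%N x) by exact: L2_sum.
have [_ LS2] := LS; have [_ LF2] := LF (N + M)%N.
have -> : (fun x => (\sum_(j < M.+1) F (N + j)%N x) ^+ 2) = (fun x =>
   ((\sum_(j < M) F (N + j)%N x) ^+ 2 + 2 * (\sum_(j < M) F (N + j)%N x * F (N + M)%N x)) + F (N + M)%N x ^+ 2).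
  by apply/funext => x; rewrite big_ord_recr/= -mulr_suml; ring.
have LFF : L1 P (fun x => \sum_(j < M) F (N + j)%N x * F (N + M)%N x).
  by apply: L1_sum => j; exact: L2M.
rewrite ExD//; last by apply: L1D => //; exact: L1Z.
rewrite ExD//; last exact: L1Z.
rewrite ExZ// Ex_sum; last by move=> j; exact: L2M.
have h1 : \sum_(j < M) Ex P (fun x => F (N + j)%N x * F (N + M)%N x) <= \sum_(l < M) c l.+1.
  (* Reversing the sum makes the index of [c] the lag from [N + j] to [N + M]. *)
  rewrite [leRHS](reindex_inj rev_ord_inj)/=; apply: ler_sum => j _.
  have -> : (M - j.+1).+1 = ((N + M) - (N + j))%N by rewrite subnDl subnSK.
  by apply: hc; rewrite ?leq_add2l ?addnS// ltnW.
have h2 : Ex P (fun x => F (N + M)%N x ^+ 2) <= c 0%N.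
  have -> : (fun x => F (N + M)%N x ^+ 2) = (fun x => F (N + M)%N x * F (N + M)%N x).
    by apply/funext => x; rewrite expr2.
  by have := hc (N + M)%N (N + M)%N (leqnn _); rewrite addnS subnn; apply.
have h3 : Ex P (fun x => (\sum_(j < M) F (N + j)%N x) ^+ 2) <= M%:R * (2 * B).
  apply: IH => [j k jk kM|]; first by apply: hc => //; rewrite addnS ltnW.
  by apply: le_trans hB; rewrite big_ord_recr/= lerDl.
move: hB; rewrite big_ord_recl/= => hB.
have c00 := c0 0%N.
rewrite -natr1 mulrDl mul1r.
have e : \sum_(l < M) c (bump 0 l) = \sum_(l < M) c l.+1 by [].
rewrite e in hB; lra.
Qed.

End ergodic_average.

(** * Operations on Borel functions *)

Section borel_functions.
Context {R : realType} {k : nat}.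

Local Notation BT := (g_sigma_algebraType [set U : set 'cV[R]_k | open U]).

Lemma borel_funP (H : 'cV[R]_k -> R) : borel_fun H <-> measurable_fun setT (H : BT -> R).
Proof.
by split=> [bH _ B mB|mH B mB]; [rewrite setTI; exact: bH|have := mH measurableT B mB; rewrite setTI].
Qed.

Lemma measurable_coord a : measurable_fun setT (fun y : BT => y a 0 : R).
Proof.
apply: (measurability (@RGenInftyO.G R)); first exact: RGenInftyO.measurableE.
move=> _ [_ [x ->] <-]; rewrite setTI; apply: sub_sigma_algebra => /=.
apply: open_comp; last exact: open_lt.
by move=> y _; exact: coord_continuous.
Qed.

Lemma borel_fun_mulmx l (h : 'cV[R]_l -> R) (A : 'M[R]_(l, k)) :
  borel_fun h -> borel_fun (fun z => h (A *m z)).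
Proof.
move=> bh; apply/borel_funP.
apply: (@measurable_borel_comp R l _ BT (fun z => A *m z) h) => // a.
have -> : (fun z : BT => (A *m z) a 0) = (fun z : BT => \sum_b A a b * z b 0).
  by apply/funext => z; rewrite mxE.
by apply: measurable_sum => b; apply: measurable_funM => //; exact: measurable_coord.
Qed.

Lemma borel_funB (h h' : 'cV[R]_k -> R) : borel_fun h -> borel_fun h' ->
  borel_fun (fun z => h z - h' z).
Proof. by move=> /borel_funP m /borel_funP m'; apply/borel_funP; exact: measurable_funB. Qed.

Lemma borel_funD (h h' : 'cV[R]_k -> R) : borel_fun h -> borel_fun h' ->
  borel_fun (fun z => h z + h' z).
Proof. by move=> /borel_funP m /borel_funP m'; apply/borel_funP; exact: measurable_funD. Qed.

Lemma borel_funM (h h' : 'cV[R]_k -> R) : borel_fun h -> borel_fun h' ->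
  borel_fun (fun z => h z * h' z).
Proof. by move=> /borel_funP m /borel_funP m'; apply/borel_funP; exact: measurable_funM. Qed.

Lemma borel_fun_cst (c : R) : borel_fun (fun _ : 'cV[R]_k => c).
Proof. by apply/borel_funP; exact: measurable_cst. Qed.

End borel_functions.

(** * Independent pairs on a product space *)

Section gaussian_independence.
Context {R : realType} dT (T : measurableType dT) (P : probability T R).

Lemma gaussian_pair k1 k2 (Z1 : T -> 'cV[R]_k1) (Z2 : T -> 'cV[R]_k2) C1 C2 :
  gaussian_vec P Z1 C1 -> gaussian_vec P Z2 C2 ->
  gaussian_vec (PP P) (fun t => col_mx (Z1 t.1) (Z2 t.2)) (block_mx C1 0 0 C2).
Proof.
move=> [s1 p1 l1] [s2 p2 l2].
have qE (u : 'cV[R]_(k1 + k2)) : (u^T *m block_mx C1 0 0 C2 *m u) 0 0 =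
    ((usubmx u)^T *m C1 *m usubmx u) 0 0 + ((dsubmx u)^T *m C2 *m dsubmx u) 0 0.
  rewrite -{1 2}[u]vsubmxK tr_col_mx mul_row_block !mulmx0 addr0 add0r mul_row_col.
  by rewrite mxE.
have lE (u : 'cV[R]_(k1 + k2)) : (fun t => (u^T *m col_mx (Z1 t.1) (Z2 t.2)) 0 0) =
    (fun t : T * T => ((usubmx u)^T *m Z1 t.1) 0 0 + ((dsubmx u)^T *m Z2 t.2) 0 0).
  by apply/funext => t; rewrite -{1}[u]vsubmxK tr_col_mx mul_row_col mxE.
split=> [|u|u]; first by rewrite tr_block_mx s1 s2 !trmx0.
  by rewrite qE addr_ge0.
have [m1 L1'] := l1 (usubmx u); have [m2 L2'] := l2 (dsubmx u).
have mU : measurable_fun setT (fun t : T * T => ((usubmx u)^T *m Z1 t.1) 0 0).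
  exact: (measurableT_comp m1 measurable_fst).
have mW : measurable_fun setT (fun t : T * T => ((dsubmx u)^T *m Z2 t.2) 0 0).
  exact: (measurableT_comp m2 measurable_snd).
rewrite lE qE; split; first exact: measurable_funD.
move=> B mB; rewrite -[RHS]mul1e.
apply: (@law_add R _ _ (PP P) _ _ 1 _ _ mU mW ler01 (p1 _) (p2 _) _ B mB).
move=> C D mC mD; rewrite mul1e -L1'// -L2'//.
rewrite -PP_setX//.
- by rewrite -[X in measurable X]setTI; exact: m1.
- by rewrite -[X in measurable X]setTI; exact: m2.
Qed.

Lemma Ex_prod_indep (F G : T -> R) : L2 P F -> L2 P G ->
  Ex (PP P) (fun t => F t.1 * G t.2) = Ex P F * Ex P G.
Proof.
move=> LF LG.
have LF1 := L2_L1 LF; have LG1 := L2_L1 LG.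
have mF := L1_measurable LF1; have mG := L1_measurable LG1.
have mFG : measurable_fun setT (fun t : T * T => F t.1 * G t.2).
  apply: measurable_funM.
    exact: (measurableT_comp mF measurable_fst).
  exact: (measurableT_comp mG measurable_snd).
have mE : measurable_fun setT (EFin \o (fun t : T * T => F t.1 * G t.2)).
  exact/measurable_EFinP.
have h : (\int[P]_x \int[P]_y `|(F x * G y)%:E| < +oo)%E.
  have -> : (\int[P]_x \int[P]_y `|(F x * G y)%:E| =
     (\int[P]_x `|F x|%:E) * \int[P]_y `|G y|%:E)%E.
    rewrite -ge0_integralZr//.
    - apply: eq_integral => x _; rewrite -ge0_integralZl//.
      + by apply: eq_integral => y _; rewrite /= normrM EFinM.
      + by apply/measurable_EFinP; exact: measurableT_comp.
    - by apply/measurable_EFinP; exact: measurableT_comp.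
    - by apply: integral_ge0 => y _; rewrite lee_fin.
  move/integrableP: LF1 => [_ F1]; move/integrableP: LG1 => [_ G1].
  apply: lte_mul_pinfty; [|rewrite ge0_fin_numE//|exact: G1];
    by apply: integral_ge0 => x _; rewrite lee_fin.
have iFG := proj2 (@integrable12ltyP _ _ T T R P P _ mE) h.
rewrite /Ex /Rintegral.
have -> : (\int[PP P]_x (F x.1 * G x.2)%:E = \int[P]_x \int[P]_y (F x * G y)%:E)%E.
  by apply/esym; exact: (integral12_prod_meas1 iFG).
have inner x : (\int[P]_y (F x * G y)%:E = (F x)%:E * (Ex P G)%:E)%E.
  transitivity (\int[P]_y ((F x)%:E * (G y)%:E))%E; first by [].
  rewrite integralZl//; congr (_ * _)%E.
  by rewrite /Ex /Rintegral fineK//; exact: integrable_fin_num LG1.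
transitivity (fine (\int[P]_x ((F x)%:E * (Ex P G)%:E))%E).
  by congr fine; apply: eq_integral => x _; exact: inner.
rewrite integralZr// fineM//; exact: integrable_fin_num LF1.
Qed.

End gaussian_independence.

(** * Decomposition of expectations over index paths *)

Section path_decomposition.
Context {R : realType} {d : nat} dT (T : measurableType dT) (P : probability T R).
Variables (i : nat -> T -> 'I_d) (g : nat -> T -> R) (Y : T -> 'cV[R]_d) (V : 'M[R]_d).
Hypothesis model : iid_model P i g.
Hypothesis gY : gaussian_vec P Y V.
Variables (n : nat) (k0 : 'I_d).
Local Notation Q := (PP P).
Local Notation noise := (noise_vec g Y n).
Local Notation path := {ffun 'I_n -> 'I_d}.
Local Notation on_path p := (on_path i n (path_of k0 p)).

(** This takes the place of conditioning on the indices: the path events form a finite partition,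
    and on each of them [H] is a Borel function of the noise. *)
Definition path_rep (H : T * T -> R) (phi : path -> 'cV[R]_(d + n) -> R) :=
  (forall p, borel_fun (phi p)) /\
  (forall p t, on_path p t -> H t = phi p (noise t)).

Let gN := noise_gaussian model gY n.

Lemma measurable_noise_comp (f : 'cV[R]_(d + n) -> R) : borel_fun f ->
  measurable_fun setT (f \o noise).
Proof. by move=> bf; apply: measurable_borel_comp => // a; exact: gaussian_measurable_coord gN a. Qed.

Let path_cover : \big[setU/set0]_(p : path) on_path p = setT.
Proof.
apply/seteqP; split => // t _; rewrite -bigcup_seq.
exists [ffun m : 'I_n => i m t.2] => /=; first by rewrite mem_index_enum.
by split=> // m mn; rewrite /= -[m]/(val (Ordinal mn)) path_ofE ffunE.
Qed.

Let path_trivI : trivIset [set` index_enum path] (fun p => on_path p).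
Proof.
move=> p q _ _ [t [[_ tp] [_ tq]]]; apply/ffunP => m.
have := tp m (ltn_ord m); have := tq m (ltn_ord m).
by rewrite /= !path_ofE => -> ->.
Qed.

Lemma path_rep_measurable H phi : path_rep H phi -> measurable_fun setT H.
Proof.
move=> [bphi Hphi] _ B mB; rewrite -path_cover setIC.
rewrite big_distrr/=; apply: bigsetU_measurable => p _.
rewrite (_ : _ `&` _ = (phi p \o noise) @^-1` B `&` on_path p).
  apply: measurableI; last exact: measurable_on_path model _ _.
  by rewrite -[X in measurable X]setTI; exact: measurable_noise_comp.
by apply/seteqP; split => t /= [HB tp]; split => //; move: HB; rewrite (Hphi p).
Qed.

Lemma path_rep_integral H phi : path_rep H phi -> (forall t, 0 <= H t) ->
  (forall p z, 0 <= phi p z) ->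
  (\int[Q]_t (H t)%:E = \sum_(p : path) (d%:R ^- n)%:E * \int[Q]_t (phi p (noise t))%:E)%E.
Proof.
move=> rH H0 phi0; have mH := path_rep_measurable rH; have [bphi Hphi] := rH.
have mp (p : path) : measurable (on_path p) by exact: measurable_on_path model _ _.
have mHD : measurable_fun (\big[setU/set0]_(p : path) on_path p) (fun t => (H t)%:E).
  by rewrite path_cover; exact/measurable_EFinP.
have -> : (\int[Q]_t (H t)%:E = \sum_(p : path) \int[Q]_(t in on_path p) (H t)%:E)%E.
  have := ge0_integral_bigsetU Q mp (index_enum_uniq _) path_trivI mHD.
  by rewrite path_cover; apply => t _; rewrite lee_fin.
apply: eq_bigr => p _.
have mphi := measurable_noise_comp (bphi p).
have dn0 : 0 <= (d%:R ^- n : R) by rewrite invr_ge0 exprn_ge0.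
pose mu1 : {measure set (T * T) -> \bar R} := mrestr Q (mp p).
pose mu2 : {measure set (T * T) -> \bar R} := mscale (NngNum dn0) Q.
rewrite -(@ge0_integral_mscale _ _ _ Q setT measurableT (NngNum dn0)); last 2 first.
- exact/measurable_EFinP.
- by move=> t _; rewrite lee_fin.
transitivity (\int[mu1]_t (phi p (noise t))%:E)%E; last first.
  apply: (@eq_law_integral R _ _ _ _ mu1 mu2 _ R (phi p \o noise) (phi p \o noise) EFin) => //.
  by move=> B mB; exact: (noise_on_path model gY (path_of k0 p) (bphi p B mB)).
rewrite (eq_integral (fun t => (phi p (noise t))%:E)); last first.
  by move=> t; rewrite inE => tp; rewrite (Hphi p).
(* The restricted measure has the indicator of the path event as its density with respect to [Q]. *)
rewrite (@ge0_integral_density _ _ R Q mu1 (\1_(on_path p)) (fun t => (phi p (noise t))%:E)).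
- rewrite integral_mkcond; apply: eq_integral => t _; rewrite patchE indicE.
  by case: ifPn => _; rewrite ?mule1 ?mule0.
- by move=> t; rewrite indicE.
- exact: measurable_indic.
- by move=> A mA; rewrite integral_indic// setIC.
- exact/measurable_EFinP.
- by move=> t; rewrite lee_fin.
Qed.

Lemma path_rep_L2 H phi : path_rep H phi -> (forall p, L2 Q (phi p \o noise)) ->
  L2 Q H /\ Ex Q (fun t => H t ^+ 2) =
    \sum_(p : path) d%:R ^- n * Ex Q (fun t => phi p (noise t) ^+ 2).
Proof.
move=> rH Lphi; have mH := path_rep_measurable rH; have [bphi Hphi] := rH.
have rH2 : path_rep (fun t => H t ^+ 2) (fun p z => phi p z ^+ 2).
  split=> [p|p t tp]; last by rewrite (Hphi p).
  have -> : (fun z => phi p z ^+ 2) = (fun z => phi p z * phi p z).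
    by apply/funext => z; rewrite expr2.
  exact: borel_funM.
have E : (\int[Q]_t (H t ^+ 2)%:E =
    (\sum_(p : path) d%:R ^- n * Ex Q (fun t => phi p (noise t) ^+ 2))%:E)%E.
  rewrite (path_rep_integral rH2); last 2 first.
  - by move=> t; exact: sqr_ge0.
  - by move=> p z; exact: sqr_ge0.
  rewrite -sumEFin; apply: eq_bigr => p _; rewrite EFinM; congr (_ * _)%E.
  by rewrite /Ex /Rintegral fineK//; have [_ /integrable_fin_num->] := Lphi p.
split; last by rewrite {1}/Ex /Rintegral E.
by apply: L2_lt_pinfty => //; rewrite E ltry.
Qed.

(** Polarization from the squares of [H], [K] and [H + K], since the decomposition of integrals is
    stated for nonnegative functions. *)
Lemma path_rep_ExM H K phi psi : path_rep H phi -> path_rep K psi ->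
  (forall p, L2 Q (phi p \o noise)) -> (forall p, L2 Q (psi p \o noise)) ->
  Ex Q (fun t => H t * K t) =
    \sum_(p : path) d%:R ^- n * Ex Q (fun t => phi p (noise t) * psi p (noise t)).
Proof.
move=> rH rK LH LK.
have rHK : path_rep (fun t => H t + K t) (fun p z => phi p z + psi p z).
  case: rH rK => [b1 e1] [b2 e2]; split=> [p|p t tp]; first exact: borel_funD.
  by rewrite (e1 p)// (e2 p).
have polar (F G : T * T -> R) : L2 Q F -> L2 Q G -> Ex Q (fun t => (F t + G t) ^+ 2) =
    Ex Q (fun t => F t ^+ 2) + Ex Q (fun t => G t ^+ 2) + 2 * Ex Q (fun t => F t * G t).
  move=> LF LG; have [_ LF2] := LF; have [_ LG2] := LG.
  rewrite -ExZ; last exact: L2M.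
  rewrite -ExD// -ExD; [|exact: L1D|by apply: L1Z; exact: L2M].
  by congr Ex; apply/funext => t; ring.
have [L2H EH] := path_rep_L2 rH LH; have [L2K EK] := path_rep_L2 rK LK.
have [_ EHK] := path_rep_L2 rHK (fun p => L2D (LH p) (LK p)).
have := polar _ _ L2H L2K; rewrite EHK EH EK => h.
have {}h : 2 * Ex Q (fun t => H t * K t) =
    \sum_(p : path) d%:R ^- n * (2 * Ex Q (fun t => phi p (noise t) * psi p (noise t))).
  rewrite (_ : \sum_p _ = \sum_(p : path) d%:R ^- n * Ex Q (fun t => (phi p (noise t) + psi p (noise t)) ^+ 2)
     - (\sum_(p : path) d%:R ^- n * Ex Q (fun t => phi p (noise t) ^+ 2) +
        \sum_(p : path) d%:R ^- n * Ex Q (fun t => psi p (noise t) ^+ 2))); first by rewrite h; ring.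
  rewrite -big_split -sumrB/=; apply: eq_bigr => p _.
  rewrite (polar _ _ (LH p) (LK p)) /=; ring.
have n2 : (2 : R) != 0 by rewrite pnatr_eq0.
apply: (mulfI n2); rewrite h mulr_sumr; apply: eq_bigr => p _; ring.
Qed.

End path_decomposition.

(** * Coupling of the stationary chain with chains restarted from 0 *)

Section coupling.
Context {R : realType} {d : nat} (V : 'M[R]_d) (lam kappa gamma : R) (h : 'cV[R]_d -> R)
  dT (T : measurableType dT) (P : probability T R)
  (i : nat -> T -> 'I_d) (g : nat -> T -> R) (Y : T -> 'cV[R]_d) (m Sigma : R).
Hypothesis d1 : (1 < d)%N.
Let d0 : (0 < d)%N := ltnW d1.
Hypothesis Vsym : V^T = V.
Hypothesis Vdiag : forall k : 'I_d, V k k = 1.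
Hypothesis Vpos : pos_def V.
Hypothesis Vlam : smallest_eigenvalue V lam.
Hypothesis model : iid_model P i g.
Hypothesis kappa0 : 0 < kappa.
Hypothesis gamma01 : 0 < gamma <= 1.
Hypothesis hlip : gauss_lipschitz kappa gamma V h.
Hypothesis gY : gaussian_vec P Y V.
Hypothesis mean : 'E_P[h \o Y]%E = m%:E.
Hypothesis var : 'V_P[h \o Y]%E = (Sigma ^+ 2)%:E.

Local Notation Q := (PP P).
Local Notation k0 := (Ordinal d0).

Let bh : borel_fun h := hlip.1.

Definition stat_dev (k : nat) (t : T * T) : R :=
  h (run V (fun a => i a t.2) (fun a => g a t.2) (Y t.1) 0 k) - m.

Definition zero_dev (j k : nat) (t : T * T) : R :=
  h (run V (fun a => i a t.2) (fun a => g a t.2) 0 j (k - j)) - m.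

Definition rate : R := (1 - lam / d%:R) `^ (gamma / 2).
(** The factor [d^gamma] is the power [gamma / 2] of [d^2]: one [d] is the mean of [V^-1(Y, Y)], the
    other comes from comparing the Euclidean norm with that of [V^-1]. *)
Definition bound (l : nat) : R := kappa * d%:R `^ gamma * rate ^+ l.

Let hY_measurable : measurable_fun setT (h \o Y).
Proof. by apply: measurable_borel_comp => // a; exact: gaussian_measurable_coord gY a. Qed.

Let var_int : (\int[P]_t ((h (Y t) - m) ^+ 2)%:E = (Sigma ^+ 2)%:E)%E.
Proof.
rewrite -var /variance unlock mean /= unlock; apply: eq_integral => t _.
by rewrite expr2.
Qed.

Lemma L2_hY : L2 P (fun t => h (Y t) - m).
Proof.
apply: L2_lt_pinfty; first exact: measurable_funB.
by rewrite var_int ltry.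
Qed.

Lemma Ex_hY : Ex P (fun t => h (Y t) - m) = 0.
Proof.
have L1h : L1 P (h \o Y).
  by apply: L1_ext (L1D (L2_L1 L2_hY) (L1_cst P m)) => t /=; rewrite subrK.
have := mean; rewrite ExpE// => -[e].
rewrite (ExB L1h (L1_cst P m)) e Ex_cst; exact: subrr.
Qed.

Lemma Ex_hY2 : Ex P (fun t => (h (Y t) - m) ^+ 2) = Sigma ^+ 2.
Proof. by rewrite /Ex /Rintegral var_int. Qed.

Section fixed_horizon.
Variable n : nat.
Local Notation path := {ffun 'I_n -> 'I_d}.
Local Notation noise := (noise_vec g Y n).
Local Notation C := (noise_cov V n).
Let statM (p : path) k := chain_mx V (path_of k0 p) (@start_mx R d n) 0 k.
Let zeroM (p : path) j k := chain_mx V (path_of k0 p) (0 : 'M[R]_(d, d + n)) j (k - j).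

Lemma noise_rowE a t : (a < n)%N -> g a t.2 = (@noise_row R d n a *m noise t) 0 0.
Proof.
move=> an; rewrite /noise_row /noise_vec mul_row_col mul0mx add0r mxE.
rewrite (bigD1 (Ordinal an))//= !mxE eqxx mul1r big1 ?addr0// => k; rewrite !mxE => ka.
rewrite (_ : (val k == a) = false) ?mul0r//.
by apply/negbTE; apply: contra ka => /eqP ka; apply/eqP/val_inj.
Qed.

Let path_eq (p : path) t a : on_path i n (path_of k0 p) t -> (a < n)%N ->
  i a t.2 = path_of k0 p a.
Proof. by move=> [_ tp] an; exact: (tp a an). Qed.

Lemma stat_rep k : (k <= n)%N ->
  path_rep i g Y k0 (stat_dev k) (fun p z => h (statM p k *m z) - m).
Proof.
move=> kn; split=> [p|p t tp].
  by apply: borel_funB; [exact: borel_fun_mulmx|exact: borel_fun_cst].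
rewrite /stat_dev; congr (h _ - m).
rewrite -(@run_chain_mx R d V n (path_of k0 p) (fun a => g a t.2))//.
- have -> : @start_mx R d n *m noise t = Y t.1.
    by rewrite /start_mx mul_row_col mul1mx mul0mx addr0.
  by apply: run_ext => a; rewrite add0n => ak//; apply: path_eq tp _; exact: leq_trans ak kn.
- by move=> a an; exact: noise_rowE.
Qed.

Lemma zero_rep j k : (j <= k <= n)%N ->
  path_rep i g Y k0 (zero_dev j k) (fun p z => h (zeroM p j k *m z) - m).
Proof.
move=> /andP[jk kn]; split=> [p|p t tp].
  by apply: borel_funB; [exact: borel_fun_mulmx|exact: borel_fun_cst].
rewrite /zero_dev; congr (h _ - m).
rewrite -(@run_chain_mx R d V n (path_of k0 p) (fun a => g a t.2)) ?subnKC//.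
- rewrite mul0mx; apply: run_ext => a //; rewrite subnKC// => /andP[_ ak].
  by apply: path_eq tp _; exact: leq_trans ak kn.
- by move=> a an; exact: noise_rowE.
Qed.

Let gN := noise_gaussian model gY n.

Lemma stat_gaussian p k : (k <= n)%N -> gaussian_vec Q (fun t => statM p k *m noise t) V.
Proof.
move=> kn; have := gaussian_lin gN (statM p k).
have := @chain_mx_cov R d V n Vsym Vdiag (path_of k0 p) (@start_mx R d n) 0 k kn
  (fun a _ => @start_orth R d V n a).
by rewrite start_cov subrr mulmx0 mul0mx => /eqP; rewrite subr_eq0 => /eqP <-.
Qed.

Let S2 p j k := zeroM p j k *m C *m (zeroM p j k)^T.

Let zero_gaussian p j k : gaussian_vec Q (fun t => zeroM p j k *m noise t) (S2 p j k).
Proof. exact: (gaussian_lin gN (zeroM p j k)). Qed.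

Let zero_psd p j k : (j <= k <= n)%N -> psd_le (S2 p j k) V.
Proof.
move=> /andP[jk kn] u.
have jn : (j + (k - j) <= n)%N by rewrite subnKC.
have := @chain_mx_cov R d V n Vsym Vdiag (path_of k0 p) 0 j (k - j) jn.
rewrite /S2 => ->; last by move=> a _; rewrite !mul0mx.
rewrite !mul0mx subr0; have [_ V0 _] := gY.
have := V0 ((refl_prod V (path_of k0 p) j (k - j))^T *m u).
by rewrite trmx_mul trmxK !mulmxA.
Qed.

Let NN (p : path) j l := refl_prod V (path_of k0 p) j l.

Let statM_split (p : path) j l : statM p (j + l) = chain_mx V (path_of k0 p) (statM p j) j l.
Proof. by elim: l => [|l IH]; rewrite ?addn0// addnS /= -IH. Qed.

Let diffE p j k : (j <= k)%N -> statM p k - zeroM p j k = NN p j (k - j) *m statM p j.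
Proof. by move=> jk; rewrite -[in LHS](subnKC jk) statM_split subnKC// chain_mx_diff. Qed.

Let stat_covE p k : (k <= n)%N -> statM p k *m C *m (statM p k)^T = V.
Proof.
move=> kn; rewrite -(gaussian_cov (gaussian_lin gN (statM p k))).
exact: gaussian_cov (stat_gaussian p kn).
Qed.

Let trN p j l : \tr (NN p j l *m V *m (NN p j l)^T) = Ex P (fun t => sqnorm (NN p j l *m Y t)).
Proof.
have := gaussian_Ex_quad gY ((NN p j l)^T *m NN p j l).
rewrite mxtrace_mulC mulmxA [in RHS]mxtrace_mulC mulmxA -mulmxA mxtrace_mulC => <-.
congr Ex; apply/funext => t; rewrite sqnormE /bf mulmx1 trmx_mul !mulmxA.
by [].
Qed.

(** On a fixed path the two states differ by a matrix applied to an [N(0, V)] vector, so their mean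
    square distance can be written with [Y] itself. In that form the average over paths can be taken
    pointwise in [Y]. *)
Lemma diff_path_le p j k : (j <= k <= n)%N ->
  L2 Q (fun t => h (statM p k *m noise t) - h (zeroM p j k *m noise t)) /\
  Ex Q (fun t => (h (statM p k *m noise t) - h (zeroM p j k *m noise t)) ^+ 2) <=
    kappa ^+ 2 * (Ex P (fun t => sqnorm (NN p j (k - j) *m Y t))) `^ gamma.
Proof.
move=> jkn; have /andP[jk kn] := jkn.
have gc : centered_gaussian_vec Q
    (fun t => col_mx (statM p k *m noise t) (zeroM p j k *m noise t)).
  have := gaussian_centered (gaussian_lin gN (col_mx (statM p k) (zeroM p j k))).
  by under [in X in X -> _]eq_fun do rewrite mul_col_mx.
have [_ /(_ _ _ Q _ _ gc)] := hlip.
rewrite (gaussian_cov (stat_gaussian p kn)) (gaussian_cov (zero_gaussian p j k)).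
have pV : psd_le V V by move=> u; rewrite subrr mulmx0 mul0mx mxE.
move=> /(_ pV (zero_psd p jkn)).
have gD := gaussian_lin gN (NN p j (k - j) *m statM p j).
have sE t : sqnorm (statM p k *m noise t - zeroM p j k *m noise t) =
    (((NN p j (k - j) *m statM p j) *m noise t)^T *m 1%:M *m
      ((NN p j (k - j) *m statM p j) *m noise t)) 0 0.
  by rewrite -mulmxBl diffE// sqnormE.
have -> : 'E_Q[fun t => sqnorm (statM p k *m noise t - zeroM p j k *m noise t)%R]%E =
    (Ex P (fun t => sqnorm (NN p j (k - j) *m Y t)))%:E.
  rewrite ExpE; last by apply: L1_ext (gaussian_L1_quad gD 1%:M) => t; rewrite sE.
  congr EFin; rewrite -trN -[LHS]/(Ex Q _).
  transitivity (Ex Q (fun t => (((NN p j (k - j) *m statM p j) *m noise t)^T *m 1%:M *m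
      ((NN p j (k - j) *m statM p j) *m noise t)) 0 0)).
    by congr Ex; apply/funext => t; exact: sE.
  rewrite (gaussian_Ex_quad gD) mul1mx trmx_mul; congr (\tr _).
  transitivity (NN p j (k - j) *m (statM p j *m C *m (statM p j)^T) *m (NN p j (k - j))^T); first by rewrite !mulmxA.
  by rewrite stat_covE// (leq_trans jk).
rewrite unlock /= => hE.
have LD : L2 Q (fun t => h (statM p k *m noise t) - h (zeroM p j k *m noise t)).
  apply: L2_lt_pinfty; last exact: le_lt_trans hE (ltry _).
  apply: measurable_funB.
    exact: (measurable_noise_comp model gY (borel_fun_mulmx (statM p k) bh)).
  exact: (measurable_noise_comp model gY (borel_fun_mulmx (zeroM p j k) bh)).
split=> //; have [_ LD2] := LD.
by rewrite -lee_fin /Ex /Rintegral fineK//; exact: integrable_fin_num LD2.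
Qed.

Lemma stat_path_L2 p k : (k <= n)%N -> L2 Q (fun t => h (statM p k *m noise t) - m).
Proof.
move=> kn.
have bH : borel_fun (fun x => (h x - m) * (h x - m)).
  by apply: borel_funM; apply: borel_funB => //; exact: borel_fun_cst.
apply: L2_lt_pinfty.
  apply: measurable_funB => //.
  exact: (measurable_noise_comp model gY (borel_fun_mulmx (statM p k) bh)).
have := gaussian_vec_Ex (stat_gaussian p kn) gY bH => e.
under eq_integral do rewrite expr2.
rewrite e; under eq_integral do rewrite -expr2.
by rewrite var_int ltry.
Qed.

Lemma stat_path_Ex p k : (k <= n)%N -> Ex Q (fun t => h (statM p k *m noise t) - m) = 0.
Proof.
move=> kn; rewrite -Ex_hY /Ex /Rintegral; congr fine.
apply: (gaussian_vec_Ex (stat_gaussian p kn) gY (H := fun x => h x - m)).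
by apply: borel_funB => //; exact: borel_fun_cst.
Qed.

Lemma stat_path_Ex2 p k : (k <= n)%N ->
  Ex Q (fun t => (h (statM p k *m noise t) - m) ^+ 2) = Sigma ^+ 2.
Proof.
move=> kn; rewrite -Ex_hY2 /Ex /Rintegral; congr fine.
apply: (gaussian_vec_Ex (stat_gaussian p kn) gY (H := fun x => (h x - m) ^+ 2)).
have -> : (fun x => (h x - m) ^+ 2) = (fun x => (h x - m) * (h x - m)).
  by apply/funext => x; rewrite expr2.
by apply: borel_funM; apply: borel_funB => //; exact: borel_fun_cst.
Qed.

Lemma zero_path_L2 p j k : (j <= k <= n)%N -> L2 Q (fun t => h (zeroM p j k *m noise t) - m).
Proof.
move=> jkn; have /andP[jk kn] := jkn; have [LD _] := diff_path_le p jkn.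
by apply: L2_ext (L2B (stat_path_L2 p kn) LD) => t; ring.
Qed.

(** The two states are jointly Gaussian and uncorrelated, so the pair has the same law as
    independent copies on a further product space; there the mean factors, and the stationary factor
    is 0. *)
Lemma path_orth p j k : (j <= k <= n)%N ->
  Ex Q (fun t => (h (statM p j *m noise t) - m) * (h (zeroM p j k *m noise t) - m)) = 0.
Proof.
move=> jkn; have /andP[jk kn] := jkn; have jn := leq_trans jk kn.
have jl : (j + (k - j) <= n)%N by rewrite subnKC.
have orth : statM p j *m C *m (zeroM p j k)^T = 0.
  apply: chain_mx0_orth => // a /andP[ja an].
  by apply: chain_mx_orth => //; rewrite ?add0n ?ja// => b _; exact: start_orth.
have orth' : zeroM p j k *m C *m (statM p j)^T = 0.
  apply: trmx_inj; rewrite !trmx_mul trmxK noise_cov_sym// mulmxA orth trmx0//.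
have gJ : gaussian_vec Q (fun t => col_mx (statM p j *m noise t) (zeroM p j k *m noise t))
    (block_mx V 0 0 (S2 p j k)).
  have := gaussian_lin gN (col_mx (statM p j) (zeroM p j k)).
  under [in X in X -> _]eq_fun do rewrite mul_col_mx.
  by rewrite mul_col_mx tr_col_mx mul_col_row stat_covE// orth orth'.
have gI := gaussian_pair (stat_gaussian p jn) (zero_gaussian p j k).
pose H (w : 'cV[R]_(d + d)) := (h (row_mx 1%:M 0 *m w) - m) * (h (row_mx 0 1%:M *m w) - m).
have bH : borel_fun H.
  by apply: borel_funM; apply: borel_funB; first [exact: borel_fun_mulmx|exact: borel_fun_cst].
have HE x y : H (col_mx x y) = (h x - m) * (h y - m).
  by rewrite /H !mul_row_col !mul1mx !mul0mx addr0 add0r.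
have := gaussian_vec_Ex gJ gI bH.
under eq_integral do rewrite HE.
under [in X in _ = X]eq_integral do rewrite HE.
move=> e; rewrite /Ex /Rintegral e.
have := Ex_prod_indep (stat_path_L2 p jn) (zero_path_L2 p jkn).
by rewrite stat_path_Ex// mul0r.
Qed.

Let card_path : (d%:R ^- n : R) * #|{: path}|%:R = 1.
Proof.
rewrite card_ffun !card_ord natrX mulVf// expf_neq0// pnatr_eq0 -lt0n//.
Qed.

Let dn0 : 0 <= (d%:R ^- n : R). Proof. by rewrite invr_ge0 exprn_ge0. Qed.

Let dR : 0 < d%:R :> R. Proof. by rewrite ltr0n. Qed.

Let l0 : 0 < lam. Proof. exact: (lam_gt0 Vsym Vpos Vlam). Qed.
Let l1 : lam <= 1. Proof. exact: (lam_le1 Vsym Vdiag Vpos Vlam d0). Qed.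

Let sqL1 p j l : L1 P (fun t => sqnorm (NN p j l *m Y t)).
Proof.
apply: L1_ext (gaussian_L1_quad gY ((NN p j l)^T *m NN p j l)) => t.
by rewrite sqnormE /bf mulmx1 trmx_mul !mulmxA.
Qed.

(** Pass to the norm of [V^-1] at the cost of a factor [d], contract, and use that the mean of
    [V^-1(Y, Y)] is the trace of [V^-1 V], again [d]. *)
Lemma path_average_sqnorm j l : (j + l <= n)%N ->
  \sum_(p : path) d%:R ^- n * Ex P (fun t => sqnorm (NN p j l *m Y t)) <=
  d%:R ^+ 2 * (1 - lam / d%:R) ^+ l.
Proof.
move=> jln.
have -> : \sum_(p : path) d%:R ^- n * Ex P (fun t => sqnorm (NN p j l *m Y t)) =
    Ex P (fun t => \sum_(p : path) d%:R ^- n * sqnorm (NN p j l *m Y t)).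
  rewrite Ex_sum; last by move=> p; exact: L1Z.
  by apply: eq_bigr => p _; rewrite ExZ.
have trVi : Ex P (fun t => bf (invmx V) (Y t) (Y t)) = d%:R.
  rewrite /bf (gaussian_Ex_quad gY) mulVmx ?mxtrace1//; exact: V_unit Vpos.
have LVi : L1 P (fun t => bf (invmx V) (Y t) (Y t)) by exact: gaussian_L1_quad gY _.
have -> : d%:R ^+ 2 * (1 - lam / d%:R) ^+ l =
    Ex P (fun t => d%:R * (1 - lam / d%:R) ^+ l * bf (invmx V) (Y t) (Y t)).
  by rewrite ExZ// trVi; ring.
apply: Ex_le; [by apply: L1_sum => p; exact: L1Z|exact: L1Z|move=> t].
have := path_average_contraction k0 Vsym Vdiag Vpos Vlam (Y t) jln => hc.
apply: (@le_trans _ _ (d%:R * (d%:R ^- n * \sum_(p : path) bf (invmx V) (NN p j l *m Y t) (NN p j l *m Y t)))).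
  rewrite !mulr_sumr; apply: ler_sum => p _; rewrite mulrCA ler_wpM2l//.
  exact: (sqnorm_le_inv Vsym Vdiag Vpos).
rewrite -[leRHS]mulrA ler_wpM2l ?(ltW dR)//.
apply: (le_trans (ler_wpM2l dn0 hc)); rewrite !mulrA mulVf ?mul1r//.
by rewrite expf_neq0// gt_eqF.
Qed.

Lemma powRX (a : R) k : 0 <= a -> (a ^+ k) `^ gamma = (a `^ gamma) ^+ k.
Proof. by move=> a0; rewrite -!powR_mulrn ?powR_ge0// -!powRrM mulrC. Qed.

Let ratio0 : 0 < 1 - lam / d%:R.
Proof.
rewrite subr_gt0 ltr_pdivrMr// mul1r; apply: (le_lt_trans l1).
by rewrite ltr1n.
Qed.

Lemma bound_sqr l : bound l ^+ 2 =
  kappa ^+ 2 * (d%:R ^+ 2 * (1 - lam / d%:R) ^+ l) `^ gamma.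
Proof.
rewrite powRM ?exprn_ge0 ?(ltW ratio0)// !powRX ?(ltW ratio0)//.
rewrite /bound !exprMn mulrA; congr (_ * _).
rewrite -exprM mulnC exprM; congr (_ ^+ l).
by rewrite /rate -powR_mulrn ?powR_ge0// -powRrM divfK.
Qed.

Lemma diff_le j k : (j <= k <= n)%N ->
  L2 Q (fun t => stat_dev k t - zero_dev j k t) /\
  Ex Q (fun t => (stat_dev k t - zero_dev j k t) ^+ 2) <= bound (k - j) ^+ 2.
Proof.
move=> jkn; have /andP[jk kn] := jkn.
have rep : path_rep i g Y k0 (fun t => stat_dev k t - zero_dev j k t)
    (fun p z => h (statM p k *m z) - h (zeroM p j k *m z)).
  have [b1 e1] := stat_rep kn; have [b2 e2] := zero_rep jkn; split=> [p|p t tp].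
    by apply: borel_funB; exact: borel_fun_mulmx.
  by rewrite (e1 p)// (e2 p)//; ring.
have [LD ED] := path_rep_L2 model gY rep (fun p => (diff_path_le p jkn).1).
split=> //; rewrite ED bound_sqr.
have k20 : 0 <= kappa ^+ 2 by exact: sqr_ge0.
apply: (@le_trans _ _ (\sum_(p : path) d%:R ^- n *
   (kappa ^+ 2 * (Ex P (fun t => sqnorm (NN p j (k - j) *m Y t))) `^ gamma))).
  by apply: ler_sum => p _; rewrite ler_wpM2l//; exact: (diff_path_le p jkn).2.
under eq_bigr do rewrite mulrCA.
rewrite -mulr_sumr ler_wpM2l//.
have E0 p : 0 <= Ex P (fun t => sqnorm (NN p j (k - j) *m Y t)).
  by apply: Ex_ge0 => t; exact: sqnorm_ge0.
apply: (le_trans (powR_jensen gamma01 dn0 card_path E0)).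
have /andP[g0 _] := gamma01.
apply: ge0_ler_powR; rewrite ?nnegrE ?(ltW g0)//.
- by apply: sumr_ge0 => p _; rewrite mulr_ge0.
- by rewrite mulr_ge0 ?sqr_ge0// exprn_ge0// ltW.
by apply: path_average_sqnorm; rewrite subnKC.
Qed.

Lemma stat_L2 k : (k <= n)%N -> L2 Q (stat_dev k).
Proof. by move=> kn; have [] := path_rep_L2 model gY (stat_rep kn) (fun p => stat_path_L2 p kn). Qed.

Lemma stat_Ex2 k : (k <= n)%N -> Ex Q (fun t => stat_dev k t ^+ 2) = Sigma ^+ 2.
Proof.
move=> kn; have [_ ->] := path_rep_L2 model gY (stat_rep kn) (fun p => stat_path_L2 p kn).
under eq_bigr do rewrite stat_path_Ex2//.
by rewrite sumr_const -[LHS]mulr_natr mulrAC card_path mul1r.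
Qed.

Lemma stat_Ex k : (k <= n)%N -> Ex Q (stat_dev k) = 0.
Proof.
(* Pairing with the constant 1 turns the formula for products into one for the mean, whose integrand
   has no sign. *)
move=> kn; have rc : path_rep i g Y k0 (n := n) (fun=> 1) (fun _ _ => 1).
  by split=> // p; exact: borel_fun_cst.
have := path_rep_ExM model gY (stat_rep kn) rc (fun p => stat_path_L2 p kn) (fun=> L2_cst Q 1).
rewrite big1 => [<-|p _]; first by congr Ex; apply/funext => t; rewrite mulr1.
rewrite -[X in _ * X = _](_ : Ex Q (fun t => h (statM p k *m noise t) - m) = _).
  by rewrite stat_path_Ex// mulr0.
by congr Ex; apply/funext => t; rewrite mulr1.
Qed.

Lemma stat_zero_orth j k : (j <= k <= n)%N ->
  Ex Q (fun t => stat_dev j t * zero_dev j k t) = 0.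
Proof.
move=> jkn; have /andP[jk kn] := jkn; have jn := leq_trans jk kn.
rewrite (path_rep_ExM model gY (stat_rep jn) (zero_rep jkn) (fun p => stat_path_L2 p jn)
  (fun p => zero_path_L2 p jkn)).
by rewrite big1// => p _; rewrite path_orth// mulr0.
Qed.

End fixed_horizon.

(** The Lipschitz hypothesis with [X' = 0]: the variance is at most the mean square of
    [h (Y) - h 0], and the mean of the squared norm of [Y] is the trace of [V], that is [d]. *)
Lemma Sigma_sqr_le : Sigma ^+ 2 <= kappa ^+ 2 * d%:R `^ gamma.
Proof.
have gc : centered_gaussian_vec P (fun t => col_mx (Y t) ((0 : 'M[R]_d) *m Y t)).
  have := gaussian_centered (gaussian_lin gY (col_mx 1%:M (0 : 'M[R]_d))).
  by under [in X in X -> _]eq_fun do rewrite mul_col_mx mul1mx.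
have [_ /(_ _ _ P _ _ gc)] := hlip.
rewrite (gaussian_cov gY) (gaussian_cov (gaussian_lin gY (0 : 'M[R]_d))).
have pV : psd_le V V by move=> u; rewrite subrr mulmx0 mul0mx mxE.
have p0 : psd_le (0 *m V *m (0 : 'M[R]_d)^T) V.
  by move=> u; rewrite !mul0mx subr0; have [_ + _] := gY; apply.
move=> /(_ pV p0).
have -> : 'E_P[fun t => sqnorm (Y t - (0 : 'M[R]_d) *m Y t)%R]%E = (d%:R : R)%:E.
  have sE t : sqnorm (Y t - (0 : 'M[R]_d) *m Y t) = ((Y t)^T *m 1%:M *m Y t) 0 0.
    by rewrite mul0mx subr0 sqnormE.
  rewrite ExpE; last by apply: L1_ext (gaussian_L1_quad gY 1%:M) => t; rewrite sE.
  have -> : Ex P (fun t => sqnorm (Y t - (0 : 'M[R]_d) *m Y t)) =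
      Ex P (fun t => ((Y t)^T *m 1%:M *m Y t) 0 0).
    by congr Ex; apply/funext => t; exact: sE.
  rewrite (gaussian_Ex_quad gY) mul1mx /mxtrace; congr EFin.
  by under eq_bigr do rewrite Vdiag; rewrite sumr_const card_ord.
set c := m - h 0.
have LhY := L2_hY; have [_ LhY2] := LhY; have LhY1 := L2_L1 LhY.
have E t : (h (Y t) - h ((0 : 'M[R]_d) *m Y t)) ^+ 2 =
    ((h (Y t) - m) ^+ 2 + 2 * c * (h (Y t) - m)) + c ^+ 2.
  by rewrite mul0mx /c; ring.
have LL : L1 P (fun t => (h (Y t) - m) ^+ 2 + 2 * c * (h (Y t) - m)).
  by apply: L1D => //; exact: L1Z.
have L0 : L1 P (fun t => (h (Y t) - h ((0 : 'M[R]_d) *m Y t)) ^+ 2).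
  by apply: L1_ext (L1D LL (L1_cst P (c ^+ 2))) => t; rewrite E.
rewrite (ExpE L0) lee_fin; apply: le_trans.
have -> : Ex P (fun t => (h (Y t) - h ((0 : 'M[R]_d) *m Y t)) ^+ 2) =
    Ex P (fun t => ((h (Y t) - m) ^+ 2 + 2 * c * (h (Y t) - m)) + c ^+ 2).
  by congr Ex; apply/funext => t; exact: E.
rewrite (ExD LL (L1_cst P (c ^+ 2))) Ex_cst ExD ?ExZ//; last exact: L1Z.
by rewrite Ex_hY Ex_hY2 mulr0 addr0 lerDl sqr_ge0.
Qed.

End coupling.

(** * Bias and mean square error of the time average *)

Section averages.
Context {R : realType} {d : nat} (V : 'M[R]_d) (lam kappa gamma : R) (h : 'cV[R]_d -> R)
  dT (T : measurableType dT) (P : probability T R)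
  (i : nat -> T -> 'I_d) (g : nat -> T -> R) (Y : T -> 'cV[R]_d) (m Sigma : R).
Hypothesis d3 : (3 <= d)%N.
Hypothesis Vsym : V^T = V.
Hypothesis Vdiag : forall k : 'I_d, V k k = 1.
Hypothesis Vpos : pos_def V.
Hypothesis Vlam : smallest_eigenvalue V lam.
Hypothesis model : iid_model P i g.
Hypothesis kappa0 : 0 < kappa.
Hypothesis gamma01 : 0 < gamma <= 1.
Hypothesis hlip : gauss_lipschitz kappa gamma V h.
Hypothesis gY : gaussian_vec P Y V.
Hypothesis mean : 'E_P[h \o Y]%E = m%:E.
Hypothesis var : 'V_P[h \o Y]%E = (Sigma ^+ 2)%:E.
Hypothesis Sigma0 : 0 < Sigma.

Local Notation Q := (PP P).
Local Notation F := (stat_dev V h i g Y m).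
Local Notation Z := (zero_dev V h i g m 0).
Local Notation rho := (@rate R d lam gamma).
Local Notation b := (@bound R d lam kappa gamma).

Let d1 : (1 < d)%N := ltnW d3.
Let d0 : (0 < d)%N := ltnW d1.
Let dR : 0 < d%:R :> R. Proof. by rewrite ltr0n. Qed.
Let dge3 : 3 <= d%:R :> R. Proof. by rewrite ler_nat. Qed.
Let l0 : 0 < lam. Proof. exact: (lam_gt0 Vsym Vpos Vlam). Qed.
Let l1 : lam <= 1. Proof. exact: (lam_le1 Vsym Vdiag Vpos Vlam d0). Qed.

Let dpow : d%:R `^ gamma <= d%:R :> R.
Proof.
have /andP[_ g1] := gamma01; have dge1 : 1 <= d%:R :> R by rewrite ler1n.
by rewrite -[leRHS]powRr1 ?(ltW dR)//; exact: (ler_powR dge1 g1).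
Qed.

(** A lower bound for [1 - rho], obtained from the tangent bound with exponent [gamma / 2]. The real
    number rounded up to [delta] is [2 ln (kappa d / Sigma) / gap]. *)
Definition gap : R := lam * gamma / (2 * d%:R).

Lemma gap_gt0 : 0 < gap.
Proof. by have /andP[g0 _] := gamma01; rewrite /gap divr_gt0 ?mulr_gt0. Qed.

Let ratio0 : 0 < 1 - lam / d%:R.
Proof. by rewrite subr_gt0 ltr_pdivrMr// mul1r (le_lt_trans l1)// ltr1n. Qed.

Lemma rate_gt0 : 0 < rho.
Proof. exact: powR_gt0. Qed.

Lemma rate_le : rho <= 1 - gap.
Proof.
have /andP[g0 g1] := gamma01.
have g2 : 0 <= gamma / 2 <= 1 by apply/andP; split; lra.
apply: (le_trans (powR_le_tangent ratio0 g2)).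
rewrite le_eqVlt; apply/orP; left; apply/eqP; rewrite /gap; field.
by rewrite gt_eqF.
Qed.

Lemma rate_lt1 : rho < 1.
Proof. by have := rate_le; have := gap_gt0; lra. Qed.

Lemma inv_rate_le : (1 - rho)^-1 <= gap^-1.
Proof.
rewrite lef_pV2 ?posrE ?gap_gt0//; last by rewrite subr_gt0 rate_lt1.
have := rate_le; lra.
Qed.

Lemma rateX_le N : rho ^+ N <= expR (- (gap * N%:R)).
Proof.
have -> : - (gap * N%:R) = N%:R * - gap by ring.
rewrite expRM_natl lerXn2r ?nnegrE ?expR_ge0// ?(ltW rate_gt0)//.
exact: le_trans rate_le (expR_ge1Dx _).
Qed.

Lemma bound_ge0 l : 0 <= b l.
Proof. by rewrite /bound !mulr_ge0 ?powR_ge0 ?exprn_ge0// ?ltW// rate_gt0. Qed.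

Let F_L2 k : L2 Q (F k).
Proof. exact: (stat_L2 d1 Vsym Vdiag model hlip gY mean var (leqnn k)). Qed.

Let F_Ex k : Ex Q (F k) = 0.
Proof. exact: (stat_Ex d1 Vsym Vdiag model hlip gY mean var (leqnn k)). Qed.

Let F_Ex2 k : Ex Q (fun t => F k t ^+ 2) = Sigma ^+ 2.
Proof. exact: (stat_Ex2 d1 Vsym Vdiag model hlip gY mean var (leqnn k)). Qed.

Let jkk j k : (j <= k)%N -> (j <= k <= k)%N. Proof. by move=> ->; rewrite leqnn. Qed.

Let diff_L2 j k : (j <= k)%N -> L2 Q (fun t => F k t - zero_dev V h i g m j k t).
Proof. by move=> jk; have [] := diff_le m d1 Vsym Vdiag Vpos Vlam model gamma01 hlip gY (jkk jk). Qed.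

Let diff_Ex j k : (j <= k)%N ->
  Ex Q (fun t => (F k t - zero_dev V h i g m j k t) ^+ 2) <= b (k - j) ^+ 2.
Proof. by move=> jk; have [] := diff_le m d1 Vsym Vdiag Vpos Vlam model gamma01 hlip gY (jkk jk). Qed.

Let Zj_L2 j k : (j <= k)%N -> L2 Q (zero_dev V h i g m j k).
Proof. by move=> jk; apply: L2_ext (L2B (F_L2 k) (diff_L2 jk)) => t; ring. Qed.

Lemma stat_cov_le j k : (j <= k)%N -> Ex Q (fun t => F j t * F k t) <= Sigma * b (k - j).
Proof.
move=> jk; pose D t := F k t - zero_dev V h i g m j k t.
have -> : (fun t => F j t * F k t) = (fun t => F j t * D t + F j t * zero_dev V h i g m j k t).
  by apply/funext => t; rewrite /D; ring.
rewrite ExD; [|exact: L2M (F_L2 j) (diff_L2 jk)|exact: L2M (F_L2 j) (Zj_L2 jk)].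
rewrite (stat_zero_orth d1 Vsym Vdiag model hlip gY mean var (jkk jk)) addr0.
apply: (le_trans (ler_norm _)).
apply: (Ex_mul_le (F_L2 j) (diff_L2 jk) (ltW Sigma0) (bound_ge0 _)); last exact: diff_Ex.
by rewrite F_Ex2.
Qed.

Lemma stat_cov_le2 j k : Ex Q (fun t => F j t * F k t) <= Sigma ^+ 2.
Proof.
rewrite expr2; apply: (le_trans (ler_norm _)).
by apply: (Ex_mul_le (F_L2 j) (F_L2 k) (ltW Sigma0) (ltW Sigma0)); rewrite F_Ex2.
Qed.

Lemma zero_Ex_le k : `|Ex Q (Z k)| <= b k.
Proof.
have LD := diff_L2 (leq0n k); have LZ := Zj_L2 (leq0n k).
have -> : Ex Q (Z k) = - Ex Q (fun t => F k t - Z k t).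
  by rewrite (ExB (L2_L1 (F_L2 k)) (L2_L1 LZ)) F_Ex sub0r opprK.
rewrite normrN; apply: Ex_norm_le => //; first exact: bound_ge0.
by have := diff_Ex (leq0n k); rewrite subn0.
Qed.

Definition zero_avg N (t : T * T) : R := (\sum_(j < N) Z (N + j)%N t) / N%:R.

Lemma zero_avg_L2 N : L2 Q (zero_avg N).
Proof.
apply: L2_ext (L2Z N%:R^-1 (L2_sum (index_enum 'I_N) (fun j : 'I_N => Zj_L2 (leq0n (N + j))))) => t.
by rewrite mulrC.
Qed.

Lemma sum_bound_le N : \sum_(j < N) b (N + j)%N <= kappa * d%:R `^ gamma * rho ^+ N / gap.
Proof.
have -> : \sum_(j < N) b (N + j)%N = kappa * d%:R `^ gamma * rho ^+ N * \sum_(j < N) rho ^+ j.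
  by rewrite mulr_sumr; apply: eq_bigr => j _; rewrite /bound exprD mulrA.
rewrite ler_wpM2l// ?mulr_ge0 ?powR_ge0 ?exprn_ge0 ?(ltW kappa0) ?(ltW rate_gt0)//.
apply: le_trans inv_rate_le; apply: geometric_sum_le.
by rewrite (ltW rate_gt0) rate_lt1.
Qed.

Lemma zero_avg_Ex_le N : (0 < N)%N ->
  `|Ex Q (zero_avg N)| <= kappa * d%:R `^ gamma * rho ^+ N / gap / N%:R.
Proof.
move=> N0.
have -> : Ex Q (zero_avg N) = N%:R^-1 * \sum_(j < N) Ex Q (Z (N + j)%N).
  rewrite -Ex_sum; last by move=> j; apply: L2_L1; exact: Zj_L2.
  rewrite -ExZ; last by apply: L1_sum => j; apply: L2_L1; exact: Zj_L2.
  by congr Ex; apply/funext => t; rewrite /zero_avg mulrC.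
rewrite normrM ger0_norm ?invr_ge0// mulrC ler_wpM2r ?invr_ge0//.
apply: le_trans (sum_bound_le N); apply: (le_trans (ler_norm_sum _ _ _)).
by apply: ler_sum => j _; exact: zero_Ex_le.
Qed.

Section second_moment.
Variables (N D : nat).
Hypothesis N0 : (0 < N)%N.
Hypothesis DN : (D < N)%N.
Hypothesis gapD : gap^-1 <= D%:R.
Hypothesis boundD : b D <= Sigma.

(** Up to lag [D] the covariance is bounded by the variance; beyond it the coupling bound, already
    below [Sigma] at [D], keeps decaying geometrically. *)
Let c l : R := Sigma ^+ 2 * rho ^+ (l - D).

Let bD l : (D <= l)%N -> b l <= Sigma * rho ^+ (l - D).
Proof.
move=> Dl; rewrite -{1}(subnKC Dl) /bound exprD mulrA ler_wpM2r//.
by rewrite exprn_ge0// ltW// rate_gt0.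
Qed.

Let cov_c j k : (j <= k)%N -> Ex Q (fun t => F j t * F k t) <= c (k - j).
Proof.
move=> jk; rewrite /c; have [lD|/ltnW Dl] := leqP (k - j) D.
  have -> : (k - j - D = 0)%N by apply/eqP; rewrite subn_eq0.
  by rewrite expr0 mulr1; exact: stat_cov_le2.
apply: (le_trans (stat_cov_le jk)); rewrite expr2 -mulrA ler_wpM2l ?(ltW Sigma0)//.
exact: bD.
Qed.

(** The sum for the chain from 0 is the stationary sum minus the coupling error, and
    [(x - y)^2 <= 2 x^2 + 2 y^2]. In units of [N D Sigma^2] the first has second moment at most 4
    and the second at most 1, hence the constant 8 + 2. *)
Lemma zero_avg_Ex2_le : Ex Q (fun t => zero_avg N t ^+ 2) <= 10 * D%:R * Sigma ^+ 2 / N%:R.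
Proof.
have r01 : 0 <= rho < 1 by rewrite (ltW rate_gt0) rate_lt1.
have S0 : 0 <= Sigma ^+ 2 by exact: sqr_ge0.
have NR : 0 < N%:R :> R by rewrite ltr0n.
pose SF t := \sum_(j < N) F (N + j)%N t.
pose SZ t := \sum_(j < N) Z (N + j)%N t.
pose SD t := \sum_(j < N) (F (N + j)%N t - Z (N + j)%N t).
have LSF : L2 Q SF by apply: L2_sum => j; exact: F_L2.
have LSD : L2 Q SD by apply: L2_sum => j; exact: diff_L2.
have LSZ : L2 Q SZ by apply: L2_sum => j; exact: Zj_L2.
have SZE t : SZ t = SF t - SD t by rewrite /SZ /SF /SD -sumrB; apply: eq_bigr => j _; ring.
have h1 : Ex Q (fun t => SF t ^+ 2) <= N%:R * (2 * (Sigma ^+ 2 * (D%:R + D%:R))).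
  apply: (@Ex_stationary_sum_le R _ _ Q F c) => //.
  - by move=> l; rewrite /c mulr_ge0// exprn_ge0//; case/andP: r01.
  - by move=> j k jk _; exact: cov_c.
  rewrite /c -mulr_sumr ler_wpM2l//; apply: (le_trans (geometric_sum_shift_le D N r01)).
  by rewrite lerD2l (le_trans inv_rate_le).
have h2 : Ex Q (fun t => SD t ^+ 2) <= N%:R * (D%:R * Sigma ^+ 2).
  have hSD : Ex Q (fun t => SD t ^+ 2) <= (\sum_(j < N) b (N + j)%N) ^+ 2.
    apply: (@Ex_sum_sqr_le R _ _ Q (fun j t => F j t - Z j t) b).
    - by move=> j; exact: diff_L2.
    - by move=> j; exact: bound_ge0.
    - by move=> j _; have := diff_Ex (leq0n j); rewrite subn0.
  apply: (le_trans hSD).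
  have s0 : 0 <= \sum_(j < N) b (N + j)%N by apply: sumr_ge0 => j _; exact: bound_ge0.
  (* As [D < N], each [b (N + j)] is at most [b (D + j)], hence at most [Sigma rho^j]. Squaring the
     resulting bound [Sigma D] and using [D <= N] once more gives [N D Sigma^2]. *)
  have sD : \sum_(j < N) b (N + j)%N <= Sigma * D%:R.
    apply: (@le_trans _ _ (Sigma * \sum_(j < N) rho ^+ j)).
      rewrite mulr_sumr; apply: ler_sum => j _.
      apply: (@le_trans _ _ (b (D + j)%N)).
        rewrite /bound ler_wpM2l ?mulr_ge0 ?powR_ge0 ?(ltW kappa0)//.
        by apply: ler_wiXn2l; [exact: ltW rate_gt0|exact: ltW rate_lt1|rewrite leq_add2r ltnW].
      by have := bD (leq_addr j D); rewrite addKn.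
    rewrite ler_wpM2l ?(ltW Sigma0)//; apply: (le_trans (geometric_sum_le N r01)).
    exact: le_trans inv_rate_le gapD.
  apply: (@le_trans _ _ ((Sigma * D%:R) ^+ 2)).
    by rewrite ler_sqr ?nnegrE// mulr_ge0// ltW.
  rewrite exprMn mulrC [D%:R ^+ 2]expr2 -!mulrA ler_wpM2r//; last by rewrite ler_nat ltnW.
  by rewrite mulr_ge0.
have [_ LF2] := LSF; have [_ LD2] := LSD; have [_ LZ2] := LSZ.
have h3 : Ex Q (fun t => SZ t ^+ 2) <= 2 * Ex Q (fun t => SF t ^+ 2) + 2 * Ex Q (fun t => SD t ^+ 2).
  rewrite -!ExZ// -ExD; [|exact: L1Z|exact: L1Z].
  apply: Ex_le => //; first by apply: L1D; exact: L1Z.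
  by move=> t; rewrite SZE; have := sqr_ge0 (SF t + SD t); rewrite !expr2; lra.
have -> : Ex Q (fun t => zero_avg N t ^+ 2) = (N%:R ^+ 2)^-1 * Ex Q (fun t => SZ t ^+ 2).
  rewrite -ExZ//; congr Ex; apply/funext => t.
  by rewrite /zero_avg -/(SZ t) expr_div_n mulrC.
have -> : 10 * D%:R * Sigma ^+ 2 / N%:R = (N%:R ^+ 2)^-1 * (N%:R * (10 * (D%:R * Sigma ^+ 2))).
  by field; rewrite gt_eqF.
rewrite ler_wpM2l ?invr_ge0 ?sqr_ge0//.
apply: (le_trans h3).
have p0 : 0 <= N%:R * (D%:R * Sigma ^+ 2) by apply: mulr_ge0 => //; apply: mulr_ge0.
move: h1 h2 p0; rewrite (_ : N%:R * (2 * (Sigma ^+ 2 * (D%:R + D%:R))) = 4 * (N%:R * (D%:R * Sigma ^+ 2))); last by ring.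
rewrite (_ : N%:R * (10 * (D%:R * Sigma ^+ 2)) = 10 * (N%:R * (D%:R * Sigma ^+ 2))); last by ring.
lra.
Qed.

End second_moment.

(** From [exp (-1/6) >= 5/6] and [(5/6)^6 >= 1/3]. *)
Lemma expR1_le3 : expR 1 <= 3 :> R.
Proof.
have h56 : 5 / 6 <= expR (- (1 / 6)) :> R by have := @expR_ge1Dx R (- (1 / 6)); lra.
have e0 := expR_gt0 (1 : R).
have -> : expR 1 = (expR (- (1 / 6)) ^+ 6)^-1 :> R.
  by rewrite -expRM_natl -expRN; congr expR; field.
have h6 : (5 / 6) ^+ 6 <= expR (- (1 / 6)) ^+ 6 :> R by rewrite lerXn2r ?nnegrE ?expR_ge0//; lra.
have p0 : 0 < expR (- (1 / 6)) ^+ 6 :> R by rewrite exprn_gt0// expR_gt0.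
rewrite -[leRHS]invrK lef_pV2 ?posrE ?invr_gt0//; apply: le_trans h6.
by rewrite -[X in X <= _]mul1r ler_pdivrMr//; lra.
Qed.

Let kS := kappa * d%:R / Sigma.

(** Both follow from [Sigma^2 <= kappa^2 d]. The second makes the logarithm in [delta] large enough
    once [d >= 3]. *)
Lemma Sigma_le : Sigma <= kappa * d%:R /\ d%:R <= kS ^+ 2.
Proof.
have /andP[g0 g1] := gamma01.
have h1 : Sigma ^+ 2 <= kappa ^+ 2 * d%:R.
  apply: (le_trans (Sigma_sqr_le Vdiag hlip gY mean var)).
  rewrite ler_wpM2l ?sqr_ge0// -[leRHS]powRr1 ?(ltW dR)//; apply: ler_powR => //; lra.
have kk0 : 0 <= kappa ^+ 2 by exact: sqr_ge0.
split.
  have kd0 : 0 <= kappa * d%:R by rewrite mulr_ge0 ?ltW.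
  rewrite -ler_sqr ?nnegrE ?(ltW Sigma0)//; apply: (le_trans h1).
  by rewrite exprMn ler_wpM2l// expr2 ler_peMr ?(ltW dR)// ler1n.
rewrite /kS expr_div_n ler_pdivlMr ?exprn_gt0// exprMn.
rewrite [leLHS]mulrC; apply: (le_trans (ler_wpM2r (ltW dR) h1)).
by rewrite [d%:R ^+ 2]expr2 mulrA.
Qed.

(** Since [kS^2 >= d >= 3 >= e], the factor [2 ln kS] is at least 1, which gives the first bound.
    Then [rho^D <= exp (- gap D) <= kS^-2], so [b D <= kappa d kS^-2], which is [Sigma] times
    [Sigma / (kappa d) <= 1]. *)
Lemma horizon_bounds (D : nat) : 4 * (lam * gamma)^-1 * d%:R * ln kS <= D%:R ->
  gap^-1 <= D%:R /\ b D <= Sigma.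
Proof.
have /andP[g0 g1] := gamma01; have [S1 S2] := Sigma_le.
have kS0 : 0 < kS by rewrite /kS divr_gt0 ?mulr_gt0.
have gi0 : 0 < gap^-1 by rewrite invr_gt0 gap_gt0.
have -> : 4 * (lam * gamma)^-1 * d%:R * ln kS = gap^-1 * (2 * ln kS).
  by rewrite /gap; field; rewrite !gt_eqF.
have ln1 : 1 <= 2 * ln kS.
  have -> : 2 * ln kS = ln (kS ^+ 2) by rewrite lnXn// mulr_natl.
  rewrite -ler_expR lnK ?posrE ?exprn_gt0//.
  by apply: (le_trans expR1_le3); exact: le_trans dge3 S2.
move=> hD; split; first by apply: le_trans hD; rewrite ler_peMr// ltW.
have h1 : rho ^+ D <= (kS ^+ 2)^-1.
  apply: (le_trans (rateX_le D)).
  have -> : (kS ^+ 2)^-1 = expR (- (2 * ln kS)).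
    by rewrite expRN mulr_natl -lnXn// lnK ?posrE// exprn_gt0.
  rewrite ler_expR lerN2.
  have := ler_wpM2l (ltW gap_gt0) hD; rewrite mulrA divff ?mul1r//.
  by rewrite gt_eqF// gap_gt0.
have h2 : d%:R `^ gamma <= d%:R.
  exact: dpow.
rewrite /bound; apply: (@le_trans _ _ (kappa * d%:R * (kS ^+ 2)^-1)).
  apply: ler_pM => //; rewrite ?mulr_ge0 ?powR_ge0 ?exprn_ge0 ?(ltW kappa0) ?(ltW rate_gt0)//.
  by rewrite ler_wpM2l// ltW.
have -> : kappa * d%:R * (kS ^+ 2)^-1 = Sigma * (Sigma / (kappa * d%:R)).
  by rewrite /kS; field; rewrite !gt_eqF.
by rewrite ler_piMr ?(ltW Sigma0)// ler_pdivrMr ?mul1r// mulr_gt0.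
Qed.

(** The second marginal of [Q] is [P]. Measurability of [A] is recovered by composing [B] with the
    diagonal map. *)
Lemma transfer_snd (A : T -> R) (B : T * T -> R) : (forall t, B t = A t.2) ->
  L1 Q B -> ('E_P[A] = (Ex Q B)%:E)%E.
Proof.
move=> BA LB; have mB := L1_measurable LB.
have mA : measurable_fun setT A.
  have -> : A = B \o (fun t => (t, t)) by apply/funext => t; rewrite /= BA.
  by apply: measurableT_comp => //; exact: measurable_fun_pair.
rewrite -ExpE// unlock.
apply: (@eq_law_integral R _ _ T (T * T)%type P Q _ R A B EFin) => // C mC.
have mAC : measurable (A @^-1` C) by rewrite -[X in measurable X]setTI; exact: mA.
transitivity (Q (setT `*` (A @^-1` C))).
  rewrite PP_setX// [X in (X * _)%E](_ : _ = 1%E) ?mul1e//.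
  exact: (@probability_setT _ _ _ P).
by congr (PP P _); apply/seteqP; split => t /=; rewrite BA => //; case.
Qed.

End averages.

(** * Return to the original process and its sample space *)

Lemma sum_proc_zero_dev (R : realType) (d : nat) (V : 'M[R]_d) (h : 'cV[R]_d -> R)
    dT (T : measurableType dT) (i : nat -> T -> 'I_d) (g : nat -> T -> R) (m : R) N (t : T * T) :
  \sum_(N <= j < N + N) h (proc V i g j t.2) =
  \sum_(j < N) zero_dev V h i g m 0 (N + j) t + N%:R * m.
Proof.
rewrite -{1}[N]add0n big_addn addnK big_mkord.
rewrite (eq_bigr (fun j : 'I_N => zero_dev V h i g m 0 (N + j) t + m)); last first.
  by move=> j _; rewrite /zero_dev subrK subn0 proc_run addnC.
by rewrite big_split/= sumr_const card_ord mulr_natl.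
Qed.

Theorem theorem5p2 (R : realType) (d : nat) (V : 'M[R]_d) (lam kappa gamma : R)
  (h : 'cV[R]_d -> R)
  (dT : measure_display) (T : measurableType dT) (P : probability T R)
  (i : nat -> T -> 'I_d) (g : nat -> T -> R)
  (Y : T -> 'cV[R]_d) (m Sigma : R) :
  (3 <= d)%N ->
  V^T = V -> (forall k : 'I_d, V k k = 1) ->
  pos_def V -> smallest_eigenvalue V lam ->
  iid_model P i g ->
  0 < kappa -> 0 < gamma <= 1 ->
  gauss_lipschitz kappa gamma V h ->
  centered_gaussian_vec P Y -> cov P Y = V ->
  'E_P[h \o Y]%E = m%:E ->
  'V_P[h \o Y]%E = (Sigma ^+ 2)%:E -> 0 < Sigma ->
  let kappa' := 2 * kappa * d%:R `^ (1 + gamma) / (lam * gamma) in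
  let delta : int :=
    Num.ceil (4 * (lam * gamma)^-1 * d%:R * ln (kappa * d%:R / Sigma)) in
  forall n : nat, (0 < n)%N -> ~~ odd n ->
  let A := fun t : T =>
    (\sum_(n./2 <= j < n) h (proc V i g j t)) / (n./2)%:R - m in
  (`| 'E_P[A] | <=
     (2 * kappa' * expR (- (lam * gamma * n%:R / (4 * d%:R))) / n%:R)%R%:E)%E
  /\
  (2 * (delta%:~R : R) < n%:R ->
   ('E_P[fun t => (A t ^+ 2)%R] <= (34 * delta%:~R * Sigma ^+ 2 / n%:R)%R%:E)%E).
Proof.
move=> d3 Vsym Vdiag Vpos Vlam model kappa0 gamma01 hlip cY covY mean var Sigma0.
move=> kappa' delta n n0 nodd A.
have gY : gaussian_vec P Y V by rewrite -covY; exact: centered_gaussian_vecP.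
have dR : 0 < d%:R :> R by rewrite ltr0n (leq_trans _ d3).
have l0 : 0 < lam by exact: (lam_gt0 Vsym Vpos Vlam).
have /andP[g0 g1] := gamma01.
set N := n./2 in A *.
have nE : n = (N + N)%N by rewrite addnn -[LHS]odd_double_half (negbTE nodd) add0n.
have N0 : (0 < N)%N by move: n0; rewrite nE; case: (N).
have NR : 0 < N%:R :> R by rewrite ltr0n.
have nR : n%:R = 2 * N%:R :> R by rewrite {1}nE natrD; ring.
pose B := @zero_avg R d V h dT T i g m N.
have BA t : B t = A t.2.
  have := sum_proc_zero_dev V h i g m N t; rewrite -nE => e.
  rewrite /A e /B /zero_avg mulrDl [N%:R * m]mulrC mulfK ?addrK//.
  by rewrite gt_eqF.
have LB : L2 (PP P) B by eapply zero_avg_L2; eassumption.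
split.
  rewrite (transfer_snd BA (L2_L1 LB)) abse_EFin lee_fin.
  have h1 : `|Ex (PP P) B| <=
     kappa * d%:R `^ gamma * (@rate R d lam gamma) ^+ N / (@gap R d lam gamma) / N%:R.
    by eapply zero_avg_Ex_le; eassumption.
  apply: (le_trans h1).
  have gp : 0 < @gap R d lam gamma by rewrite /gap divr_gt0 ?mulr_gt0.
  have h2 : (@rate R d lam gamma) ^+ N <= expR (- (@gap R d lam gamma * N%:R)).
    by eapply rateX_le; eassumption.
  apply: (@le_trans _ _ (kappa * d%:R `^ gamma * expR (- (@gap R d lam gamma * N%:R)) / (@gap R d lam gamma) / N%:R)).
    rewrite !ler_wpM2r ?invr_ge0 ?(ltW gp) ?(ltW NR)//.
    by rewrite ler_wpM2l// mulr_ge0 ?powR_ge0 ?ltW.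
  rewrite (_ : - (lam * gamma * n%:R / (4 * d%:R)) = - (@gap R d lam gamma * N%:R)); last first.
    by rewrite nR /gap; field; rewrite gt_eqF.
  (* Since [1 / gap = 2 d / (lam gamma)] and [n = 2 N], the two sides are equal. *)
  rewrite /kappa' powRD; last by rewrite (gt_eqF dR) implybT.
  rewrite powRr1 ?(ltW dR)// nR /gap le_eqVlt; apply/orP; left; apply/eqP.
  by field; rewrite !gt_eqF.
move=> hn.
have [S1 S2] : Sigma <= kappa * d%:R /\ d%:R <= (kappa * d%:R / Sigma) ^+ 2.
  by eapply Sigma_le; eassumption.
have kS1 : 1 <= kappa * d%:R / Sigma by rewrite ler_pdivlMr// mul1r.
set c := 4 * (lam * gamma)^-1 * d%:R * ln (kappa * d%:R / Sigma) in delta hn *.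
have c0 : 0 <= c by apply: mulr_ge0; [apply: mulr_ge0; [apply: mulr_ge0; rewrite ?invr_ge0 ?mulr_ge0 ?(ltW l0) ?(ltW g0)|exact: ltW]|exact: ln_ge0].
have cd : c <= delta%:~R by exact: ceil_ge.
(* The ceiling is an integer; being nonnegative it can be used as the natural lag [D]. *)
have delta0 : 0 <= delta by rewrite -(ler0z R) (le_trans c0).
have dE : delta%:~R = `|delta|%N%:R :> R by rewrite -[in LHS](gez0_abs delta0) -pmulrn.
set D := `|delta|%N in dE.
have [hD1 hD2] : (@gap R d lam gamma)^-1 <= D%:R /\ @bound R d lam kappa gamma D <= Sigma.
  by rewrite dE in cd; eapply horizon_bounds; eassumption.
have DN : (D < N)%N.
  by move: hn; rewrite dE nR ltr_pM2l// ltr_nat.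
have LB2 : L1 (PP P) (fun t => B t ^+ 2) by case: LB.
rewrite (@transfer_snd R dT T P (fun t => A t ^+ 2) (fun t => B t ^+ 2)) //; last first.
  by move=> t; rewrite BA.
rewrite lee_fin dE.
have h3 : Ex (PP P) (fun t => B t ^+ 2) <= 10 * D%:R * Sigma ^+ 2 / N%:R.
  by eapply (@zero_avg_Ex2_le R d V lam kappa gamma h dT T P i g Y m Sigma); eassumption.
apply: (le_trans h3); rewrite nR.
have p0 : 0 <= D%:R * Sigma ^+ 2 / N%:R by rewrite divr_ge0 ?(ltW NR)// mulr_ge0 ?sqr_ge0.
rewrite (_ : 10 * D%:R * Sigma ^+ 2 / N%:R = 10 * (D%:R * Sigma ^+ 2 / N%:R)); last by ring.
(* In terms of [N = n / 2] the constant 34 becomes 17, above the 10 obtained. *)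
rewrite (_ : 34 * D%:R * Sigma ^+ 2 / (2 * N%:R) = 17 * (D%:R * Sigma ^+ 2 / N%:R)); last first.
  by field; rewrite gt_eqF.
lra.
Qed.
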